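(* Let $f(z)$ be a transcendental entire function, and let $k\ge 1$ and $n\ge 2$ be integers. Suppose that $f^{(k)}(z)/f(z)^n$ is a periodic function with period $c$, and that one of the following holds: (i) $f(z)$ has the value $0$ as a Picard exceptional value, and $\rho_2(f)<\infty$; (ii) $f(z)$ has a non-zero (finite) Picard exceptional value. Then $f(z)$ is a periodic function of period $c$, $2c$ or $(n-1)c$.
   Context: The hyper-order of an entire function $f$ is $\rho_2(f)=\limsup_{r\to\infty}\frac{\log\log T(r,f)}{\log r}$, where $T(r,f)$ is the Nevanlinna characteristic function. A finite Picard exceptional value of $f$ is a $d\in\mathbb{C}$ that $f$ omits, i.e. $f(z)\ne d$ for all $z\in\mathbb{C}$ (equivalently, $f=e^{h}+d$ with $h$ entire). A meromorphic function $F$ is periodic of period $c$ ($c\in\mathbb{C}\setminus\{0\}$) if $F(z+c)=F(z)$ identically; $c$ need not be a minimal period. *)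

(* Defs.v *)
From mathcomp Require Import all_boot all_order all_algebra.
From mathcomp Require Import all_classical all_reals all_analysis.
From mathcomp Require Import complex.
Set Implicit Arguments.
Unset Strict Implicit.
Unset Printing Implicit Defensive.
Import Order.TTheory GRing.Theory Num.Theory.
Import numFieldNormedType.Exports.
Local Open Scope ring_scope.

                                                                                 
                                                                                
                                                                               
                                                                          
Definition C (R : realType) : numFieldType := R[i].

Section Defs.
Variable R : realType.
Implicit Types (f g h : C R -> C R) (c d : C R) (r : R).

Definition entire f : Prop := forall z : C R, derivable f z 1.

Definition transcendental_entire f : Prop :=
  entire f /\ ~ (exists p : {poly C R}, forall z : C R, f z = p.[z]).

Definition picard_exceptional f d : Prop := forall z : C R, f z != d.

                                                                              
                                                                              
                                                                            
                                                                            
                                                                            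
                 
Definition quotient_periodic g h c : Prop :=
  forall z : C R, h z != 0 -> h (z + c) != 0 ->
    g (z + c) / h (z + c) = g z / h z.

Definition logplus (x : R) : R := Num.max 0 (ln x).

Definition circle_pt r (t : R) : C R := Complex (r * cos t) (r * sin t).

                                                                      
Definition proximity f r : R :=
  (2 * pi)^-1 *
    (\int[lebesgue_measure]_(t in `[0%R, (2 * pi)%R]%classic)
       logplus (complex.Re `|f (circle_pt r t)|))%R.

                                                                               
                                                          
Definition nevanlinna_char f r : R := proximity f r.

                                                                           
                                                      
Definition hyper_order f : \bar R :=
  limf_esup (fun r : R => (ln (ln (nevanlinna_char f r)) / ln r)%:E)
            (pinfty_nbhs R).

End Defs.

(* Main.v *)
(* Write f = d + G with G = exp h omitting 0.  Everything rests on the circle means <.>_r: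
   a function is "small" when log M(r, .) = O(log gauge(r, s)) for all r < s, the gauge being
   built from <|Re h|>_s; h and hence h' and all differential polynomials in h' are small, by
   the coefficient bound |h_m| r^m <= 4 <|Re h|>_r and Cauchy's estimate.  Jensen's inequality
   turns an identity expressing exp h as a quotient of small functions into
   <|Re h|>_r = O(log gauge(r, s)) for all r < s, which is impossible: iterating along radii
   with summable gaps makes <|Re h|> blow up at a finite radius.  This replaces the lemma on the
   logarithmic derivative and the Borel growth lemma.

   d <> 0: logarithmic differentiation of P G (G1 + d)^n = P1 G1 (G + d)^n, where G1, P1 are the
   shifts by c of G and P = f^(k)/G, gives a relation a G G1 + b G1 + c G + e = 0 with small
   coefficients.  Eliminating G1 gives a quadratic equation for G, whose coefficients must
   vanish; so a = e = 0 or b = c = 0, i.e. G1 = G or G G1 = d^2.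

   d = 0: E = f(. + c)/f satisfies P(. + c) = P E^(n-1) with P = f^(k)/f.  Finite hyper-order
   gives P finite order, hence E = exp g with g a polynomial by Jensen.  As h'(. + c) - h' = g',
   iterated differences of P vanish; if g were not constant, the term of the N-th difference
   carrying the most factors E would dominate along a ray where Re g -> +oo.  So E is constant,
   and E^(n-1) = 1.

   Entire functions are only assumed complex differentiable, so the local theory is built from
   Goursat's theorem, applied on rectangles to f(e^w) e^(-mw) to make the Fourier coefficients
   of f on circles independent of the radius; the Taylor expansion follows from a positive
   kernel. *)
Require Import Defs.
From mathcomp Require Import all_boot all_order all_algebra.
From mathcomp Require Import all_classical all_reals all_analysis.
From mathcomp Require Import complex ring lra zify.
Set Implicit Arguments.
Unset Strict Implicit.
Unset Printing Implicit Defensive.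
Import Order.TTheory GRing.Theory Num.Theory.
Import numFieldNormedType.Exports.
Local Open Scope classical_set_scope.
Local Open Scope ring_scope.

(** * The complex plane *)

(** Three constraints shape the argument. Estimates must hold for all [r < s], with an explicit loss
    in [s - r], so that they can be composed freely: no exceptional set of radii is ever carried
    along. A function such as [ln |U|] is singular at the zeros of [U], so Jensen's inequality is
    proved for logarithms truncated from below, with a constant independent of the level. And of an
    exponential only two facts are kept, its modulus [expR (Re h)] and its logarithmic derivative
    [h']. For [d != 0] neither of [G], [G1] is known beforehand to dominate the other. The four-term
    relation is a Moebius relation between them with determinant [d^2 Q^2 h' h1'], where
    [Q = n P P1]; since it is not identically zero, a bound for one of them passes to the other, and
    both are then refuted together. For [d = 0] this determinant vanishes and the relation carries
    no such information, which is why that case goes through finite differences. Vanishing arguments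
    rest on the order of vanishing at a point: a product of nonzero entire functions is nonzero. *)

Section ComplexPlane.
Variable R : realType.
Implicit Types (z w : C R) (f g : C R -> C R).

(** The norm of [C R] takes values in [C R] itself; [nm] is the modulus as a real number. *)
Definition nm z : R := complex.Re `|z|.
Definition rC (x : R) : C R := Complex x 0.

Lemma nmE z : `|z| = rC (nm z).
Proof. by case: z => a b; rewrite /nm normc_def. Qed.

Lemma nm_sqrt (a b : R) : nm (Complex a b) = Num.sqrt (a ^+ 2 + b ^+ 2).
Proof. by rewrite /nm normc_def. Qed.

Lemma rC_lt (x y : R) : (rC x < rC y) = (x < y).
Proof. by rewrite /rC ltcE /= eqxx. Qed.
Lemma rC_le (x y : R) : (rC x <= rC y) = (x <= y).
Proof. by rewrite /rC lecE /= eqxx. Qed.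

Lemma rC_inj : injective rC. Proof. by move=> x y []. Qed.
Lemma rC0 : rC 0 = 0. Proof. by []. Qed.
Lemma rCD x y : rC (x + y) = rC x + rC y.
Proof. exact: (rmorphD (real_complex R)). Qed.
Lemma rCB x y : rC (x - y) = rC x - rC y.
Proof. exact: (rmorphB (real_complex R)). Qed.
Lemma rCM x y : rC (x * y) = rC x * rC y.
Proof. exact: (rmorphM (real_complex R)). Qed.
Lemma rCX x n : rC (x ^+ n) = rC x ^+ n.
Proof. exact: (rmorphXn (real_complex R)). Qed.
Lemma rC_nat n : rC n%:R = n%:R.
Proof. exact: (rmorph_nat (real_complex R)). Qed.
Lemma rCV x : rC x^-1 = (rC x)^-1.
Proof. exact: (fmorphV (real_complex R)). Qed.

Lemma nm_ge0 z : 0 <= nm z.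
Proof. by rewrite -rC_le -nmE; exact: normr_ge0. Qed.
Lemma nm0 : nm 0 = 0. Proof. by rewrite /nm normr0. Qed.
Lemma nm1 : nm 1 = 1. Proof. by rewrite /nm normr1. Qed.
Lemma nmN z : nm (- z) = nm z. Proof. by rewrite /nm normrN. Qed.
Lemma nmBC z w : nm (z - w) = nm (w - z). Proof. by rewrite /nm distrC. Qed.
Lemma nmM z w : nm (z * w) = nm z * nm w.
Proof. by apply: rC_inj; rewrite rCM -!nmE normrM. Qed.
Lemma nmX z n : nm (z ^+ n) = nm z ^+ n.
Proof. by apply: rC_inj; rewrite rCX -!nmE normrX. Qed.
Lemma nmV z : nm z^-1 = (nm z)^-1.
Proof. by apply: rC_inj; rewrite rCV -!nmE normfV. Qed.
Lemma nmD z w : nm (z + w) <= nm z + nm w.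
Proof. by rewrite -rC_le rCD -!nmE ler_normD. Qed.
Lemma nmB z w : nm (z - w) <= nm z + nm w.
Proof. by rewrite -(nmN w) nmD. Qed.
Lemma nm_sum n (F : nat -> C R) :
  nm (\sum_(i < n) F i) <= \sum_(i < n) nm (F i).
Proof.
elim: n => [|n IH]; first by rewrite !big_ord0 nm0.
by rewrite !big_ord_recr /= (le_trans (nmD _ _)) // lerD2r.
Qed.
Lemma nm_eq0 z : (nm z == 0) = (z == 0).
Proof.
by apply/eqP/eqP => [h|->]; [apply/eqP; rewrite -normr_eq0 nmE h|rewrite nm0].
Qed.
Lemma nm_gt0 z : (0 < nm z) = (z != 0).
Proof. by rewrite lt_def nm_ge0 andbT nm_eq0. Qed.
Lemma nm_rC x : nm (rC x) = `|x|.
Proof. by rewrite nm_sqrt expr0n /= addr0 sqrtr_sqr. Qed.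
Lemma nm_nat n : nm n%:R = n%:R.
Proof. by rewrite -rC_nat nm_rC normr_nat. Qed.
Lemma nm_dist z w : nm z - nm w <= nm (z - w).
Proof. by rewrite lerBlDr; apply: le_trans (nmD _ _); rewrite subrK. Qed.

Lemma Re_nm z : `|complex.Re z| <= nm z.
Proof.
case: z => a b; rewrite nm_sqrt /= -sqrtr_sqr ler_wsqrtr // lerDl sqr_ge0 //.
Qed.
Lemma Im_nm z : `|complex.Im z| <= nm z.
Proof.
case: z => a b; rewrite nm_sqrt /= -sqrtr_sqr ler_wsqrtr // lerDr sqr_ge0 //.
Qed.
Lemma nm_le_ReIm z : nm z <= `|complex.Re z| + `|complex.Im z|.
Proof.
case: z => a b; have -> : Complex a b = rC a + Complex 0 b :> C R.
  by congr Complex; rewrite ?addr0 ?add0r.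
apply: le_trans (nmD _ _) _; rewrite nm_rC nm_sqrt expr0n /= add0r sqrtr_sqr.
by rewrite !(addr0, add0r).
Qed.

Lemma ReD z w : complex.Re (z + w) = complex.Re z + complex.Re w.
Proof. by case: z w => [a b] [c d]. Qed.
Lemma ImD z w : complex.Im (z + w) = complex.Im z + complex.Im w.
Proof. by case: z w => [a b] [c d]. Qed.
Lemma ReN z : complex.Re (- z) = - complex.Re z.
Proof. by case: z => [a b]. Qed.
Lemma ImN z : complex.Im (- z) = - complex.Im z.
Proof. by case: z => [a b]. Qed.
Lemma ReM z w : complex.Re (z * w) =
  complex.Re z * complex.Re w - complex.Im z * complex.Im w.
Proof. by case: z w => [a b] [c d]. Qed.
Lemma ImM z w : complex.Im (z * w) =
  complex.Re z * complex.Im w + complex.Im z * complex.Re w.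
Proof. by case: z w => [a b] [c d]. Qed.
Lemma C_eq z w : complex.Re z = complex.Re w -> complex.Im z = complex.Im w ->
  z = w.
Proof. by case: z w => [a b] [c d] /= -> ->. Qed.

Lemma pos_rC (e : C R) : 0 < e -> exists2 r : R, 0 < r & e = rC r.
Proof.
case: e => a b; rewrite ltcE /= => /andP[/eqP -> a0].
by exists a.
Qed.

Lemma ball_nm z w (r : R) : ball z (rC r) w = (nm (w - z) < r) :> Prop.
Proof. by rewrite -ball_normE /ball_ /= nmE rC_lt nmBC. Qed.

Lemma ccontP (f : C R -> C R) z : {for z, continuous f} <->
  forall e : R, 0 < e -> exists2 d : R, 0 < d &
    forall w, nm (w - z) < d -> nm (f w - f z) < e.
Proof.
split.
- move=> cf e e0; move/cvgrPdist_lt: cf => /(_ (rC e)).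
  rewrite -rC0 rC_lt => /(_ e0) /nbhs_ballP[d /= d0 H].
  have [r r0 dr] := pos_rC d0; exists r => // w wz.
  have Hb : ball z d w by rewrite dr ball_nm.
  by have := H w Hb; rewrite /= nmE rC_lt nmBC.
- move=> H; suff : f w @[w --> z] --> f z by [].
  apply/(@cvgrPdist_lt _ _ _ (nbhs z) (nbhs_filter z)) => e e0; have [r r0 ->] := pos_rC e0.
  have [d d0 Hd] := H r r0; apply/nbhs_ballP; exists (rC d) => /=.
    by rewrite -rC0 rC_lt.
  move=> w; rewrite ball_nm => /Hd.
  by rewrite nmE rC_lt nmBC.
Qed.

Definition cdiff f z l := forall e : R, 0 < e -> exists2 d : R, 0 < d &
    forall h, nm h < d -> nm (f (z + h) - f z - l * h) <= e * nm h.

Lemma diffq f z l (h : C R) : h != 0 ->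
  h^-1 *: (f (h *: (1 : C R) + z) - f z) - l = (f (z + h) - f z - l * h) / h.
Proof.
move=> h0; have -> : h *: (1 : C R) + z = z + h by rewrite /GRing.scale /= mulr1 addrC.
by rewrite /GRing.scale /=; field.
Qed.

Lemma cdiff_derivable f z l : cdiff f z l <-> is_derive z 1 f l.
Proof.
split=> [H|].
- suff : (fun h : C R => h^-1 *: (f (h *: (1 : C R) + z) - f z)) @ 0^' --> l.
    move=> cl; apply: DeriveDef; first by apply/cvg_ex; exists l.
    by rewrite /derive; apply: cvg_lim.
  apply/cvgrPdist_le => e e0; have [r r0 ->] := pos_rC e0.
  have [d d0 Hd] := H r r0; apply/nbhs_ballP; exists (rC d) => /=.
    by rewrite -rC0 rC_lt.
  move=> h; rewrite ball_nm subr0 => hd hn0.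
  rewrite nmE rC_le (nmBC l) diffq // nmM nmV ler_pdivrMr ?nm_gt0 //; exact: Hd.
- case=> cl Dl e e0; rewrite /derivable -/(derive f z 1) Dl in cl.
  move/cvgrPdist_le: cl => /(_ (rC e)).
  rewrite -rC0 rC_lt => /(_ e0) /nbhs_ballP[d /= d0 H].
  have [r r0 dr] := pos_rC d0; exists r => // h hd.
  have [->|hn0] := eqVneq h 0; first by rewrite mulr0 addr0 subrr subr0 nm0 mulr0.
  have := H h; rewrite dr ball_nm subr0 => /(_ hd hn0).
  by rewrite nmE rC_le (nmBC l) diffq // nmM nmV ler_pdivrMr ?nm_gt0.
Qed.

Lemma cdiff_derive f z l : cdiff f z l -> derivable f z 1 /\ derive1 f z = l.
Proof. by move=> /cdiff_derivable[dz dl]; rewrite derive1E. Qed.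

Lemma derivable_cdiff f z : derivable f z 1 -> cdiff f z (derive1 f z).
Proof. by move=> h; apply/cdiff_derivable; rewrite derive1E; apply/derivableP. Qed.

Lemma cdiff_cont f z l : cdiff f z l -> {for z, continuous f}.
Proof.
move=> /cdiff_derive[dz _]; apply: differentiable_continuous.
exact/derivable1_diffP.
Qed.

Lemma cdiff_comp f g z l m : cdiff g z m -> cdiff f (g z) l ->
  cdiff (f \o g) z (l * m).
Proof.
move=> Hg Hf e e0.
have lm : 0 < 1 + nm l + nm m by rewrite -addrA ltr_pwDl // addr_ge0 // nm_ge0.
(* With [k] the increment of [g], the error is at most [e1 * nm k + nm l * (e1 * nm h)] and
   [nm k <= (1 + nm m) * nm h], which adds up to [e1 * (1 + nm l + nm m) * nm h]. *)
pose e1 := Num.min 1 (e / 2 / (1 + nm l + nm m)).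
have e10 : 0 < e1 by rewrite lt_min ltr01 /= !divr_gt0.
have e1e : e1 * (1 + nm l + nm m) <= e / 2.
  by rewrite -ler_pdivlMr // /e1 ge_min lexx orbT.
have e11 : e1 <= 1 by rewrite /e1 ge_min lexx.
have [d1 d10 H1] := Hf _ e10.
have [d2 d20 H2] := Hg _ e10.
exists (Num.min d2 (d1 / (1 + nm l + nm m))).
  by rewrite lt_min d20 divr_gt0.
move=> h; rewrite lt_min => /andP[hd2]; rewrite ltr_pdivlMr // => hd1.
have Hk := H2 _ hd2; pose k := g (z + h) - g z.
have kle : nm k <= (1 + nm m) * nm h.
  have -> : k = (g (z + h) - g z - m * h) + m * h by rewrite /k; ring.
  apply: le_trans (nmD _ _) _; rewrite nmM mulrDl mul1r lerD2r.
  by apply: le_trans Hk _; rewrite ler_piMl // nm_ge0.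
have kd : nm k < d1.
  apply: le_lt_trans kle (le_lt_trans _ hd1).
  rewrite mulrC ler_wpM2l ?nm_ge0 //; have := nm_ge0 l; lra.
have := H1 _ kd; rewrite /comp; have -> : g z + k = g (z + h) by rewrite /k; ring.
move=> Hfk.
have -> : f (g (z + h)) - f (g z) - l * m * h =
  (f (g (z + h)) - f (g z) - l * k) + l * (k - m * h) by rewrite /k; ring.
apply: le_trans (nmD _ _) _; rewrite nmM.
have p1 : nm (k - m * h) <= e1 * nm h by [].
have p2 : nm (f (g (z + h)) - f (g z) - l * k) <= e1 * ((1 + nm m) * nm h).
  by apply: le_trans Hfk _; rewrite ler_wpM2l // ltW.
have p3 : nm l * nm (k - m * h) <= nm l * (e1 * nm h) by rewrite ler_wpM2l ?nm_ge0.
have : e1 * (1 + nm l + nm m) * nm h <= e / 2 * nm h by rewrite ler_wpM2r ?nm_ge0.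
have : 0 <= e * nm h by rewrite mulr_ge0 ?nm_ge0 // ltW.
nra.
Qed.

End ComplexPlane.

(** * The exponential; curves in the plane *)

Section Exponential.
Variable R : realType.
Implicit Types (z w : C R) (f g : C R -> C R) (u v : R -> C R).

Lemma real_derive_eps (F : R -> R) (x l : R) : is_derive x 1 F l ->
  forall e : R, 0 < e -> exists2 d : R, 0 < d &
    forall h, `|h| < d -> `|F (x + h) - F x - l * h| <= e * `|h|.
Proof.
case=> cl Dl e e0; rewrite /derivable -/(derive F x 1) Dl in cl.
move/cvgrPdist_le: cl => /(_ e e0) /nbhs_ballP[d /= d0 H].
exists d => // h hd.
have [->|hn0] := eqVneq h 0; first by rewrite mulr0 addr0 subrr subr0 normr0 mulr0.
have Hb : ball (0 : R) d h by rewrite -ball_normE /ball_ /= sub0r normrN.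
have := H h Hb hn0.
have -> : h *: (1 : R) + x = x + h by rewrite /GRing.scale /= mulr1 addrC.
rewrite distrC /GRing.scale /=.
have -> : h^-1 * (F (x + h) - F x) - l = (F (x + h) - F x - l * h) / h by field.
by rewrite normrM normfV ler_pdivrMr // normr_gt0.
Qed.

Definition cexp z : C R :=
  Complex (expR (complex.Re z) * cos (complex.Im z))
          (expR (complex.Re z) * sin (complex.Im z)).

Lemma cexpD z w : cexp (z + w) = cexp z * cexp w.
Proof.
apply: C_eq; rewrite ?ReM ?ImM /cexp /= ReD ImD expRD ?cosD ?sinD; ring.
Qed.

Lemma nm_cexp z : nm (cexp z) = expR (complex.Re z).
Proof.
rewrite /cexp nm_sqrt !exprMn -mulrDr cos2Dsin2 mulr1 sqrtr_sqr ger0_norm //.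
Qed.

Lemma cexp_neq0 z : cexp z != 0.
Proof. by rewrite -nm_gt0 nm_cexp expR_gt0. Qed.

Lemma cexp0 : cexp 0 = 1.
Proof. by apply: C_eq; rewrite /cexp /= ?expR0 ?cos0 ?sin0; ring. Qed.

Lemma cexpN z : cexp (- z) = (cexp z)^-1.
Proof.
by apply: (mulfI (cexp_neq0 z)); rewrite -cexpD subrr cexp0 divff ?cexp_neq0.
Qed.

Lemma cexpMn z n : cexp (n%:R * z) = cexp z ^+ n.
Proof.
elim: n => [|n IH]; first by rewrite mul0r cexp0 expr0.
by rewrite -addn1 natrD mulrDl mul1r cexpD IH addn1 exprSr.
Qed.

Lemma cdiff_cexp0 : cdiff cexp 0 1.
Proof.
(* The real part costs [3 * e1 * nm h] and the imaginary part [4 * e1 * nm h], hence the 7. *)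
move=> e e0; have [e1 e10 e1e] : exists2 e1 : R, 0 < e1 & 7 * e1 <= e.
  by exists (e / 7); [rewrite divr_gt0|lra].
have [d1 d10 H1] := real_derive_eps (is_derive_expR (0 : R)) e10.
have [d2 d20 H2] := real_derive_eps (is_derive_sin (0 : R)) e10.
have [d3 d30 H3] := real_derive_eps (is_derive_cos (0 : R)) e10.
exists (Num.min (Num.min 1 e1) (Num.min d1 (Num.min d2 d3))).
  by rewrite !lt_min ltr01 e10 d10 d20 d30.
move=> h; rewrite !lt_min => /andP[/andP[h1 he]] /and3P[hd1 hd2 hd3].
have ar := Re_nm h; have br := Im_nm h; have r0 := nm_ge0 h.
have a1 := le_lt_trans ar h1; have ae := le_lt_trans ar he.
have a1d := le_lt_trans ar hd1; have b2 := le_lt_trans br hd2.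
have b3 := le_lt_trans br hd3.
have {H1} := H1 _ a1d; have {H2} := H2 _ b2; have {H3} := H3 _ b3.
rewrite !add0r sin0 cos0 expR0 oppr0 mul0r !(subr0, addr0) !mul1r => c_ s_ e_.
apply: le_trans (nm_le_ReIm _) _.
rewrite !(ReD, ImD, ReN, ImN, ReM, ImM) /= !expR0 cos0 sin0.
rewrite !(add0r, mul1r, mulr1, mul0r, subr0, addr0, mulr0).
set a := complex.Re h in ar a1 ae e_ *; set b := complex.Im h in br c_ s_ *.
set r := nm h in ar br r0 *.
have -> : expR a * cos b - 1 - a =
  (expR a - 1 - a) * cos b + (1 + a) * (cos b - 1) by ring.
have -> : expR a * sin b - b =
  (expR a - 1 - a) * sin b + (1 + a) * (sin b - b) + a * b by ring.
have h1a : `|1 + a| <= 2.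
  by rewrite (le_trans (ler_normD _ _)) // normr1 -[leRHS]/(1 + 1) lerD2l ltW.
have q1 : `|(expR a - 1 - a) * cos b| <= e1 * `|a|.
  by rewrite normrM; apply: le_trans (ler_wpM2r _ e_) _ => //;
     rewrite ler_piMr ?cos_max // mulr_ge0 // ltW.
have q2 : `|(expR a - 1 - a) * sin b| <= e1 * `|a|.
  by rewrite normrM; apply: le_trans (ler_wpM2r _ e_) _ => //;
     rewrite ler_piMr ?sin_max // mulr_ge0 // ltW.
have q3 : `|(1 + a) * (cos b - 1)| <= 2 * (e1 * `|b|).
  by rewrite normrM ler_pM.
have q4 : `|(1 + a) * (sin b - b)| <= 2 * (e1 * `|b|).
  by rewrite normrM ler_pM.
have q5 : `|a * b| <= e1 * `|b|.
  by rewrite normrM ler_wpM2r // ltW.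
have p1 := ler_normD ((expR a - 1 - a) * cos b) ((1 + a) * (cos b - 1)).
have p2 := ler_normD ((expR a - 1 - a) * sin b + (1 + a) * (sin b - b)) (a * b).
have p3 := ler_normD ((expR a - 1 - a) * sin b) ((1 + a) * (sin b - b)).
have k1 : e1 * `|a| <= e1 * r by rewrite ler_wpM2l // ltW.
have k2 : e1 * `|b| <= e1 * r by rewrite ler_wpM2l // ltW.
have k3 : 7 * e1 * r <= e * r by rewrite ler_wpM2r.
lra.
Qed.

Lemma cdiff_cexp z : cdiff cexp z (cexp z).
Proof.
move=> e e0; have zp : 0 < nm (cexp z) by rewrite nm_gt0 cexp_neq0.
have [d d0 H] := cdiff_cexp0 (divr_gt0 e0 zp).
exists d => // h hd; have := H h hd; rewrite add0r cexp0 mul1r cexpD => H1.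
have -> : cexp z * cexp h - cexp z - cexp z * h = cexp z * (cexp h - 1 - h) by ring.
rewrite nmM; apply: le_trans (ler_wpM2l (ltW zp) H1) _.
by rewrite mulrA mulrCA divff ?mulr1 // gt_eqF.
Qed.

(** Continuity through components is what the real integrals of the two parts consume; [rcontP]
    gives the equivalent form with the modulus. *)
Definition rcont u :=
  continuous (fun t => complex.Re (u t)) /\ continuous (fun t => complex.Im (u t)).

Lemma rcontP u : rcont u <-> forall t (e : R), 0 < e ->
  \forall s \near t, nm (u s - u t) < e.
Proof.
split=> [[cr ci] t e e0|H].
- have e2 : 0 < e / 2 by rewrite divr_gt0.
  have /cvgrPdist_lt/(_ _ e2) h1 := cr t; have /cvgrPdist_lt/(_ _ e2) h2 := ci t.
  near=> s; apply: le_lt_trans (nm_le_ReIm _) _; rewrite ReD ImD ReN ImN.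
  rewrite [ltRHS](splitr e) distrC [X in _ + X]distrC ltrD //; near: s.
  + exact: h1.
  + exact: h2.
- split=> t; apply/cvgrPdist_lt => e e0; near=> s.
  + rewrite distrC -ReN -ReD; apply: le_lt_trans (Re_nm _) _; near: s; exact: H.
  + rewrite distrC -ImN -ImD; apply: le_lt_trans (Im_nm _) _; near: s; exact: H.
Unshelve. all: by end_near. Qed.

Lemma rcont_comp f u : continuous f -> rcont u -> rcont (fun t => f (u t)).
Proof.
move=> cf /rcontP cu; apply/rcontP => t e e0.
have [d d0 H] := (ccontP f (u t)).1 (cf (u t)) e e0.
by near=> s; apply: H; near: s; apply: cu.
Unshelve. all: by end_near. Qed.

Lemma rcont_nm u : rcont u -> continuous (fun t => nm (u t)).
Proof.
move=> /rcontP cu t; apply/cvgrPdist_lt => e e0; near=> s.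
rewrite distrC; have : nm (u s - u t) < e by near: s; apply: cu.
apply: le_lt_trans; rewrite ler_norml nm_dist andbT lerNl opprB nmBC.
exact: nm_dist.
Unshelve. all: by end_near. Qed.

Lemma rcont_cst z : rcont (fun _ => z).
Proof. by split=> t; apply: cvg_cst. Qed.
Lemma rcontD u v : rcont u -> rcont v -> rcont (fun t => u t + v t).
Proof.
move=> [a b] [c d]; split=> t.
- by under eq_fun do rewrite ReD; apply: cvgD; [apply: a|apply: c].
- by under eq_fun do rewrite ImD; apply: cvgD; [apply: b|apply: d].
Qed.
Lemma rcontM u v : rcont u -> rcont v -> rcont (fun t => u t * v t).
Proof.
move=> [a b] [c d]; split=> t.
- by under eq_fun do rewrite ReM; apply: cvgB; apply: cvgM;
  [apply: a|apply: c|apply: b|apply: d].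
- by under eq_fun do rewrite ImM; apply: cvgD; apply: cvgM;
  [apply: a|apply: d|apply: b|apply: c].
Qed.
Lemma rcontN u : rcont u -> rcont (fun t => - u t).
Proof.
move=> cu; have := rcontM (rcont_cst (-1)) cu.
by under [X in rcont X -> _]eq_fun do rewrite mulN1r.
Qed.
Lemma rcontX u n : rcont u -> rcont (fun t => u t ^+ n).
Proof.
move=> cu; elim: n => [|n IH]; first exact: rcont_cst.
by under eq_fun do rewrite exprS; apply: rcontM.
Qed.
Lemma rcont_rC (x : R -> R) : continuous x -> rcont (fun t => rC (x t)).
Proof. by move=> cx; split=> t; [apply: cx|apply: cvg_cst]. Qed.
Lemma rcont_circle s : rcont (circle_pt s).
Proof.
split=> t /=; apply: cvgM; (try exact: cvg_cst).
- exact: continuous_cos.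
- exact: continuous_sin.
Qed.

End Exponential.

(** * Integrals of continuous functions *)

Section Integral.
Variable R : realType.
Implicit Types (a b : R) (u v : R -> R) (f g : R -> C R).
Local Notation mu := (@lebesgue_measure R).

Definition rint a b u : R := (\int[mu]_(t in `[a, b]) u t)%R.

Lemma rint_integrable a b u : continuous u -> mu.-integrable `[a, b] (EFin \o u).
Proof.
move=> cu; apply: continuous_compact_integrable; first exact: segment_compact.
exact: continuous_subspaceT.
Qed.

Lemma rintD a b u v : continuous u -> continuous v ->
  rint a b (fun t => u t + v t) = rint a b u + rint a b v.
Proof. by move=> cu cv; apply: RintegralD => //; apply: rint_integrable. Qed.

Lemma rintZ a b (r : R) u : continuous u ->
  rint a b (fun t => r * u t) = r * rint a b u.
Proof. by move=> cu; apply: RintegralZl => //; apply: rint_integrable. Qed.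

Lemma rint_cst a b (r : R) : a <= b -> rint a b (fun=> r) = r * (b - a).
Proof.
move=> ab; rewrite /rint Rintegral_cst //=; congr (_ * _).
by rewrite lebesgue_measure_itv /= lte_fin; case: ltgtP ab => // -> _; rewrite subrr.
Qed.

Lemma rint_le a b u v : continuous u -> continuous v ->
  (forall t, a <= t <= b -> u t <= v t) -> rint a b u <= rint a b v.
Proof.
move=> cu cv H; apply: le_Rintegral => //; try exact: rint_integrable.
Qed.

Lemma rint_split a m b u : continuous u -> a <= m <= b ->
  rint a b u = rint a m u + rint m b u.
Proof.
move=> cu /andP[am mb].
have := @Rintegral_itvB R u (BLeft a) (BRight b) m (rint_integrable a b cu).
rewrite !bnd_simp => /(_ am mb) /eqP; rewrite subr_eq => /eqP.
rewrite -/(rint a b u) -/(rint a m u) => ->; rewrite addrC; congr (_ + _).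
rewrite /rint -Rintegral_itv_obnd_cbnd //.
by apply: (integrableS _ _ _ (rint_integrable m b cu)) => //; apply: subset_itv_oc_cc.
Qed.

Definition cint a b f : C R :=
  Complex (rint a b (fun t => complex.Re (f t))) (rint a b (fun t => complex.Im (f t))).

Lemma eq_cint a b f g : f =1 g -> cint a b f = cint a b g.
Proof. by move=> fg; have -> : f = g by apply/funext. Qed.

Lemma cintD a b f g : rcont f -> rcont g ->
  cint a b (fun t => f t + g t) = cint a b f + cint a b g.
Proof.
move=> [cf1 cf2] [cg1 cg2]; apply: C_eq; rewrite ?ReD ?ImD /= -rintD //.
  by apply: eq_Rintegral => t _; rewrite ReD.
by apply: eq_Rintegral => t _; rewrite ImD.
Qed.

Lemma cintZ a b (c : C R) f : rcont f ->
  cint a b (fun t => c * f t) = c * cint a b f.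
Proof.
move=> [cf1 cf2]; have cn : forall (r : R) u, continuous u -> continuous (fun t => r * u t).
  by move=> r u cu t; apply: cvgM; [exact: cvg_cst|exact: cu].
apply: C_eq; rewrite ?ReM ?ImM /= -?mulNr -!rintZ // -rintD //;
  try exact: cn; apply: eq_Rintegral => t _; rewrite ?ReM ?ImM; ring.
Qed.

Lemma cintN a b f : rcont f -> cint a b (fun t => - f t) = - cint a b f.
Proof.
move=> cf; rewrite -mulN1r -cintZ //; apply: eq_cint => t.
by rewrite mulN1r.
Qed.

Lemma cintB a b f g : rcont f -> rcont g ->
  cint a b (fun t => f t - g t) = cint a b f - cint a b g.
Proof. by move=> cf cg; rewrite cintD ?cintN //; apply: rcontN. Qed.

Lemma cint_cst a b (c : C R) : a <= b -> cint a b (fun=> c) = c * rC (b - a).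
Proof.
move=> ab; apply: C_eq; rewrite ?ReM ?ImM /= !rint_cst //; ring.
Qed.

Lemma cint_split a m b f : rcont f -> a <= m <= b ->
  cint a b f = cint a m f + cint m b f.
Proof.
by move=> [cf1 cf2] amb; apply: C_eq; rewrite ?ReD ?ImD /=; apply: rint_split.
Qed.

Lemma rint_abs_le a b u (M : R) : continuous u -> a <= b ->
  (forall t, a <= t <= b -> `|u t| <= M) -> `|rint a b u| <= M * (b - a).
Proof.
move=> cu ab H; rewrite ler_norml -mulNr -!rint_cst //.
apply/andP; split; apply: rint_le => //; try (by move=> ?; exact: cvg_cst).
- by move=> t /H; rewrite ler_norml => /andP[].
- by move=> t /H; rewrite ler_norml => /andP[].
Qed.

(** The factor 2 comes from bounding real and imaginary parts separately; it recurs in all estimates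
    built on this one, where constants are harmless. *)
Lemma cint_abs_le a b f (M : R) : rcont f -> a <= b ->
  (forall t, a <= t <= b -> nm (f t) <= M) -> nm (cint a b f) <= 2 * M * (b - a).
Proof.
move=> [cf1 cf2] ab H; apply: le_trans (nm_le_ReIm _) _.
have h1 : `|rint a b (fun t => complex.Re (f t))| <= M * (b - a).
  by apply: rint_abs_le => // t /H; apply: le_trans (Re_nm _).
have h2 : `|rint a b (fun t => complex.Im (f t))| <= M * (b - a).
  by apply: rint_abs_le => // t /H; apply: le_trans (Im_nm _).
by rewrite /=; lra.
Qed.

Lemma cint_near a b f (c : C R) (e : R) : rcont f -> a <= b ->
  (forall t, a <= t <= b -> nm (f t - c) <= e) ->
  nm (cint a b f - c * rC (b - a)) <= 2 * e * (b - a).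
Proof.
move=> cf ab H; rewrite -cint_cst // -cintB //; last exact: rcont_cst.
by apply: cint_abs_le => //; apply: rcontD => //; apply: rcontN; apply: rcont_cst.
Qed.

End Integral.

(** * Goursat's theorem *)

Section Goursat.
Variable R : realType.
Implicit Types (a b c d x y : R).

(** Nested intervals, used both to locate the limit point of Goursat's bisection and to sum power
    series. *)
Lemma sup_between (lo hi : nat -> R) : (forall n m, lo n <= hi m) ->
  exists x, forall n, lo n <= x <= hi n.
Proof.
move=> H; pose S := [set lo n | n in [set: nat]].
have S0 : S !=set0 by exists (lo 0%N), 0%N.
have ub n : ubound S (hi n) by move=> _ [m _ <-].
exists (sup S) => n; apply/andP; split; last by apply: sup_le_ub.
by apply: ub_le_sup; [exists (hi 0%N)|exists n].
Qed.

Variable g : C R -> C R.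
Hypothesis gd : forall z, exists l, cdiff g z l.

Definition pt x y : C R := Complex x y.

Let gcont : continuous g.
Proof. by move=> z; have [l /cdiff_cont] := gd z. Qed.

Lemma rcont_hline y : rcont (fun x => g (pt x y)).
Proof.
apply: rcont_comp gcont _; split=> t /=; [exact: cvg_id|exact: cvg_cst].
Qed.
Lemma rcont_vline x : rcont (fun y => g (pt x y)).
Proof.
apply: rcont_comp gcont _; split=> t /=; [exact: cvg_cst|exact: cvg_id].
Qed.

Let ii : C R := Complex 0 1.

(** The counterclockwise integral of [g] along the boundary of [[a, b] x [c, d]]. *)
Definition rectI a b c d : C R :=
  ii * (cint c d (fun y => g (pt b y)) - cint c d (fun y => g (pt a y))) -
  (cint a b (fun x => g (pt x d)) - cint a b (fun x => g (pt x c))).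

Lemma rectI_splitx a m b c d : a <= m <= b ->
  rectI a b c d = rectI a m c d + rectI m b c d.
Proof.
move=> amb; rewrite /rectI (cint_split (rcont_hline d) amb).
by rewrite (cint_split (rcont_hline c) amb); ring.
Qed.

Lemma rectI_splity a b c m d : c <= m <= d ->
  rectI a b c d = rectI a b c m + rectI a b m d.
Proof.
move=> cmd; rewrite /rectI (cint_split (rcont_vline a) cmd).
by rewrite (cint_split (rcont_vline b) cmd); ring.
Qed.

(** Opposite sides are paired, so that the affine part of [g] contributes only the constants
    [l * (b - a)] and [l * ii * (d - c)] to the two integrands; after integration these
    contributions cancel, and the error terms remain. *)
Lemma rectI_local z l (e s : R) a b c d : 0 <= e ->
  (forall h, nm h < s -> nm (g (z + h) - g z - l * h) <= e * nm h) ->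
  a <= complex.Re z <= b -> c <= complex.Im z <= d -> (b - a) + (d - c) < s ->
  nm (rectI a b c d) <= 8 * e * ((b - a) + (d - c)) ^+ 2.
Proof.
move=> e0 H /andP[az zb] /andP[cz zd] hs; set L := (b - a) + (d - c).
have ab : a <= b := le_trans az zb; have cd : c <= d := le_trans cz zd.
have L0 : 0 <= L by rewrite /L; lra.
have K x y : a <= x <= b -> c <= y <= d ->
  nm (g (pt x y) - g z - l * (pt x y - z)) <= e * L.
  move=> /andP[ax xb] /andP[cy yd].
  have hL : nm (pt x y - z) <= L.
    apply: le_trans (nm_le_ReIm _) _; rewrite ReD ImD ReN ImN /=.
    by apply: lerD; rewrite ler_norml; lra.
  have := H _ (le_lt_trans hL hs); have -> : z + (pt x y - z) = pt x y by ring.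
  by move=> /le_trans; apply; rewrite ler_wpM2l.
have aa : a <= a <= b by rewrite lexx. have bb : a <= b <= b by rewrite lexx ab.
have cc : c <= c <= d by rewrite lexx. have dd : c <= d <= d by rewrite lexx cd.
have V : nm (cint c d (fun y => g (pt b y) - g (pt a y)) - l * rC (b - a) * rC (d - c))
    <= 2 * (2 * (e * L)) * (d - c).
  apply: cint_near => //.
    by apply: rcontD; [exact: rcont_vline|apply: rcontN; exact: rcont_vline].
  move=> y ycd; have := K b y bb ycd; have := K a y aa ycd => h1 h2.
  have -> : g (pt b y) - g (pt a y) - l * rC (b - a) =
    (g (pt b y) - g z - l * (pt b y - z)) - (g (pt a y) - g z - l * (pt a y - z)).
    have -> : rC (b - a) = pt b y - pt a y.
      by apply: C_eq; rewrite !(ReD, ImD, ReN, ImN) /= ?subrr.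
    ring.
  by apply: le_trans (nmB _ _) _; lra.
have W : nm (cint a b (fun x => g (pt x d) - g (pt x c)) - l * ii * rC (d - c) * rC (b - a))
    <= 2 * (2 * (e * L)) * (b - a).
  apply: cint_near => //.
    by apply: rcontD; [exact: rcont_hline|apply: rcontN; exact: rcont_hline].
  move=> x xab; have := K x d xab dd; have := K x c xab cc => h1 h2.
  have -> : g (pt x d) - g (pt x c) - l * ii * rC (d - c) =
    (g (pt x d) - g z - l * (pt x d - z)) - (g (pt x c) - g z - l * (pt x c - z)).
    have -> : l * ii * rC (d - c) = l * (pt x d - pt x c).
      by rewrite -mulrA; congr (_ * _);
       apply: C_eq; rewrite !(ReD, ImD, ReN, ImN, ReM, ImM) /= ; ring.
    ring.
  by apply: le_trans (nmB _ _) _; lra.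
have -> : rectI a b c d = ii *
   (cint c d (fun y => g (pt b y) - g (pt a y)) - l * rC (b - a) * rC (d - c)) -
   (cint a b (fun x => g (pt x d) - g (pt x c)) - l * ii * rC (d - c) * rC (b - a)).
  rewrite /rectI !cintB; try exact: rcont_hline; try exact: rcont_vline.
  ring.
apply: le_trans (nmB _ _) _; rewrite nmM.
have -> : nm ii = 1 by rewrite nm_sqrt expr0n /= add0r expr1n sqrtr1.
rewrite mul1r; apply: le_trans (lerD V W) _.
have -> : 2 * (2 * (e * L)) * (d - c) + 2 * (2 * (e * L)) * (b - a) =
  4 * e * L ^+ 2 by rewrite /L; ring.
have : 0 <= e * L ^+ 2 by rewrite mulr_ge0 // sqr_ge0.
lra.
Qed.

Lemma rectI_bisect a b c d : a <= b -> c <= d ->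
  exists q : R * R * R * R, let: (a', b', c', d') := q in
  [/\ a <= a' /\ b' <= b, c <= c' /\ d' <= d, b' - a' = (b - a) / 2,
      d' - c' = (d - c) / 2 & nm (rectI a b c d) / 4 <= nm (rectI a' b' c' d')].
Proof.
move=> ab cd; pose m := (a + b) / 2; pose p := (c + d) / 2.
have am : a <= m by rewrite /m; lra. have mb : m <= b by rewrite /m; lra.
have cp : c <= p by rewrite /p; lra. have pd : p <= d by rewrite /p; lra.
have := @rectI_splitx a m b c d; rewrite am mb => /(_ isT) E.
have := @rectI_splity a m c p d; rewrite cp pd => /(_ isT) E1.
have := @rectI_splity m b c p d; rewrite cp pd => /(_ isT) E2.
have N : nm (rectI a b c d) <= nm (rectI a m c p) + nm (rectI a m p d) +
   (nm (rectI m b c p) + nm (rectI m b p d)).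
  rewrite E E1 E2; apply: le_trans (nmD _ _) _; apply: lerD; exact: nmD.
have e1 : m - a = (b - a) / 2 by rewrite /m; lra.
have e2 : b - m = (b - a) / 2 by rewrite /m; lra.
have e3 : p - c = (d - c) / 2 by rewrite /p; lra.
have e4 : d - p = (d - c) / 2 by rewrite /p; lra.
have [h1|h1] := leP (nm (rectI a b c d) / 4) (nm (rectI a m c p)).
  by exists (a, m, c, p); split.
have [h2|h2] := leP (nm (rectI a b c d) / 4) (nm (rectI a m p d)).
  by exists (a, m, p, d); split.
have [h3|h3] := leP (nm (rectI a b c d) / 4) (nm (rectI m b c p)).
  by exists (m, b, c, p); split.
exists (m, b, p, d); split => //; lra.
Qed.

Lemma goursat a b c d : a <= b -> c <= d -> rectI a b c d = 0.
Proof.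
move=> ab cd.
pose I (q : R * R * R * R) := let: (a, b, c, d) := q in rectI a b c d.
pose P (q q' : R * R * R * R) :=
  let: (a, b, c, d) := q in let: (a', b', c', d') := q' in
  a <= b -> c <= d -> [/\ a <= a' /\ b' <= b, c <= c' /\ d' <= d,
     b' - a' = (b - a) / 2,
      d' - c' = (d - c) / 2 & nm (rectI a b c d) / 4 <= nm (rectI a' b' c' d')].
(* Inverted rectangles satisfy [P] vacuously, so bisection becomes a total function that can be
   iterated. *)
have /choice[F HF] : forall q, exists q', P q q'.
  move=> -[[[a1 b1] c1] d1].
  have [ab1|ab1] := leP a1 b1; last first.
    by exists (a1, b1, c1, d1) => /= h; move: ab1; rewrite ltNge h.
  have [cd1|cd1] := leP c1 d1; last first.
    by exists (a1, b1, c1, d1) => /= _ h; move: cd1; rewrite ltNge h.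
  by have [[[[a2 b2] c2] d2] H] := rectI_bisect ab1 cd1; exists (a2, b2, c2, d2).
pose Q n := iter n F (a, b, c, d).
pose A n := (Q n).1.1.1; pose B n := (Q n).1.1.2; pose Cc n := (Q n).1.2.
pose Dd n := (Q n).2.
have QE n : Q n = (A n, B n, Cc n, Dd n).
  by rewrite /A /B /Cc /Dd; case: (Q n) => [[[]]].
have step n : A n <= B n -> Cc n <= Dd n -> [/\ A n <= A n.+1 /\ B n.+1 <= B n,
   Cc n <= Cc n.+1 /\ Dd n.+1 <= Dd n, B n.+1 - A n.+1 = (B n - A n) / 2,
   Dd n.+1 - Cc n.+1 = (Dd n - Cc n) / 2 &
   nm (rectI (A n) (B n) (Cc n) (Dd n)) / 4 <=
   nm (rectI (A n.+1) (B n.+1) (Cc n.+1) (Dd n.+1))].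
  by have := HF (Q n); rewrite -[F (Q n)]/(Q n.+1) !QE /=.
have ord n : A n <= B n /\ Cc n <= Dd n.
  elim: n => [//|n [IH1 IH2]]; have [_ _ h1 h2 _] := step n IH1 IH2.
  by split; lra.
have [s1 s2] : (forall n, A n <= A n.+1 /\ B n.+1 <= B n) /\
               (forall n, Cc n <= Cc n.+1 /\ Dd n.+1 <= Dd n).
  by split=> n; have [? ?] := ord n; have [] := step n.
have nest (lo hi : nat -> R) : (forall n, lo n <= hi n) ->
    (forall n, lo n <= lo n.+1 /\ hi n.+1 <= hi n) -> forall n m, lo n <= hi m.
  move=> lh H n m.
  have l1 : lo n <= lo (maxn n m).
    by apply: (homo_leq (@lexx _ _) (@le_trans _ _)) (leq_maxl _ _) => k; case: (H k).
  have h1 : hi (maxn n m) <= hi m.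
    have := @homo_leq _ hi (fun x y => y <= x) (@lexx _ _)
      (fun y x z (h1 : y <= x) (h2 : z <= y) => le_trans h2 h1).
    by apply; [move=> k; case: (H k)|exact: leq_maxr].
  exact: le_trans l1 (le_trans (lh _) h1).
have [x hx] := sup_between (nest A B (fun n => (ord n).1) s1).
have [y hy] := sup_between (nest Cc Dd (fun n => (ord n).2) s2).
pose L n := (B n - A n) + (Dd n - Cc n).
have LE n : L n = L 0%N / 2 ^+ n.
  elim: n => [|n IH]; first by rewrite expr0 divr1.
  have [k1 k2] := ord n; have [_ _ h1 h2 _] := step n k1 k2.
  have -> : L n.+1 = L n / 2 by rewrite /L h1 h2; lra.
  by rewrite IH exprS; field; rewrite expf_neq0.
have IE n : nm (rectI a b c d) / 4 ^+ n <= nm (rectI (A n) (B n) (Cc n) (Dd n)).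
  elim: n => [|n IH]; first by rewrite expr0 divr1.
  have [k1 k2] := ord n; have [_ _ _ _ h] := step n k1 k2.
  apply: le_trans h; rewrite exprS invfM mulrCA mulrC.
  by rewrite ler_pM2r // invr_gt0.
have [l Hl] := gd (pt x y).
apply/eqP; rewrite -nm_eq0 eq_le nm_ge0 andbT leNgt; apply/negP => I0.
have L0 : 0 <= L 0%N by have [? ?] := ord 0%N; rewrite /L; lra.
(* The scales [4 ^ n] cancel and leave [nm (rectI a b c d) <= 8 * e * L 0 ^ 2]; this [e] makes the
   right side at most half of the left. The [+ 1] covers a degenerate rectangle. *)
pose e := nm (rectI a b c d) / (16 * (L 0%N ^+ 2 + 1)).
have D0 : 0 < L 0%N ^+ 2 + 1 by rewrite ltr_wpDl // sqr_ge0.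
have e0 : 0 < e by rewrite divr_gt0 // mulr_gt0.
have [s sp Hs] := Hl e e0.
have [n hn] : exists n, L n < s.
  have := @near_infty_natSinv_expn_lt R (PosNum (divr_gt0 sp (ltr_wpDl L0 (@ltr01 R)))).
  move=> [n _ /(_ n (leqnn _))] /= hn; exists n; rewrite LE.
  move: hn; rewrite div1r ltr_pdivlMr ?ltr_wpDl // mulrC => /(le_lt_trans _); apply.
  by rewrite ler_wpM2r ?invr_ge0 ?exprn_ge0 // lerDl.
have := rectI_local (ltW e0) Hs (hx n) (hy n) hn.
rewrite -/(L n) LE => /(le_trans (IE n)).
rewrite expr_div_n -exprM mulnC exprM.
have -> : (2 : R) ^+ 2 = 4 by rewrite expr2; lra.
rewrite mulrA ler_pM2r ?invr_gt0 ?exprn_gt0 // /e.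
have -> : 8 * (nm (rectI a b c d) / (16 * (L 0%N ^+ 2 + 1))) * L 0%N ^+ 2 =
   nm (rectI a b c d) / 2 * (L 0%N ^+ 2 / (L 0%N ^+ 2 + 1)).
  by field; rewrite gt_eqF.
have : L 0%N ^+ 2 / (L 0%N ^+ 2 + 1) <= 1 by rewrite ler_pdivrMr // mul1r lerDl.
move=> h1 h2.
have := ler_wpM2l (ltW (divr_gt0 I0 (@ltr0Sn R 1))) h1; lra.
Qed.

End Goursat.

(** * Circle means and Fourier coefficients *)

Section CircleMean.
Variable R : realType.
Implicit Types (u v : R -> R) (f g : R -> C R) (r s t x y : R).

Let tpi : R := 2 * pi.
Let tpi0 : 0 < tpi. Proof. by rewrite mulr_gt0 // pi_gt0. Qed.

Definition mean u : R := (2 * pi)^-1 * rint 0 (2 * pi) u.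
Definition cmean f : C R :=
  Complex (mean (fun t => complex.Re (f t))) (mean (fun t => complex.Im (f t))).

Lemma cmeanE f : cmean f = rC (2 * pi)^-1 * cint 0 (2 * pi) f.
Proof. by apply: C_eq; rewrite ?ReM ?ImM /= /mean; ring. Qed.

Lemma eq_mean u v : u =1 v -> mean u = mean v.
Proof. by move=> uv; have -> : u = v by apply/funext. Qed.
Lemma eq_cmean f g : f =1 g -> cmean f = cmean g.
Proof. by move=> uv; have -> : f = g by apply/funext. Qed.

Lemma meanD u v : continuous u -> continuous v ->
  mean (fun t => u t + v t) = mean u + mean v.
Proof. by move=> cu cv; rewrite /mean rintD // mulrDr. Qed.
Lemma meanZ r u : continuous u -> mean (fun t => r * u t) = r * mean u.
Proof. by move=> cu; rewrite /mean rintZ // mulrCA. Qed.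
Lemma mean_cst r : mean (fun=> r) = r.
Proof.
rewrite /mean rint_cst ?ltW // subr0 mulrCA mulVf ?mulr1 //.
by rewrite gt_eqF.
Qed.
Lemma mean_le u v : continuous u -> continuous v -> (forall t, 0 <= t <= 2 * pi -> u t <= v t) ->
  mean u <= mean v.
Proof.
move=> cu cv H; rewrite /mean ler_pM2l ?invr_gt0 //.
by apply: rint_le.
Qed.

Lemma cmeanD f g : rcont f -> rcont g ->
  cmean (fun t => f t + g t) = cmean f + cmean g.
Proof. by move=> cf cg; rewrite !cmeanE cintD // mulrDr. Qed.
Lemma cmeanZ (c : C R) f : rcont f -> cmean (fun t => c * f t) = c * cmean f.
Proof. by move=> cf; rewrite !cmeanE cintZ // mulrCA. Qed.
Lemma cmeanN f : rcont f -> cmean (fun t => - f t) = - cmean f.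
Proof. by move=> cf; rewrite !cmeanE cintN // mulrN. Qed.
Lemma cmean_cst (c : C R) : cmean (fun=> c) = c.
Proof. by apply: C_eq; rewrite /= mean_cst. Qed.
Lemma cmean_sum n (F : nat -> R -> C R) : (forall i, rcont (F i)) ->
  rcont (fun t => \sum_(i < n) F i t) /\
  cmean (fun t => \sum_(i < n) F i t) = \sum_(i < n) cmean (F i).
Proof.
move=> cF; elim: n => [|n [IH1 IH2]].
  split; first by under eq_fun do rewrite big_ord0; apply: rcont_cst.
  by rewrite big_ord0; under eq_cmean do rewrite big_ord0; rewrite cmean_cst.
split; first by under eq_fun do rewrite big_ord_recr /=; apply: rcontD.
by rewrite big_ord_recr /=; under eq_cmean do rewrite big_ord_recr /=;
   rewrite cmeanD // IH2.
Qed.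
Lemma cmean_le f (u : R -> R) : rcont f -> continuous u ->
  (forall t, 0 <= t <= 2 * pi -> nm (f t) <= u t) -> nm (cmean f) <= 2 * mean u.
Proof.
move=> [c1 c2] cu H; apply: le_trans (nm_le_ReIm _) _ => /=.
have K (w : R -> R) : continuous w ->
    (forall t, 0 <= t <= 2 * pi -> `|w t| <= u t) -> `|mean w| <= mean u.
  move=> cw Hw; rewrite ler_norml -mulN1r -meanZ //.
  apply/andP; split; apply: mean_le => // t.
  - by apply: cvgM; [exact: cvg_cst|exact: cu].
  - by move=> /Hw; rewrite mulN1r ler_norml => /andP[].
  - by move=> /Hw; rewrite ler_norml => /andP[].
have h1 := K _ c1 (fun t ht => le_trans (Re_nm _) (H t ht)).
have h2 := K _ c2 (fun t ht => le_trans (Im_nm _) (H t ht)).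
lra.
Qed.
Lemma cmean_bound f (M : R) : rcont f ->
  (forall t, 0 <= t <= 2 * pi -> nm (f t) <= M) ->
  nm (cmean f) <= 2 * M.
Proof.
move=> cf H; rewrite -[M]mean_cst; apply: cmean_le => // t; exact: cvg_cst.
Qed.

Lemma nm_circle s t : nm (circle_pt s t) = `|s|.
Proof.
rewrite nm_sqrt !exprMn -mulrDr cos2Dsin2 mulr1; exact: sqrtr_sqr.
Qed.

Lemma circle_neq0 s t : s != 0 -> circle_pt s t != 0.
Proof. by move=> s0; rewrite -nm_gt0 nm_circle normr_gt0. Qed.

Lemma circle_exp x y : circle_pt (expR x) y = cexp (pt x y).
Proof. by []. Qed.

Lemma circle_inv s t : (circle_pt s t)^-1 = circle_pt s^-1 (- t).
Proof.
have [->|s0] := eqVneq s 0.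
  rewrite invr0; have E (r : R) : circle_pt 0 r = 0 by apply: C_eq; rewrite /= mul0r.
  by rewrite !E invr0.
apply: (mulfI (circle_neq0 t s0)); rewrite divff ?circle_neq0 //.
have q := cos2Dsin2 t.
have ss : s * s^-1 = 1 by rewrite divff.
apply: C_eq; rewrite ?ReM ?ImM /= cosN sinN.
  rewrite (_ : _ - _ = s * s^-1 * (cos t ^+ 2 + sin t ^+ 2)); last by ring.
  by rewrite q ss mul1r.
by ring.
Qed.

Lemma rcont_circleV s : rcont (fun t => (circle_pt s t)^-1).
Proof.
under eq_fun do rewrite circle_inv.
split=> t /=; apply: cvgM; (try exact: cvg_cst).
- under eq_fun do rewrite cosN; rewrite cosN; exact: continuous_cos.
- under eq_fun do rewrite sinN; rewrite sinN; apply: cvgN; exact: continuous_sin.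
Qed.

(** Goursat on a rectangle of height [2 pi]: by periodicity the horizontal sides cancel, so the
    vertical ones agree. *)
Lemma strip_const (G : C R -> C R) : (forall z, exists l, cdiff G z l) ->
  (forall z, G (z + Complex 0 (2 * pi)) = G z) -> forall x x',
  cmean (fun y => G (pt x y)) = cmean (fun y => G (pt x' y)).
Proof.
move=> Gd Gp; suff H x x' : x <= x' ->
    cmean (fun y => G (pt x y)) = cmean (fun y => G (pt x' y)).
  by move=> x x'; have [/H|/ltW/H] := leP x x'.
move=> xx; have := goursat Gd xx (ltW tpi0); rewrite /rectI.
have -> : cint x x' (fun t => G (pt t tpi)) = cint x x' (fun t => G (pt t 0)).
  apply: eq_cint => t; rewrite -[RHS]Gp; congr G.
  by apply: C_eq; rewrite ?ReD ?ImD /= ?addr0 ?add0r.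
rewrite subrr subr0 => /eqP; rewrite mulf_eq0 => /orP[/eqP[] /eqP|].
  by rewrite oner_eq0.
by rewrite subr_eq0 !cmeanE => /eqP ->.
Qed.

End CircleMean.

(** * Fourier coefficients on circles and their independence of the radius *)

Section Coefficients.
Variable R : realType.
Implicit Types (f g : C R -> C R) (s : R).

(** Dividing by the full power of the point, and not only by its unimodular part, yields the Taylor
    coefficient itself, without a factor [s ^ m]. *)
Definition coefc f s m : C R :=
  cmean (fun t => f (circle_pt s t) * (circle_pt s t)^-1 ^+ m).

Lemma entire_cdiff f : entire f -> forall z, cdiff f z (derive1 f z).
Proof. by move=> ef z; apply: derivable_cdiff. Qed.

Lemma cdiff_entire f : (forall z, exists l, cdiff f z l) -> entire f.
Proof. by move=> H z; have [l /cdiff_derive[]] := H z. Qed.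

Lemma entire_cont f : entire f -> continuous f.
Proof. by move=> ef z; exact: cdiff_cont (entire_cdiff ef z). Qed.

Lemma rcont_coefc f s m : continuous f ->
  rcont (fun t => f (circle_pt s t) * (circle_pt s t)^-1 ^+ m).
Proof.
move=> cf; apply: rcontM; first exact/rcont_comp/rcont_circle.
exact/rcontX/rcont_circleV.
Qed.

Lemma cexp2pi : cexp (Complex 0 (2 * pi)) = 1 :> C R.
Proof.
apply: C_eq; rewrite /= expR0 mul1r mulrC mulr_natr ?cos2pi ?sin2pi //.
Qed.

Let stripd f (k : C R) : entire f ->
  forall z, exists l, cdiff (fun w => f (cexp w) * cexp (k * w)) z l.
Proof.
move=> ef z.
have d1 := cdiff_comp (cdiff_cexp z) (entire_cdiff ef (cexp z)).
have dk : cdiff (fun w => k * w) z k.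
  move=> e e0; exists 1 => // h _.
  rewrite (_ : _ - _ - _ = 0); last by ring.
  by rewrite nm0 mulr_ge0 ?nm_ge0 // ltW.
have d2 := cdiff_comp dk (cdiff_cexp (k * z)).
have [e1 _] := cdiff_derive d1; have [e2 _] := cdiff_derive d2.
have := derivableM e1 e2.
by move=> /derivable_cdiff H; eexists; exact: H.
Qed.

Let stripper f (k : C R) : cexp (k * Complex 0 (2 * pi)) = 1 ->
  forall z, f (cexp (z + Complex 0 (2 * pi))) * cexp (k * (z + Complex 0 (2 * pi))) =
  f (cexp z) * cexp (k * z).
Proof. by move=> h z; rewrite (mulrDr k) !cexpD cexp2pi h !mulr1. Qed.

Lemma coefc_const f m s s' : entire f -> 0 < s -> 0 < s' ->
  coefc f s m = coefc f s' m.
Proof.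
move=> ef s0 s0'.
have k1 : cexp (- m%:R * Complex 0 (2 * pi)) = 1 :> C R.
  by rewrite mulNr cexpN cexpMn cexp2pi expr1n invr1.
have := strip_const (stripd (- m%:R) ef) (stripper f k1) (ln s) (ln s').
suff E x : 0 < x -> cmean (fun y => f (cexp (pt (ln x) y)) * cexp (- m%:R * pt (ln x) y))
   = coefc f x m by rewrite !E.
move=> x0; apply: eq_cmean => t.
by rewrite mulNr cexpN cexpMn -circle_exp lnK ?posrE // exprVn.
Qed.

(** The radius is free, so the coefficient may be computed on a tiny circle, where the integrand is
    close to [a]. *)
Lemma small_coefc f m s (a : C R) : entire f -> 0 < s ->
  (forall e : R, 0 < e -> exists2 d : R, 0 < d & forall z, z != 0 -> nm z < d ->
     nm (f z * z^-1 ^+ m - a) <= e) -> coefc f s m = a.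
Proof.
move=> ef s0 H; apply/eqP; rewrite -subr_eq0 -nm_eq0 eq_le nm_ge0 andbT.
apply/ler_addgt0Pl => e e0; rewrite addr0.
have [d d0 Hd] := H _ (divr_gt0 e0 (@ltr0Sn R 1)).
have d20 : 0 < d / 2 by rewrite divr_gt0.
rewrite (coefc_const m ef s0 d20) -[a]cmean_cst -cmeanN; last exact: rcont_cst.
rewrite /coefc -cmeanD; first last.
- exact/rcontN/rcont_cst.
- exact/rcont_coefc/entire_cont.
have -> : e = 2 * (e / 2) by field.
apply: cmean_bound => [|t _].
  apply: rcontD; [exact/rcont_coefc/entire_cont|exact/rcontN/rcont_cst].
apply: Hd; first by rewrite circle_neq0 // gt_eqF.
by rewrite nm_circle gtr0_norm //; lra.
Qed.

(** These are the coefficients of negative index. The radius is free again, and on a circle of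
    radius [x <= 1] the integrand is [O(x)]. *)
Lemma coefc_pos f n s : entire f -> 0 < s ->
  cmean (fun t => f (circle_pt s t) * circle_pt s t ^+ n.+1) = 0.
Proof.
move=> ef s0.
have cF x : rcont (fun t => f (circle_pt x t) * circle_pt x t ^+ n.+1).
  apply: rcontM; first exact/rcont_comp/rcont_circle/entire_cont.
  exact/rcontX/rcont_circle.
have k1 : cexp (n.+1%:R * Complex 0 (2 * pi)) = 1 :> C R.
  by rewrite cexpMn cexp2pi expr1n.
have K x : 0 < x -> cmean (fun t => f (circle_pt s t) * circle_pt s t ^+ n.+1) =
    cmean (fun t => f (circle_pt x t) * circle_pt x t ^+ n.+1).
  move=> x0.
  have := strip_const (stripd n.+1%:R ef) (stripper f k1) (ln s) (ln x).
  suff E y : 0 < y -> cmean (fun t => f (cexp (pt (ln y) t)) * cexp (n.+1%:R * pt (ln y) t))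
     = cmean (fun t => f (circle_pt y t) * circle_pt y t ^+ n.+1) by rewrite !E.
  move=> y0; apply: eq_cmean => t.
  by rewrite cexpMn -circle_exp lnK ?posrE.
apply/eqP; rewrite -nm_eq0 eq_le nm_ge0 andbT.
apply/ler_addgt0Pl => e e0; rewrite addr0.
have [d d0 Hd] := (ccontP f 0).1 (@entire_cont f ef 0) 1 ltr01.
have M0 : 0 < nm (f 0) + 1 by rewrite ltr_wpDl ?nm_ge0.
pose x := Num.min (Num.min 1 (d / 2)) (e / 2 / (nm (f 0) + 1)).
have x0 : 0 < x by rewrite !lt_min ltr01 !divr_gt0.
have x1 : x <= 1 by rewrite /x !ge_min lexx.
have xd : x <= d / 2 by rewrite /x !ge_min lexx orbT.
have xe : x * (nm (f 0) + 1) <= e / 2.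
  by rewrite -ler_pdivlMr // /x !ge_min lexx orbT.
rewrite (K x x0); have -> : e = 2 * (e / 2) by field.
apply: cmean_bound => // t _; rewrite nmM nmX nm_circle gtr0_norm //.
have fl : nm (f (circle_pt x t)) <= nm (f 0) + 1.
  have /ltW : nm (f (circle_pt x t) - f 0) < 1.
    by apply: Hd; rewrite subr0 nm_circle gtr0_norm //; lra.
  by rewrite -lerBlDl; apply: le_trans; exact: nm_dist.
apply: le_trans xe; rewrite mulrC exprS; apply: ler_pM => //.
- by rewrite mulr_ge0 ?exprn_ge0 // ltW.
- exact: nm_ge0.
- by rewrite ler_piMr ?exprn_ile1 // ltW.
Qed.

End Coefficients.

(** * A positive kernel *)

Section Kernel.
Variable R : realType.
Implicit Types (f g : C R -> C R) (r s t x y : R) (z w : C R).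

Definition cj z : C R := Complex (complex.Re z) (- complex.Im z).

Lemma cjM z w : cj (z * w) = cj z * cj w.
Proof. by apply: C_eq; rewrite /cj /= ?ReM ?ImM /=; ring. Qed.
Lemma cjX z n : cj (z ^+ n) = cj z ^+ n.
Proof.
elim: n => [|n IH]; last by rewrite !exprS cjM IH.
by rewrite !expr0; apply: C_eq; rewrite /= ?oppr0.
Qed.
Lemma cj0 : cj 0 = 0.
Proof. by apply: C_eq; rewrite /= ?oppr0. Qed.
Lemma addcj z : z + cj z = rC (2 * complex.Re z).
Proof. by apply: C_eq; rewrite ?ReD ?ImD /=; ring. Qed.

Lemma rcont_cj (u : R -> C R) : rcont u -> rcont (fun t => cj (u t)).
Proof. by move=> [c1 c2]; split=> t /=; [exact: c1|apply: cvgN; exact: c2]. Qed.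

Lemma meanN (u : R -> R) : continuous u -> mean (fun t => - u t) = - mean u.
Proof.
move=> cu; rewrite -mulN1r -meanZ //; apply: eq_mean => t.
by rewrite mulN1r.
Qed.

Lemma cmean_cj (u : R -> C R) : rcont u -> cmean (fun t => cj (u t)) = cj (cmean u).
Proof. by move=> [_ c2]; apply: C_eq => //=; rewrite meanN. Qed.

Lemma circleE s t : circle_pt s t = rC s * circle_pt 1 t.
Proof. by apply: C_eq; rewrite ?ReM ?ImM /=; ring. Qed.

Lemma circle1D t x : circle_pt 1 (t + x) = circle_pt 1 t * circle_pt 1 x :> C R.
Proof. by apply: C_eq; rewrite ?ReM ?ImM /= ?cosD ?sinD; ring. Qed.

Lemma circle_cjV s t : s != 0 -> (circle_pt s t)^-1 = rC (s ^- 2) * cj (circle_pt s t).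
Proof.
move=> s0; rewrite circle_inv.
by apply: C_eq; rewrite ?ReM ?ImM /= ?cosN ?sinN; field.
Qed.

(** On the circle the inverse is a multiple of the conjugate, so this is the conjugate of
    [coefc_pos]. It is the reason why [Re h] alone determines the coefficients of [h] of positive
    index. *)
Lemma coefc_cj f m s : entire f -> 0 < s ->
  cmean (fun t => cj (f (circle_pt s t)) * (circle_pt s t)^-1 ^+ m.+1) = 0.
Proof.
move=> ef s0; have s1 : s != 0 by rewrite gt_eqF.
have cu : rcont (fun t => f (circle_pt s t) * circle_pt s t ^+ m.+1).
  apply: rcontM; first exact/rcont_comp/rcont_circle/entire_cont.
  exact/rcontX/rcont_circle.
rewrite -[RHS](mulr0 (rC (s ^- 2) ^+ m.+1)) -cj0 -(coefc_pos m ef s0) -cmean_cj //.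
rewrite -cmeanZ; last exact: rcont_cj.
apply: eq_cmean => t; rewrite circle_cjV // cjM cjX exprMn; ring.
Qed.

Lemma entire_cst (c : C R) : entire (fun=> c).
Proof. by move=> z; apply: derivable_cst. Qed.

Lemma coefc_neg f n j s : entire f -> 0 < s -> (j < n)%N ->
  cmean (fun t => f (circle_pt s t) * ((circle_pt s t)^-1 ^+ j * circle_pt s t ^+ n)) = 0.
Proof.
move=> ef s0 jn; have -> : n = (j + (n - j.+1).+1)%N by lia.
set k := (n - j.+1)%N; rewrite -(coefc_pos k ef s0); apply: eq_cmean => t.
congr (_ * _); have w0 : circle_pt s t != 0 by rewrite circle_neq0 // gt_eqF.
by rewrite exprD mulrA -exprMn mulVf // expr1n mul1r.
Qed.

Lemma coefc_shift f n j s : 0 < s -> (n <= j)%N ->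
  cmean (fun t => f (circle_pt s t) * ((circle_pt s t)^-1 ^+ j * circle_pt s t ^+ n)) =
  coefc f s (j - n).
Proof.
move=> s0 jn; have [k ->] : exists k, j = (k + n)%N by exists (j - n)%N; lia.
rewrite addnK; apply: eq_cmean => t.
congr (_ * _); have w0 : circle_pt s t != 0 by rewrite circle_neq0 // gt_eqF.
by rewrite exprD -mulrA -exprMn mulVf // expr1n mulr1.
Qed.

(** The de la Vallee-Poussin kernel, that is the [2n]-th power of the cosine of half the angle
    [t - x], unnormalised: its mean is [kap n]. *)
Definition vpk n t x : R := ((1 + cos (t - x)) / 2) ^+ n.

Lemma vpk_ge0 n t x : 0 <= vpk n t x.
Proof. by apply: exprn_ge0; rewrite divr_ge0 //; have := cos_geN1 (t - x); lra. Qed.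

Lemma continuous_cosB t : continuous (fun x : R => cos (t - x)).
Proof.
move=> x; apply: (@continuous_comp _ _ _ (fun x => t - x) (@cos R)).
  by apply: cvgB; [exact: cvg_cst|exact: cvg_id].
exact: continuous_cos.
Qed.

Lemma continuous_vpk n t : continuous (vpk n t).
Proof.
move=> x; apply: (@continuous_comp _ _ _ (fun x => (1 + cos (t - x)) / 2) (fun y => y ^+ n)).
  apply: cvgM; last exact: cvg_cst.
  by apply: cvgD; [exact: cvg_cst|exact: continuous_cosB].
exact: exprn_continuous.
Qed.

Lemma vpk1 t x (q := circle_pt 1 t / circle_pt 1 x) :
  rC ((1 + cos (t - x)) / 2) = (1 + q) ^+ 2 / (4 * q).
Proof.
have qE : q = circle_pt 1 (t - x) by rewrite /q circle_inv invr1 -circle1D.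
have q0 : q != 0 by rewrite qE circle_neq0 ?oner_eq0.
have : q + q^-1 = rC (2 * cos (t - x)).
  rewrite qE circle_cjV ?oner_eq0 // expr1n invr1 mul1r addcj /=.
  by rewrite mul1r.
have -> : rC ((1 + cos (t - x)) / 2) = (2 + rC (2 * cos (t - x))) / 4.
  by apply: (mulIf (_ : (4 : C R) != 0)) => //; rewrite divfK // -!rC_nat -rCM -rCD;
     congr rC; field.
by move=> <-; field.
Qed.

(** Binomial expansion of [(1 + q) ^ (2n) / (4 q) ^ n] with [q] the quotient of the two circle
    points; index [j] carries the frequency [j - n]. *)
Lemma vpkE n s t x : 0 < s -> rC (vpk n t x) =
  \sum_(j < (n + n).+1) (4 ^- n * 'C(n + n, j)%:R * (circle_pt s t ^+ j * (circle_pt s t)^-1 ^+ n))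
     * ((circle_pt s x)^-1 ^+ j * circle_pt s x ^+ n).
Proof.
move=> s0; have w0 y : circle_pt s y != 0 by rewrite circle_neq0 // gt_eqF.
rewrite /vpk rCX vpk1.
have -> : circle_pt 1 t / circle_pt 1 x = circle_pt s t / circle_pt s x.
  have r0 : rC s != 0 by rewrite -nm_gt0 nm_rC normr_gt0 gt_eqF.
  rewrite (circleE s t) (circleE s x); field.
  by rewrite r0 circle_neq0 // oner_eq0.
rewrite expr_div_n -exprM mul2n -addnn exprDn mulr_suml; apply: eq_bigr => j _.
rewrite expr1n mul1r !exprMn !exprVn -mulr_natl.
have q0 : (4 : C R) ^+ n != 0 by rewrite expf_neq0 // pnatr_eq0.
move: (expf_neq0 n (w0 t)) (expf_neq0 n (w0 x)) (expf_neq0 j (w0 x)) q0.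
move: (circle_pt s t ^+ n) (circle_pt s x ^+ n) (circle_pt s x ^+ j) (4 ^+ n)
  (circle_pt s t ^+ j) ('C(n + n, j)%:R : C R) => b1 b2 b3 b4 b5 b6 h1 h2 h3 h4.
by field; rewrite h1 h2 h3 h4.
Qed.

(** The indices [j < n] meet vanishing coefficients of [f]; the others, written [j = n + m], leave a
    weighted Taylor polynomial. *)
Lemma vp_sum f n s t : entire f -> 0 < s ->
  cmean (fun x => f (circle_pt s x) * rC (vpk n t x)) =
  4 ^- n * \sum_(m < n.+1) 'C(n + n, n + m)%:R * (coefc f s m * circle_pt s t ^+ m).
Proof.
move=> ef s0; have z0 : circle_pt s t != 0 by rewrite circle_neq0 // gt_eqF.
pose F j x := (4 ^- n * 'C(n + n, j)%:R * (circle_pt s t ^+ j * (circle_pt s t)^-1 ^+ n)) *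
  (f (circle_pt s x) * ((circle_pt s x)^-1 ^+ j * circle_pt s x ^+ n)).
have cw j : rcont (fun x => f (circle_pt s x) * ((circle_pt s x)^-1 ^+ j * circle_pt s x ^+ n)).
  apply: rcontM; first exact/rcont_comp/rcont_circle/entire_cont.
  by apply: rcontM; [exact/rcontX/rcont_circleV|exact/rcontX/rcont_circle].
have cF j : rcont (F j) by apply: rcontM; [exact: rcont_cst|exact: cw].
have -> : cmean (fun x => f (circle_pt s x) * rC (vpk n t x)) =
          cmean (fun x => \sum_(j < (n + n).+1) F j x).
  apply: eq_cmean => x; rewrite (vpkE n t x s0) mulr_sumr; apply: eq_bigr => j _.
  by rewrite /F mulrCA.
rewrite (cmean_sum _ cF).2 -addnS big_split_ord /= big1 ?add0r => [|j _]; last first.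
  by rewrite /F cmeanZ // coefc_neg // mulr0.
rewrite mulr_sumr; apply: eq_bigr => m _; rewrite /F cmeanZ // coefc_shift ?leq_addr //.
rewrite addKn exprD exprVn.
move: (expf_neq0 n z0).
move: (circle_pt s t ^+ n) (4 ^- n) (coefc f s m) (circle_pt s t ^+ m)
  ('C(n + n, n + m)%:R : C R) => b1 b2 b3 b4 b5 h1.
by field.
Qed.

Lemma coefc1 m s : 0 < s -> coefc (fun=> 1) s m = (m == 0%N)%:R :> C R.
Proof.
move=> s0; case: m => [|m] /=.
  by rewrite /coefc; under eq_cmean do rewrite expr0 mulr1; rewrite cmean_cst.
rewrite /coefc -[RHS]/(0 : C R) -(coefc_cj m (@entire_cst 1) s0); apply: eq_cmean => t; congr (_ * _).
by apply: C_eq; rewrite /= ?oppr0.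
Qed.

Definition kap n : R := 'C(n + n, n)%:R / 4 ^+ n.

Lemma kap_gt0 n : 0 < kap n.
Proof. by rewrite divr_gt0 ?exprn_gt0 // ltr0n bin_gt0 leq_addr. Qed.

(** This ratio, [1 - 1 / (2n + 2)], is what gives the kernel its concentration rate in
    [mean_vpk_cos]. *)
Lemma kapS n : kap n.+1 = kap n * (n.*2.+1%:R / n.*2.+2%:R).
Proof.
have h1 : (n.+1 * 'C(n.+1 + n.+1, n.+1) = 4 * n * 'C(n + n, n) + 2 * 'C(n + n, n))%N.
  have e1 := mul_bin_diag (n.+1 + n.+1) n.
  have e2 := mul_bin_down (n + n).+1 n.
  have e3 : ((n.+1 + n.+1).-1 = (n + n).+1)%N by lia.
  rewrite e3 in e1; rewrite /= in e2.
  have e4 : ((n + n).+1 - n = n.+1)%N by lia.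
  rewrite e4 in e2; nia.
have h2 : (n.+1%:R * 'C(n.+1 + n.+1, n.+1)%:R = (4 * n%:R + 2) * 'C(n + n, n)%:R :> R).
  by rewrite -natrM h1 natrD !natrM; ring.
have n1 : (n.+1%:R : R) != 0 by rewrite pnatr_eq0.
rewrite /kap; have -> : 'C(n.+1 + n.+1, n.+1)%:R = (4 * n%:R + 2) * 'C(n + n, n)%:R / n.+1%:R :> R.
  by rewrite -h2; field.
have -> : (n.*2.+1%:R : R) = 2 * n%:R + 1 by rewrite -addn1 natrD -mul2n natrM.
have -> : (n.*2.+2%:R : R) = 2 * n.+1%:R by rewrite -doubleS -mul2n natrM.
rewrite exprS; have q0 : (4 : R) ^+ n != 0 by rewrite expf_neq0 // pnatr_eq0.
move: (4 ^+ n) ('C(n + n, n)%:R : R) n.+1%:R n%:R q0 n1 => b1 b2 b3 b4 k1 k2.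
by field; rewrite k1 k2.
Qed.

Lemma mean_vpk n t : mean (vpk n t) = kap n.
Proof.
apply: rC_inj; have := @vp_sum (fun=> 1) n 1 t (@entire_cst 1) ltr01.
under eq_cmean do rewrite mul1r.
have -> : cmean (fun x => rC (vpk n t x)) = rC (mean (vpk n t)).
  by apply: C_eq => //=; rewrite mean_cst.
move=> ->; rewrite big_ord_recl /= big1 => [|i _]; last by rewrite coefc1 //= mul0r mulr0.
by rewrite coefc1 // addn0 expr0 !mulr1 addr0 /kap rCM rC_nat rCV rCX rC_nat mulrC.
Qed.

(** Since [1 - cos = 2 - 2 * ((1 + cos) / 2)], the integrand is [2 vpk n - 2 vpk (n + 1)]. *)
Lemma mean_vpk_cos n t : mean (fun x => (1 - cos (t - x)) * vpk n t x) = kap n / n.+1%:R.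
Proof.
have -> : mean (fun x => (1 - cos (t - x)) * vpk n t x) =
    mean (fun x => 2 * vpk n t x + (-2) * vpk n.+1 t x).
  by apply: eq_mean => x; rewrite /vpk exprS; field.
have cZ (r : R) m : continuous (fun x => r * vpk m t x).
  by move=> x; apply: cvgM; [exact: cvg_cst|exact: continuous_vpk].
rewrite meanD // !meanZ ?mean_vpk ?kapS; try exact: continuous_vpk.
have -> : (n.*2.+1%:R : R) = 2 * n.+1%:R - 1.
  by rewrite -natrM mul2n doubleS -[in RHS]natr1; ring.
have -> : (n.*2.+2%:R : R) = 2 * n.+1%:R by rewrite -doubleS -mul2n natrM.
have : (n.+1%:R : R) != 0 by rewrite pnatr_eq0.
by move: (n.+1%:R) => b b0; field.
Qed.

(* Korovkin: the deviation is controlled by the first moment of 1 - cos. *)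
Lemma vp_approx (u : R -> C R) n t (e K : R) : rcont u ->
  (forall x, 0 <= x <= 2 * pi -> nm (u x - u t) <= e + K * (1 - cos (t - x))) ->
  nm (cmean (fun x => u x * rC (vpk n t x)) - u t * rC (kap n)) <=
  2 * (kap n * (e + K / n.+1%:R)).
Proof.
move=> cu H; have cv : rcont (fun x => rC (vpk n t x)) by apply/rcont_rC/continuous_vpk.
have -> : rC (kap n) = cmean (fun x => rC (vpk n t x)).
  by apply: C_eq => /=; rewrite ?mean_cst ?mean_vpk.
rewrite -cmeanZ // -cmeanN -?cmeanD //; try (by apply: rcontM => //; apply: rcont_cst);
 try (by apply: rcontN; apply: rcontM => //; apply: rcont_cst); try exact: rcontM.
have c1 (r : R) : continuous (fun x => r * vpk n t x).
  by move=> x; apply: cvgM; [exact: cvg_cst|exact: continuous_vpk].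
have c2 : continuous (fun x => (1 - cos (t - x)) * vpk n t x).
  move=> x; apply: cvgM; last exact: continuous_vpk.
  by apply: cvgB; [exact: cvg_cst|exact: continuous_cosB].
have c3 : continuous (fun x => K * ((1 - cos (t - x)) * vpk n t x)).
  by move=> x; apply: cvgM; [exact: cvg_cst|exact: c2].
have -> : kap n * (e + K / n.+1%:R) =
    mean (fun x => e * vpk n t x + K * ((1 - cos (t - x)) * vpk n t x)).
  rewrite meanD // !meanZ ?mean_vpk ?mean_vpk_cos //; last exact: continuous_vpk.
  by ring.
apply: cmean_le.
- apply: rcontD; first exact: rcontM.
  by apply: rcontN; apply: rcontM => //; apply: rcont_cst.
- by move=> x; apply: cvgD; [exact: c1|exact: c3].
move=> x hx; rewrite -mulrBl nmM nm_rC ger0_norm ?vpk_ge0 // mulrA -mulrDl.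
by rewrite ler_wpM2r ?vpk_ge0 // H.
Qed.

End Kernel.

(** * Taylor coefficients *)

Section PowerSeries.
Variable R : realType.
Implicit Types (f g : C R -> C R) (r s t x y : R) (z w : C R) (a : nat -> C R).

Lemma polar z : exists2 t : R, 0 <= t <= 2 * pi & z = circle_pt (nm z) t.
Proof.
have [->|z0] := eqVneq z 0.
  exists 0; first by rewrite lexx mulr_ge0 // pi_ge0.
  by rewrite nm0; apply: C_eq; rewrite /= mul0r.
have n0 : nm z != 0 by rewrite nm_eq0.
case: z z0 n0 => a b z0 n0; set n := nm _ in n0 *.
have n2 : n ^+ 2 = a ^+ 2 + b ^+ 2.
  by rewrite /n nm_sqrt sqr_sqrtr // addr_ge0 // sqr_ge0.
have npos : 0 < n by rewrite lt_def n0 nm_ge0.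
have ain : -1 <= a / n <= 1.
  by rewrite -ler_norml normrM normfV (gtr0_norm npos) ler_pdivrMr // mul1r (Re_nm (Complex a b)).
have ca := acosK (ain : a / n \in `[-1, 1]%R).
have s1 : sin (acos (a / n)) ^+ 2 = (b / n) ^+ 2.
  rewrite sin2cos2 ca !expr_div_n n2.
  have : a ^+ 2 + b ^+ 2 != 0 by rewrite -n2 expf_neq0.
  by move=> ?; field.
have ac0 := acos_ge0 ain; have ac1 := acos_lepi ain; have p0 := @pi_ge0 R.
move/eqP: s1; rewrite eqf_sqr => /orP[]/eqP s1.
- exists (acos (a / n)); first by rewrite ac0 /=; lra.
  by apply: C_eq; rewrite /= ?ca ?s1; field.
- exists (2 * pi - acos (a / n)); first by apply/andP; split; lra.
  have e : (2 * pi : R) = pi *+ 2 by rewrite mulr_natl.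
  apply: C_eq; rewrite /= e.
    rewrite cosB cos2pi sin2pi ca; field; exact: n0.
  by rewrite sinB cos2pi sin2pi s1; field; exact: n0.
Qed.

Lemma circle_bounded f s : continuous f ->
  exists M : R, forall z, nm z = s -> nm (f z) <= M.
Proof.
move=> cf; have c : continuous (fun t => nm (f (circle_pt s t))).
  exact/rcont_nm/rcont_comp/rcont_circle.
have p0 : 0 <= 2 * pi :> R by rewrite mulr_ge0 // pi_ge0.
have [t0 _ H] := EVT_max p0 (continuous_subspaceT c).
exists (nm (f (circle_pt s t0))) => z zs; have [t ht ->] := polar z.
by rewrite zs; apply: H; rewrite in_itv /=.
Qed.

Definition tc f m : C R := coefc f 1 m.

Lemma coefc_tc f s m : entire f -> 0 < s -> coefc f s m = tc f m.
Proof. by move=> ef s0; apply: coefc_const. Qed.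

(** Infinite radius of convergence, expressed by Cauchy bounds on every radius. *)
Definition ecoef a := forall s, 0 < s -> exists2 M : R, 0 <= M &
  forall m, nm (a m) * s ^+ m <= M.

Lemma tc_mean_le f s m (M : R) : entire f -> 0 < s ->
  (forall z, nm z = s -> nm (f z) <= M) -> nm (tc f m) * s ^+ m <= 2 * M.
Proof.
move=> ef s0 HM; have -> : nm (tc f m) = nm (coefc f s m) by rewrite coefc_tc.
rewrite -ler_pdivlMr ?exprn_gt0 // -mulrA; apply: cmean_bound.
  exact/rcont_coefc/entire_cont.
move=> t _; rewrite nmM nmX nmV nm_circle gtr0_norm // exprVn.
by rewrite ler_wpM2r ?invr_ge0 ?exprn_ge0 ?(ltW s0) // HM // nm_circle gtr0_norm.
Qed.

Lemma ecoef_tc f : entire f -> ecoef (tc f).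
Proof.
move=> ef s s0; have [M HM] := circle_bounded s (entire_cont ef).
have M0 : 0 <= M.
  apply: le_trans (nm_ge0 (f (rC s))) _.
  by apply: HM; rewrite nm_rC gtr0_norm.
exists (2 * M); first by rewrite mulr_ge0.
by move=> m; apply: tc_mean_le.
Qed.

Definition psum a N z : C R := \sum_(i < N) a i * z ^+ i.

Lemma psumS a N z : psum a N.+1 z = psum a N z + a N * z ^+ N.
Proof. by rewrite /psum big_ord_recr. Qed.

Lemma entire_psum a N : entire (psum a N).
Proof.
elim: N => [|N IH] z.
  have -> : psum a 0 = fun=> 0 by apply/funext => w; rewrite /psum big_ord0.
  exact: derivable_cst.
have -> : psum a N.+1 = psum a N + (fun w => a N *: (@id (C R) ^+ N) w).
  by apply/funext => w; rewrite psumS /= !fctE.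
apply: derivableD; first exact: IH.
by apply: derivableZ; apply: derivableX; exact: derivable_id.
Qed.

(** All errors for power series are brought to the form [K / 2 ^ n], and this is the passage to the
    limit for them. *)
Lemma le_pow2 (x y K : R) : (forall n : nat, x <= y + K / 2 ^+ n) -> x <= y.
Proof.
move=> H; apply/ler_addgt0Pl => e e0.
have K1 : 0 < `|K| + 1 by rewrite ltr_wpDl.
have [n _ /(_ n (leqnn _))] := near_infty_natSinv_expn_lt (PosNum (divr_gt0 e0 K1)).
rewrite /= div1r ltr_pdivlMr // => hn.
apply: le_trans (H n) _; rewrite addrC lerD2r.
apply: ltW; apply: le_lt_trans hn; rewrite mulrC ler_wpM2l ?invr_ge0 ?exprn_ge0 //.
by have := ler_norm K; lra.
Qed.

(** A coefficient bound at twice the radius buys a geometric factor. *)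
Lemma pow2_le (M : R) a s : 0 < s -> (forall m, nm (a m) * (2 * s) ^+ m <= M) ->
  forall m z, nm z <= s -> nm (a m * z ^+ m) <= M / 2 ^+ m.
Proof.
move=> s0 HM m z zs; rewrite ler_pdivlMr ?exprn_gt0 //.
apply: le_trans (HM m); rewrite nmM nmX exprMn -mulrA ler_wpM2l ?nm_ge0 // mulrC.
by rewrite ler_wpM2l ?exprn_ge0 // lerXn2r ?nnegrE ?nm_ge0 // ltW.
Qed.

Lemma geo_tail (M : R) (F : nat -> R) : 0 <= M ->
  (forall m, F m <= M / 2 ^+ m) -> forall N k,
  \sum_(i < k) F (N + i)%N <= 2 * M / 2 ^+ N.
Proof.
(* The exact geometric sum, with the tail subtracted, is what closes the induction on [k]. *)
move=> M0 H N k; suff : \sum_(i < k) F (N + i)%N <=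
    2 * M / 2 ^+ N - 2 * M / 2 ^+ (N + k).
  by move=> /le_trans; apply; rewrite gerBl divr_ge0 ?exprn_ge0 // mulr_ge0.
elim: k => [|k IH]; first by rewrite big_ord0 addn0 subrr.
rewrite big_ord_recr /=; apply: le_trans (lerD IH (H _)) _; rewrite addnS exprS.
have e1 : (2 : R) ^+ (N + k) != 0 by rewrite expf_neq0 // pnatr_eq0.
have e2 : (2 : R) ^+ N != 0 by rewrite expf_neq0 // pnatr_eq0.
rewrite le_eqVlt; apply/orP; left; apply/eqP.
by move: (2 ^+ (N + k)) (2 ^+ N) e1 e2 => b1 b2 k1 k2; field; rewrite k1 k2.
Qed.

Lemma psum_add a N k z :
  psum a (N + k) z = psum a N z + \sum_(i < k) a (N + i)%N * z ^+ (N + i).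
Proof. by rewrite /psum big_split_ord. Qed.

Lemma psum_tail (M : R) a s : 0 < s -> 0 <= M ->
  (forall m, nm (a m) * (2 * s) ^+ m <= M) -> forall z, nm z <= s ->
  forall N k, nm (psum a (N + k) z - psum a N z) <= 2 * M / 2 ^+ N.
Proof.
move=> s0 M0 H z zs N k; rewrite psum_add addrAC subrr add0r.
apply: le_trans (@nm_sum _ _ (fun i => a (N + i)%N * z ^+ (N + i))) _.
by apply: (geo_tail (F := fun m => nm (a m * z ^+ m))) => // m; apply: pow2_le zs.
Qed.

Lemma coefcD f g s m : continuous f -> continuous g ->
  coefc (fun z => f z + g z) s m = coefc f s m + coefc g s m.
Proof.
move=> cf cg; rewrite /coefc -cmeanD; try exact: rcont_coefc.
by apply: eq_cmean => t; rewrite mulrDl.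
Qed.

Lemma coefcZ f (c : C R) s m : continuous f ->
  coefc (fun z => c * f z) s m = c * coefc f s m.
Proof.
move=> cf; rewrite /coefc -cmeanZ; try exact: rcont_coefc.
by apply: eq_cmean => t; rewrite mulrA.
Qed.

Lemma coefcX s m i : 0 < s -> coefc (fun z : C R => z ^+ i) s m = (m == i)%:R.
Proof.
move=> s0; have [mi|im] := ltnP m i.
  rewrite (ltn_eqF mi) -[RHS]/(0 : C R) -(coefc_neg (@entire_cst R 1) s0 mi).
  by apply: eq_cmean => t; rewrite mul1r mulrC.
have := coefc_shift (fun=> 1) s0 im; rewrite coefc1 //.
have -> : ((m - i)%N == 0%N) = (m == i) by lia.
by move=> <-; apply: eq_cmean => t; rewrite mul1r mulrC.
Qed.

Lemma entireD f g : entire f -> entire g -> entire (fun z => f z + g z).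
Proof. by move=> ef eg z; apply: derivableD. Qed.
Lemma entireN f : entire f -> entire (fun z => - f z).
Proof. by move=> ef z; apply: derivableN. Qed.
Lemma entireM f g : entire f -> entire g -> entire (fun z => f z * g z).
Proof. by move=> ef eg z; apply: derivableM. Qed.

Lemma entireX N : entire (fun w : C R => w ^+ N).
Proof.
have -> : (fun w : C R => w ^+ N) = psum (fun i => (i == N)%:R) N.+1.
  apply/funext => w; rewrite psumS eqxx mul1r /psum big1 ?add0r // => i _.
  by rewrite (ltn_eqF (ltn_ord i)) mul0r.
exact: entire_psum.
Qed.

Lemma coefc_psum a N s m : 0 < s ->
  coefc (psum a N) s m = if (m < N)%N then a m else 0.
Proof.
move=> s0; elim: N => [|N IH].
  have -> : psum a 0 = fun=> 0 * 1 by apply/funext => w; rewrite /psum big_ord0 mul0r.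
  by rewrite coefcZ ?mul0r //; exact: (entire_cont (@entire_cst R 1)).
have cX := entire_cont (@entireX N).
have -> : psum a N.+1 = fun w => psum a N w + a N * w ^+ N by apply/funext => w; rewrite psumS.
have cZ := entire_cont (entireM (@entire_cst R (a N)) (@entireX N)).
rewrite (coefcD s m (entire_cont (@entire_psum a N)) cZ) (coefcZ (a N) s m cX).
rewrite IH coefcX // [in RHS]ltnS; case: ltngtP => [||->].
- by rewrite [a N * _]mulr0 addr0.
- by rewrite [a N * _]mulr0 addr0.
- by rewrite add0r; exact: mulr1.
Qed.

Lemma bin_central n m : ('C(n + n, n + m) <= 'C(n + n, n))%N.
Proof.
elim: m => [|m IH]; first by rewrite addn0.
apply: leq_trans IH; have e := mul_bin_left (n + n) (n + m).
rewrite addnS -(leq_pmul2l (ltn0Sn (n + m))) e leq_mul2r; apply/orP; right; lia.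
Qed.

Lemma dist_circle s t x :
  nm (circle_pt s x - circle_pt s t) ^+ 2 = 2 * s ^+ 2 * (1 - cos (t - x)).
Proof.
rewrite nm_sqrt sqr_sqrtr ?addr_ge0 ?sqr_ge0 //= cosB.
have h1 := cos2Dsin2 t; have h2 := cos2Dsin2 x.
rewrite (_ : _ + _ = s ^+ 2 * ((cos t ^+ 2 + sin t ^+ 2) + (cos x ^+ 2 + sin x ^+ 2)
   - 2 * (cos t * cos x + sin t * sin x))); last by ring.
by rewrite h1 h2; ring.
Qed.

Lemma le_eps_inv (x y : R) : (forall e, 0 < e -> exists K : R,
  forall n : nat, x <= y + (e + K / n.+1%:R)) -> x <= y.
Proof.
move=> H; apply/ler_addgt0Pl => e e0; have e2 : 0 < e / 2 by rewrite divr_gt0.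
have [K HK] := H _ e2; have K1 : 0 < `|K| + 1 by rewrite ltr_wpDl.
have [n _ /(_ n (leqnn _))] := near_infty_natSinv_lt (PosNum (divr_gt0 e2 K1)).
rewrite /= ltr_pdivlMr // => hn; apply: le_trans (HK n) _.
have : K / n.+1%:R <= n.+1%:R^-1 * (`|K| + 1).
  by rewrite mulrC ler_wpM2l ?invr_ge0 //; have := ler_norm K; lra.
by move=> /le_lt_trans/(_ hn); move: (K / n.+1%:R) => p; lra.
Qed.

Lemma tc0 f : entire f -> tc f 0 = f 0.
Proof.
move=> ef; apply: small_coefc => // e e0.
have [d d0 Hd] := (ccontP f 0).1 (@entire_cont _ f ef 0) e e0.
exists d => // z _ zd; rewrite expr0 mulr1; apply/ltW/Hd.
by rewrite subr0.
Qed.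

(** Let [g] be the remainder. Its coefficients below [N] vanish, and the binomial weights are at
    most the central one, so its kernel mean at [z] is at most [kap n * B]. By concentration of the
    kernel, the same mean divided by [kap n] tends to [g z]. *)
Lemma circle_taylor f N (B : R) z : entire f -> z != 0 ->
  (forall k, \sum_(i < k) nm (tc f (N + i)%N * z ^+ (N + i)) <= B) ->
  nm (f z - psum (tc f) N z) <= B.
Proof.
move=> ef z0 HB; have r0 : 0 < nm z by rewrite nm_gt0.
pose g w := f w - psum (tc f) N w.
have ep := @entire_psum (tc f) N; have enp := entireN ep.
have eg : entire g := entireD ef enp.
have cg : continuous g := entire_cont eg.
have [t ht zE] := polar z; set r := nm z in r0 zE.
have gc m : coefc g r m = if (m < N)%N then 0 else tc f m.
  rewrite (coefcD r m (entire_cont ef) (entire_cont enp)).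
  have -> : (fun w => - psum (tc f) N w) = (fun w => -1 * psum (tc f) N w).
    by apply/funext => w; rewrite mulN1r.
  rewrite (coefcZ (-1) r m (entire_cont ep)) coefc_psum // coefc_tc //.
  by case: ifP => _; rewrite mulN1r ?subrr ?subr0.
pose V n := cmean (fun x => g (circle_pt r x) * rC (vpk n t x)).
have VB n : nm (V n) <= kap R n * B.
  rewrite /V vp_sum // nmM nmV nmX nm_nat /kap -mulrA [X in _ <= X]mulrCA.
  apply: ler_wpM2l; first by rewrite invr_ge0 exprn_ge0.
  have B0 : 0 <= B by apply: le_trans (HB 0%N); rewrite big_ord0.
  apply: le_trans (@nm_sum _ _ (fun m => 'C(n + n, n + m)%:R * (coefc g r m * circle_pt r t ^+ m))) _.
  have T1 : \sum_(i < n.+1) nm ('C(n + n, n + i)%:R * (coefc g r i * circle_pt r t ^+ i)) <=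
    \sum_(i < n.+1) 'C(n + n, n)%:R * nm (coefc g r i * circle_pt r t ^+ i).
    apply: ler_sum => i _; rewrite nmM nm_nat ler_wpM2r ?nm_ge0 // ler_nat.
    exact: bin_central.
  apply: le_trans T1 _; rewrite -mulr_sumr ler_wpM2l ?ler0n //.
  have T2 : \sum_(i < n.+1) nm (coefc g r i * circle_pt r t ^+ i) <=
      \sum_(i < N + n.+1) nm (coefc g r i * circle_pt r t ^+ i).
    rewrite addnC big_split_ord /= lerDl; apply: sumr_ge0 => i _; exact: nm_ge0.
  apply: le_trans T2 _; rewrite big_split_ord /= big1 ?add0r => [|i _].
    apply: le_trans (HB n.+1); apply: ler_sum => i _ /=.
    by rewrite gc -zE ltnNge leq_addr.
  by rewrite gc /= ltn_ord mul0r nm0.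
apply: le_eps_inv => e e0.
have e2 : 0 < e / 2 by rewrite divr_gt0.
have [d d0 Hd] := (ccontP g z).1 (cg z) _ e2.
have [M HM] := circle_bounded r cg.
have M0 : 0 <= M by apply: le_trans (HM z (erefl _)); exact: nm_ge0.
(* Away from [z] the values of [g] differ by at most [2 * M], and there
   [1 - cos (t - x) >= d ^ 2 / (2 * r ^ 2)]; this [K] lets [K * (1 - cos (t - x))] dominate. *)
pose K := 2 * M * (2 * r ^+ 2) / d ^+ 2; have K0 : 0 <= K.
  have h1 : 0 <= 2 * r ^+ 2 by apply: mulr_ge0 => //; exact: sqr_ge0.
  have h2 : 0 <= 2 * M by apply: mulr_ge0.
  by apply: divr_ge0; [exact: mulr_ge0|exact: sqr_ge0].
exists (2 * K) => n; have kp := kap_gt0 R n.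
have ap : nm (V n - g z * rC (kap R n)) <= 2 * (kap R n * (e / 2 + K / n.+1%:R)).
  rewrite /V zE; apply: vp_approx => [|x _].
    exact/rcont_comp/rcont_circle.
  rewrite -zE; have c1 : 0 <= 1 - cos (t - x) by have := cos_le1 (t - x); lra.
  have [h|h] := ltP (nm (circle_pt r x - z)) d.
    apply: le_trans (ltW (Hd _ h)) _; rewrite lerDl mulr_ge0 //.
  have h2 : d ^+ 2 <= 2 * r ^+ 2 * (1 - cos (t - x)).
    by rewrite -dist_circle -zE lerXn2r // nnegrE ?nm_ge0 // ltW.
  have h3 : nm (g (circle_pt r x) - g z) <= 2 * M.
    apply: le_trans (nmB _ _) _; rewrite mulr_natl mulr2n lerD ?HM //.
    by rewrite nm_circle gtr0_norm.
  apply: le_trans h3 _; apply: ler_wpDl; first exact: ltW.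
  rewrite /K mulrAC ler_pdivlMr ?exprn_gt0 // -[leRHS]mulrA ler_wpM2l // mulr_ge0 //.
have : nm (g z) * kap R n <= kap R n * B + 2 * (kap R n * (e / 2 + K / n.+1%:R)).
  have -> : nm (g z) * kap R n = nm (g z * rC (kap R n)) by rewrite nmM nm_rC gtr0_norm.
  have -> : g z * rC (kap R n) = V n - (V n - g z * rC (kap R n)) by ring.
  by apply: le_trans (nmB _ _) _; apply: lerD.
have -> : kap R n * B + 2 * (kap R n * (e / 2 + K / n.+1%:R)) =
  (B + (e + 2 * K / n.+1%:R)) * kap R n.
  by have : (n.+1%:R : R) != 0 by [rewrite pnatr_eq0]; move: (n.+1%:R) => b b0; field.
by rewrite ler_pM2r.
Qed.

End PowerSeries.

(** * Power series *)

Section Taylor.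
Variable R : realType.
Implicit Types (f g : C R -> C R) (r s t x y : R) (z w h : C R) (a : nat -> C R).

(** A geometric rate, uniform on discs, is available because the coefficients are bounded at twice
    any radius; it reduces all limits to [le_pow2]. *)
Definition rep g a := ecoef a /\ forall s, 0 < s -> exists2 K : R, 0 <= K &
  forall N z, nm z <= s -> nm (g z - psum a N z) <= K / 2 ^+ N.

Lemma rep_tc f : entire f -> rep f (tc f).
Proof.
move=> ef; split; first exact: ecoef_tc.
move=> s s0; have [M M0 HM] := ecoef_tc ef (mulr_gt0 (@ltr0Sn R 1) s0).
(* The term [nm (f 0)] serves [z = 0] with [N = 0], where the partial sum is empty and no circle
   passes through [z]. *)
exists (2 * M + nm (f 0)); first by rewrite addr_ge0 ?nm_ge0 // mulr_ge0.
move=> N z zs; have [->|z0] := eqVneq z 0.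
  case: N => [|N].
    rewrite /psum big_ord0 subr0 expr0 divr1 lerDr mulr_ge0 //.
  rewrite -add1n psum_add /psum big_ord1 expr0 mulr1 tc0 // big1 => [|i _].
    rewrite addr0 subrr nm0 divr_ge0 ?exprn_ge0 // addr_ge0 ?nm_ge0 // mulr_ge0 //.
  by rewrite add1n exprS mul0r mulr0.
apply: (@le_trans _ _ (2 * M / 2 ^+ N)).
  apply: circle_taylor => // k.
  by apply: (geo_tail (F := fun m => nm (tc f m * z ^+ m))) => // m; apply: pow2_le zs.
by rewrite ler_wpM2r ?invr_ge0 ?exprn_ge0 // lerDl nm_ge0.
Qed.

Lemma rep_ex a : ecoef a -> exists g, rep g a.
Proof.
move=> ea.
have H z : exists w, exists M : R, forall N, nm (w - psum a N z) <= M / 2 ^+ N.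
  have s0 : 0 < nm z + 1 by rewrite ltr_wpDl ?nm_ge0.
  have [M M0 HM] := ea _ (mulr_gt0 (@ltr0Sn R 1) s0).
  have zs : nm z <= nm z + 1 by rewrite lerDl.
  have T := psum_tail s0 M0 HM zs; pose B (n : nat) := 2 * M / 2 ^+ n.
  have B0 n : 0 <= B n by rewrite /B divr_ge0 ?exprn_ge0 // mulr_ge0.
  have D n m : nm (psum a n z - psum a m z) <= B n + B m.
    have [nm_|mn] := leqP n m.
      by rewrite -(subnKC nm_) nmBC; apply: le_trans (T _ _) _; rewrite lerDl B0.
    by rewrite -(subnKC (ltnW mn)); apply: le_trans (T _ _) _; rewrite lerDr B0.
  (* The real parts of the partial sums, thickened by the tail bound [B n], are pairwise
     intersecting intervals; a common point is the real part of the limit. *)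
  have [x Hx] : exists x, forall n, complex.Re (psum a n z) - B n <= x <= complex.Re (psum a n z) + B n.
    apply: sup_between => n m; have := le_trans (Re_nm _) (D n m).
    by rewrite ReD ReN ; rewrite ler_norml => /andP[_ ?]; lra.
  have [y Hy] : exists y, forall n, complex.Im (psum a n z) - B n <= y <= complex.Im (psum a n z) + B n.
    apply: sup_between => n m; have := le_trans (Im_nm _) (D n m).
    by rewrite ImD ImN ; rewrite ler_norml => /andP[_ ?]; lra.
  exists (Complex x y), (2 * (2 * M)) => N; apply: le_trans (nm_le_ReIm _) _.
  rewrite ReD ImD ReN ImN /=.
  have h1 : `|x - complex.Re (psum a N z)| <= B N by rewrite ler_norml; have := Hx N; lra.
  have h2 : `|y - complex.Im (psum a N z)| <= B N by rewrite ler_norml; have := Hy N; lra.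
  by have -> : 2 * (2 * M) / 2 ^+ N = B N + B N; [rewrite /B; ring|exact: lerD].
have [g Hg] := choice H; exists g; split=> // s s0.
have [M M0 HM] := ea _ (mulr_gt0 (@ltr0Sn R 1) s0).
exists (2 * M); first by rewrite mulr_ge0.
move=> N z zs; have [K HK] := Hg z.
have K0 : 0 <= K by have := le_trans (nm_ge0 _) (HK 0%N); rewrite expr0 divr1.
apply: (@le_pow2 _ _ _ K) => k.
have -> : g z - psum a N z = (g z - psum a (N + k) z) + (psum a (N + k) z - psum a N z) by ring.
apply: le_trans (nmD _ _) _; rewrite addrC; apply: lerD; first exact: psum_tail s0 M0 HM z zs N k.
apply: le_trans (HK _) _; rewrite ler_wpM2l // lef_pV2 ?posrE ?exprn_gt0 //.
by rewrite ler_weXn2l ?leq_addl // ler1n.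
Qed.

Definition dcoef a m : C R := m.+1%:R * a m.+1.
Definition pcoef a m : C R := if m is k.+1 then a k / k.+1%:R else 0.

Lemma pow2_nat m : (m%:R : R) <= 2 ^+ m.
Proof. by rewrite -natrX ler_nat ltnW // ltn_expl. Qed.

Lemma ecoef_d a : ecoef a -> ecoef (dcoef a).
Proof.
move=> ea s s0; have [M M0 HM] := ea _ (mulr_gt0 (@ltr0Sn R 1) s0).
exists (M / s); first by rewrite divr_ge0 // ltW.
move=> m; rewrite ler_pdivlMr // -mulrA -exprSr nmM nm_nat.
apply: le_trans (HM m.+1); rewrite exprMn mulrAC mulrC ler_wpM2l ?nm_ge0 //.
by rewrite ler_wpM2r ?exprn_ge0 ?(ltW s0) // pow2_nat.
Qed.

Lemma ecoef_p a : ecoef a -> ecoef (pcoef a).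
Proof.
move=> ea s s0; have [M M0 HM] := ea _ s0.
exists (M * s); first by rewrite mulr_ge0 // ltW.
case=> [|m] /=; first by rewrite nm0 mul0r mulr_ge0 // ltW.
rewrite exprSr mulrA ler_pM2r //; apply: le_trans (HM m).
rewrite nmM nmV nm_nat ler_wpM2r ?exprn_ge0 ?(ltW s0) // ler_piMr ?nm_ge0 //.
by rewrite invf_le1 ?ltr0n // ler1n.
Qed.

Lemma dcoef_p a : dcoef (pcoef a) = a.
Proof. by apply/funext => m; rewrite /dcoef /pcoef mulrC divfK // pnatr_eq0. Qed.

(** The remainders satisfy [r_(i+1) = (z + h) r_i + i z^(i-1) h^2], and [i^2 + i <= (i + 1)^2]. *)
Lemma pow_taylor z h s i : 1 <= s -> nm z <= s -> nm (z + h) <= s ->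
  nm ((z + h) ^+ i - z ^+ i - i%:R * z ^+ i.-1 * h) <= i%:R ^+ 2 * s ^+ i * nm h ^+ 2.
Proof.
move=> s1 zs zhs; have s0 : 0 <= s by lra.
elim: i => [|i IH].
  by rewrite !expr0 !mul0r subrr subr0 nm0 expr0n /= !mul0r.
have -> : (z + h) ^+ i.+1 - z ^+ i.+1 - i.+1%:R * z ^+ i.+1.-1 * h =
  (z + h) * ((z + h) ^+ i - z ^+ i - i%:R * z ^+ i.-1 * h) + i%:R * z ^+ i.-1 * h ^+ 2.
  case: i {IH} => [|i]; first by rewrite !expr1 !expr0; ring.
  rewrite -[in LHS](natr1 i.+1) !exprS /=; ring.
apply: le_trans (nmD _ _) _; rewrite nmM.
have h1 : nm (z + h) * nm ((z + h) ^+ i - z ^+ i - i%:R * z ^+ i.-1 * h) <=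
    s * (i%:R ^+ 2 * s ^+ i * nm h ^+ 2) by apply: ler_pM => //; exact: nm_ge0.
have h2 : nm (i%:R * z ^+ i.-1 * h ^+ 2) <= i%:R * s ^+ i.+1 * nm h ^+ 2.
  rewrite nmM (nmM i%:R) nm_nat !nmX ler_wpM2r ?sqr_ge0 // ler_wpM2l //.
  apply: (@le_trans _ _ (s ^+ i.-1)); first by rewrite lerXn2r // nnegrE nm_ge0.
  by rewrite ler_weXn2l // (leq_trans (leq_pred _)).
apply: le_trans (lerD h1 h2) _.
have -> : s * (i%:R ^+ 2 * s ^+ i * nm h ^+ 2) + i%:R * s ^+ i.+1 * nm h ^+ 2 =
  (i%:R ^+ 2 + i%:R) * s ^+ i.+1 * nm h ^+ 2 by rewrite (exprS s i); ring.
rewrite ler_wpM2r ?sqr_ge0 // ler_wpM2r ?exprn_ge0 // -natr1.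
by have : 0 <= i%:R :> R by []; nra.
Qed.

Lemma rep_quad g a g' : rep g a -> rep g' (dcoef a) -> forall s, 0 < s ->
  exists2 K : R, 0 <= K & forall z h, nm z <= s -> nm (z + h) <= s ->
    nm (g (z + h) - g z - g' z * h) <= K * nm h ^+ 2.
Proof.
move=> [ea Hg] [_ Hg'] s' s'0; pose s := s' + 1.
have s1 : 1 <= s by rewrite /s; lra.
have s0 : 0 < s by rewrite /s; lra.
(* In [(8 s) ^ m] two of the three factors [2 ^ m] absorb the [m ^ 2] of [pow_taylor], and the third
   makes the series geometric. *)
have s80 : 0 < 8 * s by rewrite mulr_gt0.
have [M M0 HM] := ea _ s80.
have [K1 K10 HK1] := Hg _ s0; have [K2 K20 HK2] := Hg' _ s0.
exists (2 * M); first by rewrite mulr_ge0.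
move=> z h zs' zhs'; have zs : nm z <= s by rewrite /s; lra.
have zhs : nm (z + h) <= s by rewrite /s; lra.
have P N : nm (psum a N.+1 (z + h) - psum a N.+1 z - psum (dcoef a) N z * h) <=
    2 * M * nm h ^+ 2.
  have -> : psum a N.+1 (z + h) - psum a N.+1 z - psum (dcoef a) N z * h =
     \sum_(i < N.+1) a i * ((z + h) ^+ i - z ^+ i - i%:R * z ^+ i.-1 * h).
    elim: N => [|N IH].
      by rewrite /psum big_ord0 !big_ord1 /= !expr0; ring.
    rewrite big_ord_recr /= -IH [psum a N.+2 (z + h)]psumS [psum a N.+2 z]psumS [psum (dcoef a) N.+1 z]psumS.
    by rewrite /dcoef /=; ring.
  apply: le_trans (@nm_sum _ _ (fun i => a i * ((z + h) ^+ i - z ^+ i - i%:R * z ^+ i.-1 * h))) _.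
  have T : \sum_(i < N.+1) nm (a i) * (i%:R ^+ 2 * s ^+ i) <= 2 * M.
    have := @geo_tail R M (fun i => nm (a i) * (i%:R ^+ 2 * s ^+ i)) M0 _ 0%N N.+1.
    rewrite expr0 divr1; apply => m; rewrite ler_pdivlMr ?exprn_gt0 //.
    apply: le_trans (HM m); rewrite -mulrA ler_wpM2l ?nm_ge0 //.
    have -> : (8 * s) ^+ m = 2 ^+ m ^+ 2 * s ^+ m * 2 ^+ m.
      rewrite -exprM mulnC exprM -!exprMn; congr (_ ^+ _).
      by rewrite expr2; ring.
    rewrite ler_wpM2r ?exprn_ge0 // ler_wpM2r ?exprn_ge0 ?(ltW s0) //.
    by rewrite lerXn2r ?nnegrE ?exprn_ge0 // pow2_nat.
  apply: le_trans (_ : \sum_(i < N.+1) nm (a i) * (i%:R ^+ 2 * s ^+ i) * nm h ^+ 2 <= _).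
    apply: ler_sum => i _; rewrite nmM -[leRHS]mulrA ler_wpM2l ?nm_ge0 //.
    exact: pow_taylor.
  by rewrite -mulr_suml ler_wpM2r ?sqr_ge0.
apply: (@le_pow2 _ _ _ (2 * K1 + K2 * nm h)) => N.
have b1 : nm (g (z + h) - psum a N.+1 (z + h)) <= K1 / 2 ^+ N.
  apply: le_trans (HK1 N.+1 _ zhs) _; rewrite ler_wpM2l // lef_pV2 ?posrE ?exprn_gt0 //.
  by rewrite ler_weXn2l // ler1n.
have b2 : nm (g z - psum a N.+1 z) <= K1 / 2 ^+ N.
  apply: le_trans (HK1 N.+1 _ zs) _; rewrite ler_wpM2l // lef_pV2 ?posrE ?exprn_gt0 //.
  by rewrite ler_weXn2l // ler1n.
have b3 : nm ((g' z - psum (dcoef a) N z) * h) <= K2 / 2 ^+ N * nm h.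
  by rewrite nmM ler_wpM2r ?nm_ge0 // HK2.
have -> : g (z + h) - g z - g' z * h =
   (psum a N.+1 (z + h) - psum a N.+1 z - psum (dcoef a) N z * h) +
   ((g (z + h) - psum a N.+1 (z + h)) - (g z - psum a N.+1 z)
    - (g' z - psum (dcoef a) N z) * h) by ring.
apply: le_trans (nmD _ _) _; apply: lerD; first exact: P.
have -> : (2 * K1 + K2 * nm h) / 2 ^+ N = (K1 / 2 ^+ N + K1 / 2 ^+ N) + K2 / 2 ^+ N * nm h.
  by ring.
apply: le_trans (nmB _ _) _; apply: lerD b3.
by apply: le_trans (nmB _ _) _; apply: lerD.
Qed.

Lemma rep_cdiff g a g' : rep g a -> rep g' (dcoef a) -> forall z, cdiff g z (g' z).
Proof.
move=> rg rg' z e e0; have s0 : 0 < nm z + 1 by rewrite ltr_wpDl ?nm_ge0.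
have [K K0 HK] := rep_quad rg rg' s0.
have K1 : 0 < K + 1 by rewrite ltr_wpDl.
exists (Num.min 1 (e / (K + 1))); first by rewrite lt_min ltr01 divr_gt0.
move=> h; rewrite lt_min => /andP[h1 h2].
have zz : nm z <= nm z + 1 by rewrite lerDl.
have zh : nm (z + h) <= nm z + 1 by apply: le_trans (nmD _ _) _; rewrite lerD2l ltW.
apply: le_trans (HK _ _ zz zh) _; rewrite expr2 mulrA ler_wpM2r ?nm_ge0 //.
move: h2; rewrite ltr_pdivlMr // => h2; have := nm_ge0 h; nra.
Qed.

(** The formally differentiated series is summed first; the quadratic error bound then identifies
    its sum with the derivative. *)
Lemma rep_entire g a : rep g a -> entire g /\ rep (derive1 g) (dcoef a).
Proof.
move=> rg; have [g' rg'] := rep_ex (ecoef_d rg.1).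
have cd := rep_cdiff rg rg'.
split; first by move=> z; case: (cdiff_derive (cd z)).
by have -> : derive1 g = g' by apply/funext => z; case: (cdiff_derive (cd z)).
Qed.

Lemma rep_uniq g g' a : rep g a -> rep g' a -> g = g'.
Proof.
move=> [_ H] [_ H']; apply/funext => z; apply/eqP; rewrite -subr_eq0 -nm_eq0.
rewrite eq_le nm_ge0 andbT.
have s0 : 0 < nm z + 1 by rewrite ltr_wpDl ?nm_ge0.
have zz : nm z <= nm z + 1 by rewrite lerDl.
have [K _ HK] := H _ s0; have [K' _ HK'] := H' _ s0.
apply: (@le_pow2 _ _ _ (K + K')) => N; rewrite add0r mulrDl.
have -> : g z - g' z = (g z - psum a N z) - (g' z - psum a N z) by ring.
by apply: le_trans (nmB _ _) _; apply: lerD; [exact: HK|exact: HK'].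
Qed.

Lemma tc_rep g a m : rep g a -> tc g m = a m.
Proof.
move=> rg; have [eg _] := rep_entire rg; have [_ /(_ 1 ltr01)[K K0 HK]] := rg.
apply/eqP; rewrite -subr_eq0 -nm_eq0 eq_le nm_ge0 andbT.
apply: (@le_pow2 _ _ _ (2 * K)) => N; rewrite add0r.
have ep := @entire_psum R a (N + m).+1; have enp := entireN ep.
have E : tc (fun z => g z + - psum a (N + m).+1 z) m = tc g m - a m.
  rewrite /tc (coefcD 1 m (entire_cont eg) (entire_cont enp)); congr (_ + _).
  have -> : (fun w => - psum a (N + m).+1 w) = (fun w => -1 * psum a (N + m).+1 w).
    by apply/funext => w; rewrite mulN1r.
  by rewrite (coefcZ (-1) 1 m (entire_cont ep)) coefc_psum // ltnS leq_addl mulN1r.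
have := @tc_mean_le R _ 1 m (K / 2 ^+ N) (entireD eg enp) ltr01.
rewrite E expr1n mulr1 mulrA; apply => z z1.
apply: le_trans (HK (N + m).+1 z _) _; first by rewrite z1.
rewrite ler_wpM2l // lef_pV2 ?posrE ?exprn_gt0 // ler_weXn2l ?ler1n //.
by rewrite leqW // leq_addr.
Qed.

Lemma entire_d f : entire f -> entire (derive1 f).
Proof. by move=> /rep_tc/rep_entire[_ /rep_entire[]]. Qed.

Lemma tc_d f m : entire f -> tc (derive1 f) m = m.+1%:R * tc f m.+1.
Proof. by move=> /rep_tc/rep_entire[_ /(tc_rep m)]. Qed.

Lemma eq_tc f g : entire f -> entire g -> tc f =1 tc g -> f = g.
Proof.
move=> /rep_tc rf /rep_tc rg fg; apply: rep_uniq rf _.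
by have -> : tc f = tc g by apply/funext.
Qed.

Lemma primitive f : entire f -> exists2 g, entire g & derive1 g = f.
Proof.
move=> /rep_tc rf; have [g rg] := rep_ex (ecoef_p rf.1).
have [eg] := rep_entire rg; rewrite dcoef_p => rg'.
by exists g => //; apply: rep_uniq rg' rf.
Qed.

Lemma entire_bounded f s : entire f ->
  exists2 K : R, 0 <= K & forall z, nm z <= s -> nm (f z) <= K.
Proof.
move=> /rep_tc[_ Hf].
have s0 : 0 < `|s| + 1 by rewrite ltr_wpDl.
have [K K0 HK] := Hf _ s0; exists K => // z zs.
have := HK 0%N z; rewrite /psum big_ord0 subr0 expr0 divr1; apply.
by have := ler_norm s; lra.
Qed.

End Taylor.

(** * Entire functions *)

Section EntireFunctions.
Variable R : realType.
Implicit Types (f g h : C R -> C R) (r s t x y : R) (z w c : C R).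

Lemma d1D f g z : entire f -> entire g ->
  derive1 (fun z => f z + g z) z = derive1 f z + derive1 g z.
Proof. by move=> ef eg; rewrite !derive1E; apply: deriveD. Qed.

Lemma d1M f g z : entire f -> entire g ->
  derive1 (fun z => f z * g z) z = derive1 f z * g z + f z * derive1 g z.
Proof.
move=> ef eg; rewrite !derive1E.
have := deriveM (ef z) (eg z); rewrite /GRing.scale /= => H.
by rewrite -[LHS]/('D_1 (f * g) z) H addrC; congr (_ + _); rewrite mulrC.
Qed.

Lemma d1_cst c z : derive1 (fun=> c) z = 0.
Proof. by rewrite derive1E; apply: derive_cst. Qed.

Lemma d1N f z : entire f -> derive1 (fun z => - f z) z = - derive1 f z.
Proof. by move=> ef; rewrite !derive1E; apply: deriveN. Qed.

Lemma cdiff_cexp_comp h z : entire h ->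
  cdiff (fun z => cexp (h z)) z (cexp (h z) * derive1 h z).
Proof. by move=> eh; apply: cdiff_comp (entire_cdiff eh z) (cdiff_cexp _). Qed.

Lemma entire_cexp h : entire h -> entire (fun z => cexp (h z)).
Proof. by move=> eh; apply: cdiff_entire => z; eexists; apply: cdiff_cexp_comp. Qed.

Lemma d1_cexp h z : entire h -> derive1 (fun z => cexp (h z)) z = cexp (h z) * derive1 h z.
Proof. by move=> eh; case: (cdiff_derive (cdiff_cexp_comp z eh)). Qed.

Lemma cdiff_shift f c z : entire f -> cdiff (fun z => f (z + c)) z (derive1 f (z + c)).
Proof.
move=> ef e e0; have [d d0 H] := entire_cdiff ef (z + c) e0; exists d => // h hd.
by have := H h hd; rewrite (addrAC z c h).
Qed.

Lemma entire_shift f c : entire f -> entire (fun z => f (z + c)).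
Proof. by move=> ef; apply: cdiff_entire => z; eexists; apply: cdiff_shift. Qed.

Lemma d1_shift f c z : entire f -> derive1 (fun z => f (z + c)) z = derive1 f (z + c).
Proof. by move=> ef; case: (cdiff_derive (cdiff_shift c z ef)). Qed.

Lemma entireV f : entire f -> (forall z, f z != 0) -> entire (fun z => (f z)^-1).
Proof. by move=> ef f0 z; apply: derivableV. Qed.

Lemma entireXn f n : entire f -> entire (fun z => f z ^+ n).
Proof.
move=> ef; elim: n => [|n IH]; first exact: entire_cst.
by under eq_fun do rewrite exprS; apply: entireM.
Qed.

Lemma tc_zero m : tc (fun=> 0) m = 0 :> C R.
Proof.
have -> : (fun _ : C R => 0 : C R) = (fun z : C R => 0 * (fun _ : C R => 1 : C R) z).
  by apply/funext => z; rewrite mul0r.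
by rewrite /tc (coefcZ 0 1 m (entire_cont (@entire_cst R 1))) mul0r.
Qed.

Lemma entire_d0_cst f : entire f -> (forall z, derive1 f z = 0) -> forall z, f z = f 0.
Proof.
move=> ef d0 z; have e0 := @entire_cst R (f 0).
suff -> : f = fun=> f 0 by [].
apply: eq_tc => // -[|m]; first by rewrite !tc0.
have E g : entire g -> (forall z, derive1 g z = 0) -> tc g m.+1 = 0.
  move=> eg dg; have := tc_d m eg.
  have -> : derive1 g = fun=> 0 by apply/funext => w; rewrite dg.
  rewrite tc_zero => /esym/eqP; by rewrite mulf_eq0 pnatr_eq0 => /eqP.
exact: etrans (E _ ef d0) (esym (E _ e0 (d1_cst _))).
Qed.

(** Here [m] is the first index with a nonzero Taylor coefficient, and [g] has the coefficients
    shifted by [m]. *)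
Lemma factor_zero f : entire f -> (exists z, f z != 0) ->
  exists m g, [/\ entire g, g 0 != 0 & forall z, f z = z ^+ m * g z].
Proof.
move=> ef [z0 fz0]; have [ea ra] := rep_tc ef.
have [m Hm Hmin] : exists2 m, tc f m != 0 & forall i, (i < m)%N -> tc f i = 0.
  have ex : exists m, tc f m != 0.
    apply: contrapT => H; move/eqP: fz0; apply.
    have e0 := @entire_cst R 0.
    have -> : f = fun=> 0; last by [].
    apply: (eq_tc ef e0) => m; rewrite tc_zero.
    by apply/eqP/negPn/negP => h; apply: H; exists m.
  exists (ex_minn ex); case: ex_minnP => // m mP min i im.
  by apply/eqP/negPn/negP => /min; rewrite leqNgt im.
pose b i := tc f (m + i)%N.
have eb : ecoef b.
  move=> s s0; have [M M0 HM] := ea s s0; exists (M / s ^+ m).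
    by rewrite divr_ge0 // exprn_ge0 // ltW.
  move=> i; rewrite ler_pdivlMr ?exprn_gt0 // -mulrA -exprD (addnC i m).
  exact: HM.
have [g rg] := rep_ex eb; have [eg _] := rep_entire rg.
exists m, g; split=> //.
  by rewrite -tc0 // (tc_rep _ rg) /b addn0.
have es := entireM (@entireX R m) eg.
move=> z; apply/eqP; rewrite -subr_eq0 -nm_eq0 eq_le nm_ge0 andbT.
have s0 : 0 < nm z + 1 by rewrite ltr_wpDl ?nm_ge0.
have zz : nm z <= nm z + 1 by rewrite lerDl.
have [K K0 HK] := ra _ s0; have [K' K'0 HK'] := rg.2 _ s0.
apply: (@le_pow2 _ _ _ (K + nm z ^+ m * K')) => N; rewrite add0r mulrDl.
have E : psum (tc f) (m + N) z = z ^+ m * psum b N z.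
  rewrite psum_add /psum big1 ?add0r => [|i _]; last by rewrite Hmin ?mul0r.
  by rewrite mulr_sumr; apply: eq_bigr => i _; rewrite /b exprD mulrCA.
have -> : f z - z ^+ m * g z = (f z - psum (tc f) (m + N) z) - z ^+ m * (g z - psum b N z).
  by rewrite E; ring.
apply: le_trans (nmB _ _) _; apply: lerD.
  apply: le_trans (HK _ _ zz) _; rewrite ler_wpM2l // lef_pV2 ?posrE ?exprn_gt0 //.
  by rewrite ler_weXn2l ?leq_addl // ler1n.
by rewrite nmM nmX -mulrA ler_wpM2l ?exprn_ge0 ?nm_ge0 // HK'.
Qed.

(** With the zeros at the origin factored out, the product of the cofactors is nonzero at 0, hence
    at some small [z != 0]. This is how the identity theorem enters: nonzero entire factors can be
    cancelled. *)
Lemma entire_dom f g : entire f -> entire g -> (forall z, f z * g z = 0) ->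
  (forall z, f z = 0) \/ (forall z, g z = 0).
Proof.
move=> ef eg H; apply: contrapT => /not_orP[/existsNP[z1 /eqP f1] /existsNP[z2 /eqP g2]].
have [m [f0 [ef0 f00 fE]]] := factor_zero ef (ex_intro _ z1 f1).
have [n [g0 [eg0 g00 gE]]] := factor_zero eg (ex_intro _ z2 g2).
have ep := entireM ef0 eg0.
have p0 : 0 < nm (f0 0 * g0 0) by rewrite nm_gt0 mulf_neq0.
have [d d0 Hd] := (ccontP _ 0).1 (entire_cont ep (x := 0)) _ p0.
pose z := rC (d / 2) : C R.
have zn : nm z = d / 2 by rewrite /z nm_rC gtr0_norm // divr_gt0.
have z0 : z != 0 by rewrite -nm_gt0 zn divr_gt0.
have := Hd z; rewrite subr0 zn => /(_ _)/wrap[]; first by lra.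
have : f0 z * g0 z = 0.
  have := H z; rewrite fE gE => /eqP; rewrite !mulf_eq0 !expf_eq0 (negbTE z0) !andbF /=.
  by rewrite -mulf_eq0 => /eqP.
by move=> ->; rewrite sub0r nmN ltxx.
Qed.

Lemma entire_eq_mul f g h : entire f -> entire g -> entire h -> (exists z, h z != 0) ->
  (forall z, f z * h z = g z * h z) -> forall z, f z = g z.
Proof.
move=> ef eg eh [z0 h0] H.
have := entire_dom (entireD ef (entireN eg)) eh.
case=> [z|E z|E]; first by rewrite mulrBl H subrr.
  by apply/eqP; rewrite -subr_eq0 E.
by move: h0; rewrite E eqxx.
Qed.

(** For a primitive [h0] of [F' / F] the product [F * cexp (- h0)] is a constant [k]. As only the
    modulus of [F] is recorded, adding the real number [ln (nm k)] to [h0] suffices. *)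
Lemma entire_log F : entire F -> (forall z, F z != 0) -> exists2 h, entire h &
  forall z, derive1 F z = derive1 h z * F z /\ nm (F z) = expR (complex.Re (h z)).
Proof.
move=> eF F0; have eq := entireM (entire_d eF) (entireV eF F0).
have [h0 eh0 dh0] := primitive eq.
have en := entireN eh0; have ex := entire_cexp en; have eG := entireM eF ex.
have GE : forall z, F z * cexp (- h0 z) = F 0 * cexp (- h0 0).
  apply: (entire_d0_cst eG) => z.
  rewrite (d1M z eF ex) d1_cexp // d1N // dh0 /=.
  by field; rewrite F0.
pose k := F 0 * cexp (- h0 0); have k0 : k != 0 by rewrite mulf_neq0 // cexp_neq0.
exists (fun z => h0 z + rC (ln (nm k))).
  exact: entireD eh0 (@entire_cst R _).
move=> z; split.
  rewrite (d1D z eh0 (@entire_cst R _)) d1_cst addr0 dh0 /= divfK //.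
have -> : F z = k * cexp (h0 z).
  by rewrite -/k in GE; rewrite -(GE z) cexpN divfK ?cexp_neq0.
rewrite nmM nm_cexp ReD /= expRD mulrC lnK // posrE nm_gt0 //.
Qed.

Lemma mean_Re h s : entire h -> 0 < s ->
  mean (fun t => complex.Re (h (circle_pt s t))) = complex.Re (h 0).
Proof.
move=> eh s0; have : coefc h s 0 = h 0 by rewrite coefc_tc // tc0.
by move=> <- /=; apply: eq_mean => t; rewrite expr0 mulr1.
Qed.

Lemma rcont_circle_comp h s : entire h -> rcont (fun t => h (circle_pt s t)).
Proof. by move=> eh; apply/rcont_comp/rcont_circle/entire_cont. Qed.

Lemma continuous_norm_comp (u : R -> R) : continuous u -> continuous (fun t => `|u t|).
Proof. by move=> cu t; apply: cvg_norm; apply: cu. Qed.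

(** Adding the conjugate of [h] to the integrand costs nothing by [coefc_cj] and turns it into
    [2 Re h]; the other factor 2 is that of [cmean_le]. *)
Lemma tc_le_mean h s m : entire h -> 0 < s ->
  nm (tc h m.+1) * s ^+ m.+1 <= 4 * mean (fun t => `|complex.Re (h (circle_pt s t))|).
Proof.
move=> eh s0; have -> : nm (tc h m.+1) = nm (coefc h s m.+1) by rewrite coefc_tc.
have ch := rcont_circle_comp s eh; have [ch1 ch2] := ch.
have cV := rcontX m.+1 (@rcont_circleV R s).
have cu : continuous (fun t => `|complex.Re (h (circle_pt s t))|).
  exact: continuous_norm_comp.
have E : coefc h s m.+1 = 2 * cmean (fun t =>
   rC (complex.Re (h (circle_pt s t))) * (circle_pt s t)^-1 ^+ m.+1).
  rewrite -[LHS]addr0 -(coefc_cj m eh s0) /coefc -cmeanD.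
  - rewrite -cmeanZ; last by apply: rcontM => //; apply: rcont_rC.
    apply: eq_cmean => t; rewrite -mulrDl addcj rCM -mulrA; congr (_ * _).
    exact: rC_nat.
  - exact: rcontM.
  - by apply: rcontM => //; apply: rcont_cj.
have sp : 0 < s ^+ m.+1 by rewrite exprn_gt0.
rewrite E nmM nm_nat -ler_pdivlMr //.
have -> : 4 * mean (fun t => `|complex.Re (h (circle_pt s t))|) / s ^+ m.+1 =
    2 * (2 * mean (fun t => (s ^+ m.+1)^-1 * `|complex.Re (h (circle_pt s t))|)).
  by rewrite meanZ //; ring.
rewrite ler_pM2l //; apply: cmean_le.
- by apply: rcontM => //; apply: rcont_rC.
- by move=> t; apply: cvgM; [exact: cvg_cst|exact: cu].
- by move=> t _; rewrite nmM nm_rC nmX nmV nm_circle (gtr0_norm s0) exprVn mulrC.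
Qed.

End EntireFunctions.

(** * Jensen's inequality *)

Section Jensen.
Variable R : realType.
Implicit Types (f g h U : C R -> C R) (r s t x y d : R) (z w c : C R).

(** The truncated subtractions add up to [|j - n|]: each negative frequency of the kernel is
    replaced by its conjugate, which keeps the real part on the unit circle and produces a
    polynomial. *)
Definition vpq n z : C R :=
  \sum_(j < (n + n).+1) (4 ^- n * 'C(n + n, j)%:R) * z ^+ ((j - n) + (n - j))%N.

Lemma Re_sum n (F : nat -> C R) :
  complex.Re (\sum_(i < n) F i) = \sum_(i < n) complex.Re (F i).
Proof.
by elim: n => [|n IH]; rewrite ?big_ord0 // !big_ord_recr /= ReD IH.
Qed.

Lemma Re_rCM x z : complex.Re (rC x * z) = x * complex.Re z.
Proof. by rewrite ReM /= mul0r subr0. Qed.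

Lemma unit_cj z : nm z = 1 -> z^-1 = cj z.
Proof.
move=> nz; have z0 : z != 0 by rewrite -nm_gt0 nz ltr01.
apply: (mulfI z0); rewrite divff //.
have e : complex.Re z ^+ 2 + complex.Im z ^+ 2 = 1.
  rewrite -[RHS](expr1n _ 2) -nz; case: (z) => a b.
  by rewrite nm_sqrt sqr_sqrtr ?addr_ge0 ?sqr_ge0.
apply: C_eq; rewrite ?ReM ?ImM /cj /=.
  by rewrite -[LHS]/(1 : R) -e; ring.
by rewrite -[LHS]/(0 : R); ring.
Qed.

Lemma vpk_Re n s t x : 0 < s ->
  vpk n t x = complex.Re (vpq n (circle_pt s t * (circle_pt s x)^-1)).
Proof.
move=> s0; have s1 : s != 0 by rewrite gt_eqF.
have -> : vpk n t x = complex.Re (rC (vpk n t x)) by [].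
rewrite (vpkE n t x s0) /vpq.
pose F1 j := (4 ^- n * 'C(n + n, j)%:R * (circle_pt s t ^+ j * (circle_pt s t)^-1 ^+ n))
     * ((circle_pt s x)^-1 ^+ j * circle_pt s x ^+ n).
pose F2 j := (4 ^- n * 'C(n + n, j)%:R) *
     (circle_pt s t * (circle_pt s x)^-1) ^+ ((j - n) + (n - j))%N.
rewrite (Re_sum _ F1) (Re_sum _ F2); apply: eq_bigr => j _; rewrite /F1 /F2.
set q := circle_pt s t * (circle_pt s x)^-1.
have z0 := circle_neq0 t s1; have w0 := circle_neq0 x s1.
have q0 : q != 0 by rewrite mulf_neq0 // invr_eq0.
have nq : nm q = 1.
  by rewrite nmM nmV !nm_circle divff // normr_eq0.
have qc : q^-1 = cj q := unit_cj nq.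
have -> : (4 ^- n * 'C(n + n, j)%:R * (circle_pt s t ^+ j * (circle_pt s t)^-1 ^+ n))
     * ((circle_pt s x)^-1 ^+ j * circle_pt s x ^+ n) =
  (4 ^- n * 'C(n + n, j)%:R) * (q ^+ j * q^-1 ^+ n).
  rewrite -mulrA; congr (_ * _); rewrite /q invfM invrK !exprMn; ring.
have -> : (4 ^- n * 'C(n + n, j)%:R : C R) = rC (4 ^- n * 'C(n + n, j)%:R).
  by rewrite rCM rC_nat rCV rCX rC_nat.
rewrite !Re_rCM; congr (_ * _).
move: (nat_of_ord j) => i.
have [nj|jn] := leqP n i.
  have [k ->] : exists k, i = (k + n)%N by exists (i - n)%N; lia.
  have -> : ((k + n - n) + (n - (k + n)) = k)%N by lia.
  by rewrite exprD -mulrA -exprMn divff // expr1n mulr1.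
have [k ->] : exists k, n = (i + k)%N by exists (n - i)%N; lia.
have -> : ((i - (i + k)) + ((i + k) - i) = k)%N by lia.
by rewrite exprD mulrA -exprMn divff // expr1n mul1r qc -cjX.
Qed.

Lemma vpq0 n : vpq n 0 = rC (kap R n).
Proof.
rewrite /vpq /kap rCM rC_nat rCV rCX rC_nat mulrC.
have ln : (n < (n + n).+1)%N by lia.
rewrite (bigD1 (Ordinal ln)) //= subnn addn0 expr0 mulr1 big1 ?addr0 // => j jn.
have : nat_of_ord j != n by move: jn; rewrite -val_eqE.
move=> h; have [k ->] : exists k, ((j - n) + (n - j) = k.+1)%N.
  by exists ((j - n) + (n - j)).-1; lia.
by rewrite exprS mul0r mulr0.
Qed.

Lemma entire_sum n (F : nat -> C R -> C R) : (forall i, entire (F i)) ->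
  entire (fun z => \sum_(i < n) F i z).
Proof.
move=> eF; elim: n => [|n IH].
  by under eq_fun do rewrite big_ord0; apply: entire_cst.
by under eq_fun do rewrite big_ord_recr /=; exact: entireD IH (eF n).
Qed.

(* The polynomial P has real part V_n u on the circle, V_n the de la Vallee-Poussin means. *)
Lemma trig_approx (u : R -> R) s n : continuous u -> 0 < s -> exists P,
  [/\ entire P, complex.Re (P 0) = mean u &
   forall t, complex.Re (P (circle_pt s t)) = (kap R n)^-1 * mean (fun x => u x * vpk n t x)].
Proof.
move=> cu s0; have s1 : s != 0 by rewrite gt_eqF.
have k0 := kap_gt0 R n; have k1 : kap R n != 0 by rewrite gt_eqF.
have cr : rcont (fun x => rC (u x)) by apply: rcont_rC.
pose G z x := rC (u x) * vpq n (z * (circle_pt s x)^-1).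
pose e j := ((j - n) + (n - j))%N.
pose F z j x := (4 ^- n * 'C(n + n, j)%:R * z ^+ e j) * (rC (u x) * (circle_pt s x)^-1 ^+ e j).
have cw j : rcont (fun x => rC (u x) * (circle_pt s x)^-1 ^+ e j).
  by apply: rcontM => //; apply: rcontX; apply: rcont_circleV.
have cF z j : rcont (F z j) by apply: rcontM; [exact: rcont_cst|exact: cw].
have GF z x : G z x = \sum_(j < (n + n).+1) F z j x.
  rewrite /G /vpq mulr_sumr; apply: eq_bigr => j _.
  by rewrite /F /e exprMn; ring.
have cG z : rcont (G z).
  have -> : G z = fun x => \sum_(j < (n + n).+1) F z j x by apply/funext => x.
  exact: (cmean_sum _ (cF z)).1.
pose P z := (rC (kap R n))^-1 * cmean (G z).
have PE z : cmean (G z) = \sum_(j < (n + n).+1)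
   (4 ^- n * 'C(n + n, j)%:R * z ^+ e j) * cmean (fun x => rC (u x) * (circle_pt s x)^-1 ^+ e j).
  have -> : cmean (G z) = cmean (fun x => \sum_(j < (n + n).+1) F z j x) by apply: eq_cmean.
  by rewrite (cmean_sum _ (cF z)).2; apply: eq_bigr => j _; rewrite cmeanZ.
have ReP z : complex.Re (P z) = (kap R n)^-1 * mean (fun x => complex.Re (G z x)).
  by rewrite /P -rCV Re_rCM.
exists P; split.
- pose E j z := (4 ^- n * 'C(n + n, j)%:R * z ^+ e j) *
    cmean (fun x => rC (u x) * (circle_pt s x)^-1 ^+ e j).
  have eE j : entire (E j).
    exact: entireM (entireM (@entire_cst R _) (@entireX R (e j))) (@entire_cst R _).
  have H := entireM (@entire_cst R (rC (kap R n))^-1) (entire_sum eE (n := (n + n).+1)).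
  suff -> : P = fun z => (rC (kap R n))^-1 * \sum_(j < (n + n).+1) E j z by exact: H.
  by apply/funext => z; rewrite /P PE.
- rewrite ReP.
  have -> : mean (fun x => complex.Re (G 0 x)) = mean (fun x => kap R n * u x).
    by apply: eq_mean => x; rewrite /G mul0r vpq0 -rCM /= mulrC.
  by rewrite meanZ // mulKf.
- move=> t; rewrite ReP; congr (_ * _); apply: eq_mean => x.
  by rewrite /G (vpk_Re n t x s0) Re_rCM.
Qed.

Lemma ln_lip d x y : 0 < d -> d <= x -> d <= y -> `|ln x - ln y| <= `|x - y| / d.
Proof.
move=> d0; wlog xy : x y / x <= y.
  move=> H dx dy; have [/H|/ltW/H] := leP x y; first by apply.
  by rewrite distrC [in `|x - y|]distrC; apply.
move=> dx dy; have x0 : 0 < x by lra. have y0 : 0 < y by lra.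
have lxy : ln x <= ln y by rewrite ler_ln ?posrE.
rewrite !ler0_norm ?subr_le0 // !opprB.
rewrite -ln_div ?posrE //.
have -> : y / x = 1 + (y - x) / x by field; rewrite gt_eqF.
have p : 0 <= (y - x) / x by rewrite divr_ge0 // ?subr_ge0 // ltW.
apply: le_trans (le_ln1Dx _) _; first by lra.
by rewrite ler_wpM2l ?subr_ge0 // lef_pV2 ?posrE.
Qed.

Lemma lip_max d x y : `|Num.max x d - Num.max y d| <= `|x - y|.
Proof.
have a := ler_norm (x - y); have b := ler_norm (y - x); rewrite distrC in b.
have c := normr_ge0 (x - y).
by rewrite ler_norml; case: (leP x d) => ?; case: (leP y d) => ?; lra.
Qed.

Lemma entire_lip U s : entire U -> 0 < s -> exists2 L : R, 0 <= L &
  forall z w, nm z <= s -> nm w <= s -> nm (U w - U z) <= L * nm (w - z).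
Proof.
move=> eU s0; have rU := rep_tc eU; have [_ rU'] := rep_entire rU.
have [K K0 HK] := rep_quad rU rU' s0.
have [B B0 HB] := entire_bounded s (entire_d eU).
exists (B + K * (2 * s)).
  by rewrite addr_ge0 // mulr_ge0 // mulr_ge0 // ltW.
move=> z w zs ws; pose h := w - z.
have hs : nm h <= 2 * s by apply: le_trans (nmB _ _) _; lra.
have := HK z h zs; have -> : z + h = w by rewrite /h; ring.
move=> /(_ ws) H; have -> : U w - U z = (U w - U z - derive1 U z * h) + derive1 U z * h by ring.
apply: le_trans (nmD _ _) _; rewrite nmM.
have h1 : nm (derive1 U z) * nm h <= B * nm h by rewrite ler_wpM2r ?nm_ge0 // HB.
have h2 : K * nm h ^+ 2 <= K * (2 * s) * nm h.
  by rewrite expr2 mulrA ler_wpM2r ?nm_ge0 // ler_wpM2l.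
by rewrite -/h mulrDl; lra.
Qed.

(** The truncation at [ln d] makes the logarithm Lipschitz on discs in spite of the zeros of [U]. *)
Definition lmax U d z : R := ln (Num.max (nm (U z)) d).

Lemma lmax_lip U d s : entire U -> 0 < d -> 0 < s -> exists2 L : R, 0 <= L &
  forall z w, nm z <= s -> nm w <= s -> `|lmax U d w - lmax U d z| <= L * nm (w - z).
Proof.
move=> eU d0 s0; have [L L0 HL] := entire_lip eU s0.
exists (L / d); first by rewrite divr_ge0 // ltW.
move=> z w zs ws; rewrite /lmax.
apply: le_trans (ln_lip d0 _ _) _; rewrite ?le_max ?lexx ?orbT //.
rewrite mulrAC ler_wpM2r ?invr_ge0 ?(ltW d0) //.
apply: le_trans (lip_max _ _ _) _; apply: le_trans (HL z w zs ws).
rewrite ler_norml nm_dist andbT lerNl opprB nmBC; exact: nm_dist.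
Qed.

Lemma continuous_lmax U d s : entire U -> 0 < d ->
  continuous (fun t => lmax U d (circle_pt s t)).
Proof.
move=> eU d0 t.
apply: (@continuous_comp _ _ _ (fun t => Num.max (nm (U (circle_pt s t))) d) (@ln R)).
  apply: continuous_max; last exact: cvg_cst.
  exact: (rcont_nm (rcont_circle_comp s eU)).
by apply: continuous_ln; rewrite lt_max d0 orbT.
Qed.

(** Some entire [P] has [Re P >= lmax U d - 1] on the circle and [Re (P 0)] equal to the mean. Then
    [U * cexp (- P)] has modulus at most [e] on the circle, and Cauchy's estimate at 0 bounds
    [nm (U 0) * expR (- mean)] by [2 e]. The level [d] drops out of the constant. *)
Lemma jensen_max U d s : entire U -> U 0 != 0 -> 0 < d -> 0 < s ->
  ln (nm (U 0)) <= mean (fun t => lmax U d (circle_pt s t)) + (1 + ln 2).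
Proof.
move=> eU U0 d0 s0; have [L L0 HL] := lmax_lip eU d0 s0.
pose u t := lmax U d (circle_pt s t).
have cu : continuous u by apply: continuous_lmax.
pose K := 2 * L ^+ 2 * s ^+ 2.
have K0 : 0 <= K by rewrite /K mulr_ge0 ?sqr_ge0 // mulr_ge0 // sqr_ge0.
(* With both error terms at most [1/4], the normalised kernel mean is within 1 of [u]. *)
have [n hn] : exists n : nat, K / n.+1%:R <= 1 / 4.
  have K40 : 0 <= 4 * K by rewrite mulr_ge0.
  exists (Num.bound (4 * K)); rewrite ler_pdivrMr ?ltr0Sn // -[(Num.bound _).+1%:R]natr1.
  by have := archi_boundP K40; lra.
have [P [eP P0 HP]] := trig_approx n cu s0.
have kp := kap_gt0 R n.
have ap t : u t - complex.Re (P (circle_pt s t)) <= 1.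
  rewrite HP.
  have := @vp_approx R (fun x => rC (u x)) n t (1 / 4) K (rcont_rC cu) _.
  have -> : cmean (fun x => rC (u x) * rC (vpk n t x)) = rC (mean (fun x => u x * vpk n t x)).
    apply: C_eq => /=; first by apply: eq_mean => x; rewrite !mul0r subr0.
    rewrite -[RHS](@mean_cst R 0); apply: eq_mean => x.
    by rewrite mul0r mulr0 addr0.
  rewrite -rCM -rCB nm_rC => /(_ _)/wrap[].
    move=> x _; rewrite -rCB nm_rC.
    have zs y : nm (circle_pt s y) <= s by rewrite nm_circle gtr0_norm.
    apply: le_trans (HL _ _ (zs t) (zs x)) _.
    have -> : K * (1 - cos (t - x)) = L ^+ 2 * (2 * s ^+ 2 * (1 - cos (t - x))) by rewrite /K; ring.
    rewrite -dist_circle -exprMn; set q := L * _.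
    (* The inequality [q <= 1/4 + q ^ 2] turns the Lipschitz bound into the quadratic one that the
       kernel estimate requires. *)
    have := sqr_ge0 (q - 1 / 2); rewrite sqrrB; lra.
  rewrite ler_norml => /andP[].
  have H2 : 2 * (kap R n * (1 / 4 + K / n.+1%:R)) <= kap R n.
    have := ler_wpM2l (ltW kp) hn; move: (K / n.+1%:R) => b hb.
    have -> : 2 * (kap R n * (1 / 4 + b)) = kap R n / 2 + 2 * (kap R n * b) by field.
    by lra.
  move: (2 * (kap R n * (1 / 4 + K / n.+1%:R))) H2 => B hB H _.
  rewrite lerBlDl -lerBlDr -(ler_pM2l kp) mulVKf ?gt_eqF // mulrBr mulr1.
  by rewrite [kap R n * u t]mulrC; lra.
have eN := entireN eP; have eX := entire_cexp eN; have ePhi := entireM eU eX.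
have B z : nm z = s -> nm (U z * cexp (- P z)) <= expR 1.
  move=> zs; have [t ht zE] := polar z; rewrite zs in zE.
  have m0 : 0 < Num.max (nm (U z)) d by rewrite lt_max d0 orbT.
  rewrite nmM nm_cexp ReN.
  apply: (@le_trans _ _ (Num.max (nm (U z)) d * expR (- complex.Re (P z)))).
    by rewrite ler_wpM2r ?expR_ge0 // le_max lexx.
  rewrite -[Num.max _ _](lnK (m0 : _ \in Num.pos)) -expRD ler_expR.
  by have := ap t; rewrite /u /lmax -zE.
have := tc_mean_le 0 ePhi s0 B.
rewrite expr0 mulr1 tc0 // nmM nm_cexp ReN P0.
have up : 0 < nm (U 0) by rewrite nm_gt0.
have m2 : 0 < 2 * expR 1 :> R by rewrite mulr_gt0 // expR_gt0.
have lp : 0 < nm (U 0) * expR (- mean u) by rewrite mulr_gt0 // expR_gt0.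
rewrite -ler_ln ?posrE // !lnM ?posrE ?expR_gt0 // !expRK.
by rewrite -/u; lra.
Qed.

(* Jensen's inequality in the form used for estimating quotients: where U vanishes nothing
   is assumed on w. *)
Lemma jensen U : entire U -> (exists z, U z != 0) -> exists K : R,
  forall s (w v : R -> R), 1 <= s -> continuous w -> continuous v ->
  (forall t, U (circle_pt s t) != 0 -> w t <= v t - ln (nm (U (circle_pt s t)))) ->
  mean w <= mean v + K.
Proof.
move=> eU nU; have [m [g [eg g0 UE]]] := factor_zero eU nU.
exists (1 + ln 2 - ln (nm (g 0))) => s w v s1 cw cv H.
have s0 : 0 < s by lra.
have p0 : 0 <= 2 * pi :> R by rewrite mulr_ge0 // pi_ge0.
have cwv : continuous (fun t => w t - v t).
  by move=> t; apply: cvgB; [exact: cw|exact: cv].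
have [t0 _ Ht0] := EVT_max p0 (continuous_subspaceT cwv).
(* Near the zeros of [g] the hypothesis gives no uniform control; there the maximum [B] of [w - v]
   is used, and the level is set so that [- ln d = B]. It may depend on the circle, because the
   bound of [jensen_max] does not depend on [d]. *)
pose B := w t0 - v t0; pose d := expR (- B); have d0 : 0 < d := expR_gt0 _.
have J := jensen_max eg g0 d0 s0.
pose u t := lmax g d (circle_pt s t); have cu : continuous u by apply: continuous_lmax.
have cN : continuous (fun t => - u t) by move=> t; apply: cvgN; exact: cu.
have cD : continuous (fun t => v t + - u t).
  by move=> t; apply: cvgD; [exact: cv|exact: cN].
have : mean w <= mean (fun t => v t + - u t).
  apply: mean_le => // t ht; rewrite /u /lmax.
  have [gd|gd] := leP d (nm (g (circle_pt s t))).
    have gp : 0 < nm (g (circle_pt s t)) := lt_le_trans d0 gd.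
    have z0 : circle_pt s t != 0 by rewrite circle_neq0 // gt_eqF.
    have Un : U (circle_pt s t) != 0.
      by rewrite UE mulf_neq0 ?expf_neq0 // -nm_gt0.
    (* As [1 <= s], the factor [z ^ m] has modulus at least 1 and only helps. *)
    apply: le_trans (H t Un) _; rewrite lerD2l lerN2 UE nmM.
    rewrite ler_ln ?posrE ?mulr_gt0 // ?nm_gt0 ?expf_neq0 //.
    rewrite ler_peMl ?nm_ge0 // nmX nm_circle gtr0_norm // exprn_ege1 //.
  rewrite /d expRK opprK; have := Ht0 t; rewrite in_itv /= ht => /(_ isT).
  by rewrite -/B; lra.
rewrite meanD // meanN //.
by have := J; rewrite -/u; lra.
Qed.

End Jensen.

(** * Small functions *)

Section SmallFunctions.
Variable R : realType.
Implicit Types (f g h F : C R -> C R) (r s t x y d : R) (z w c : C R).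
Variable mu : R -> R.

(** The 2 makes every constant at most a power of the gauge and keeps its logarithm away from 0; [s]
    and [(s - r)^-1] absorb what is lost between the radii. *)
Definition gauge r s : R := 2 + `|mu s| + s + (s - r)^-1.

Definition small g := entire g /\ exists K : nat, forall r s, 1 <= r -> r < s ->
  forall z, nm z <= r -> nm (g z) <= gauge r s ^+ K.

Lemma gauge_ge2 r s : 1 <= r -> r < s -> 2 <= gauge r s.
Proof.
move=> r1 rs; have : 0 <= (s - r)^-1 by rewrite invr_ge0; lra.
by have := normr_ge0 (mu s); rewrite /gauge; lra.
Qed.

Lemma gauge_pow r s k m : 1 <= r -> r < s -> (k <= m)%N -> gauge r s ^+ k <= gauge r s ^+ m.
Proof.
by move=> r1 rs km; apply: ler_weXn2l => //; have := gauge_ge2 r1 rs; lra.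
Qed.

Lemma pow2_ge x : exists K : nat, x <= 2 ^+ K.
Proof.
have h := archi_boundP (normr_ge0 x); exists (Num.bound `|x|).
apply: le_trans (ler_norm _) (le_trans (ltW h) _); exact: pow2_nat.
Qed.

Lemma small_entire g : small g -> entire g. Proof. by case. Qed.

Lemma small_cst c : small (fun=> c).
Proof.
split; first exact: entire_cst.
have [K HK] := pow2_ge (nm c); exists K => r s r1 rs z _.
apply: le_trans HK _; have := gauge_ge2 r1 rs => h.
by rewrite lerXn2r // nnegrE; lra.
Qed.

Lemma smallD f g : small f -> small g -> small (fun z => f z + g z).
Proof.
move=> [ef [K HK]] [eg [M HM]]; split; first exact: entireD ef eg.
exists (maxn K M).+1 => r s r1 rs z zr; apply: le_trans (nmD _ _) _.
have h1 := le_trans (HK r s r1 rs z zr) (gauge_pow r1 rs (leq_maxl K M)).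
have h2 := le_trans (HM r s r1 rs z zr) (gauge_pow r1 rs (leq_maxr K M)).
have g2 := gauge_ge2 r1 rs; have g0 : 0 <= gauge r s by lra.
rewrite exprS; have : 2 * gauge r s ^+ maxn K M <= gauge r s * gauge r s ^+ maxn K M.
  by rewrite ler_wpM2r // exprn_ge0.
lra.
Qed.

Lemma smallM f g : small f -> small g -> small (fun z => f z * g z).
Proof.
move=> [ef [K HK]] [eg [M HM]]; split; first exact: entireM ef eg.
exists (K + M)%N => r s r1 rs z zr; rewrite nmM exprD.
by apply: ler_pM; rewrite ?nm_ge0 ?HK ?HM.
Qed.

Lemma smallN f : small f -> small (fun z => - f z).
Proof.
move=> [ef [K HK]]; split; first exact: entireN ef.
by exists K => r s r1 rs z zr; rewrite nmN; apply: HK.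
Qed.

Lemma smallB f g : small f -> small g -> small (fun z => f z - g z).
Proof. by move=> sf /smallN; exact: smallD. Qed.

Lemma cauchy_d g z d (M : R) : entire g -> 0 < d ->
  (forall w, nm (w - z) = d -> nm (g w) <= M) -> nm (derive1 g z) * d <= 2 * M.
Proof.
move=> eg d0 HM; have es := @entire_shift R g z eg.
have -> : derive1 g z = tc (fun w => g (w + z)) 1.
  have := tc_d 0 es; rewrite mul1r => <-.
  by rewrite (tc0 (entire_d es)) (d1_shift z 0 eg) add0r.
rewrite -{1}(expr1 d); apply: (tc_mean_le 1 es d0) => w wd; apply: HM.
by rewrite addrK.
Qed.

Lemma small_d g : small g -> small (derive1 g).
Proof.
move=> [eg [K HK]]; split; first exact: entire_d.
exists (3 + (K + K))%N => r s r1 rs z zr.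
(* Half of the gap is spent on Cauchy's estimate. Over the other half the gauge is at most
   [2 * G <= G ^ 2], so that only the exponent grows. *)
pose d := (s - r) / 2; have d0 : 0 < d by rewrite /d; lra.
pose m := (r + s) / 2; have rm : r < m by rewrite /m; lra.
have ms : m < s by rewrite /m; lra.
have m1 : 1 <= m by lra.
have g2 := gauge_ge2 r1 rs; set G := gauge r s in g2 *.
have si : 0 <= (s - r)^-1 by rewrite invr_ge0; lra.
have Gm : gauge m s <= G ^+ 2.
  apply: (@le_trans _ _ (2 * G)).
    rewrite /G /gauge; have -> : (s - m)^-1 = 2 * (s - r)^-1.
      by rewrite /m; field; rewrite gt_eqF ?subr_gt0 //=; apply/eqP; lra.
    by have := normr_ge0 (mu s); lra.
  by rewrite expr2 ler_wpM2r //; lra.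
have B : forall w, nm (w - z) = d -> nm (g w) <= G ^+ (K + K).
  move=> w wd; have wm : nm w <= m.
    have -> : w = (w - z) + z by ring.
    by apply: le_trans (nmD _ _) _; rewrite wd /d /m; lra.
  apply: le_trans (HK m s m1 ms w wm) _; rewrite addnn -mul2n exprM.
  by rewrite lerXn2r ?nnegrE ?sqr_ge0 //; have := gauge_ge2 m1 ms; lra.
have := cauchy_d eg d0 B; rewrite -ler_pdivlMr // => /le_trans; apply.
have -> : 2 * G ^+ (K + K) / d = 2 * (2 * (s - r)^-1) * G ^+ (K + K).
  by rewrite /d; field; apply/eqP; lra.
rewrite [leRHS]exprD ler_wpM2r ?exprn_ge0 //; first lra.
have i1 : (s - r)^-1 <= G by rewrite /G /gauge; have := normr_ge0 (mu s); lra.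
have -> : 2 * (2 * (s - r)^-1) = 4 * (s - r)^-1 by ring.
apply: (@le_trans _ _ (4 * G)); first by lra.
by rewrite !exprS expr0; nra.
Qed.

Lemma geo_sum x n : 0 <= x -> x < 1 -> \sum_(i < n) x ^+ i <= (1 - x)^-1.
Proof.
move=> x0 x1; rewrite -[(1 - x)^-1]mul1r ler_pdivlMr; last by lra.
rewrite mulrC; have := subrX1 x n; have := exprn_ge0 n x0; lra.
Qed.

(** The coefficient bound at radius [s] gives a geometric series of ratio [r / s], whose sum
    [s / (s - r)] is controlled by the gauge. *)
Lemma small_of_mean h : entire h -> (forall r, 1 <= r ->
  mean (fun t => `|complex.Re (h (circle_pt r t))|) <= mu r) -> small h.
Proof.
move=> eh Hmu; split => //; have [ec rh] := rep_tc eh.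
have [K0 HK0] := pow2_ge (nm (tc h 0)).
(* The 5 counts factors of [4 * mu s * s * (s - r)^-1], where [4 <= G * G]; one more factor pays for
   adding the constant coefficient. *)
exists (maxn K0 5).+1 => r s r1 rs z zr.
have g2 := gauge_ge2 r1 rs; have g0 : 0 <= gauge r s by lra.
have s0 : 0 < s by lra.
set G := gauge r s in g2 g0 *.
have zs : nm z <= s by lra.
have [K K00 HK] := rh s s0.
have si : 0 <= (s - r)^-1 by rewrite invr_ge0; lra.
pose q := r / s; have q0 : 0 <= q by rewrite /q divr_ge0; lra.
have q1 : q < 1 by rewrite /q ltr_pdivrMr ?mul1r.
have mu0 : 0 <= mu s.
  apply: le_trans (Hmu s _); last by lra.
  rewrite -[0](@mean_cst R); apply: mean_le => //; first by move=> t; exact: cvg_cst.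
  by apply: continuous_norm_comp; case: (rcont_circle_comp s eh).
have P N : nm (psum (tc h) N z) <= nm (tc h 0) + 4 * mu s * (1 - q)^-1.
  apply: le_trans (@nm_sum _ _ (fun i => tc h i * z ^+ i)) _.
  case: N => [|N].
    rewrite big_ord0 addr_ge0 ?nm_ge0 // mulr_ge0 ?mulr_ge0 // invr_ge0; lra.
  rewrite big_ord_recl /= expr0 mulr1 lerD2l.
  apply: le_trans (_ : \sum_(i < N) 4 * mu s * q ^+ i <= _); last first.
    by rewrite -mulr_sumr ler_wpM2l ?mulr_ge0 // geo_sum.
  apply: ler_sum => i _; rewrite /bump /= add1n nmM nmX.
  have h1 : nm (tc h i.+1) * s ^+ i.+1 <= 4 * mu s.
    by apply: le_trans (tc_le_mean i eh s0) _; rewrite ler_pM2l // Hmu; lra.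
  have h2 : nm z ^+ i.+1 <= s ^+ i.+1 * q ^+ i.
    apply: (@le_trans _ _ (r ^+ i.+1)).
      by rewrite lerXn2r // nnegrE ?nm_ge0 //; lra.
    rewrite exprS [s ^+ _]exprS -mulrA -exprMn /q [s * (r / s)]mulrC divfK ?gt_eqF //.
    by rewrite ler_wpM2r ?exprn_ge0 //; lra.
  apply: (@le_trans _ _ (nm (tc h i.+1) * (s ^+ i.+1 * q ^+ i))).
    by rewrite ler_wpM2l ?nm_ge0.
  by rewrite mulrA ler_wpM2r ?exprn_ge0.
have H : nm (h z) <= nm (tc h 0) + 4 * mu s * (1 - q)^-1.
  apply: (@le_pow2 _ _ _ K) => N.
  have -> : h z = psum (tc h) N z + (h z - psum (tc h) N z) by ring.
  by apply: le_trans (nmD _ _) _; apply: lerD; [exact: P|exact: HK].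
apply: le_trans H _.
have -> : (1 - q)^-1 = s * (s - r)^-1.
  by rewrite /q; field; rewrite !gt_eqF ?subr_gt0.
have e1 : nm (tc h 0) <= G ^+ maxn K0 5.
  apply: le_trans HK0 _; apply: le_trans (_ : G ^+ K0 <= _).
    by rewrite lerXn2r // nnegrE.
  exact: gauge_pow (leq_maxl _ _).
have a1 : mu s <= G by rewrite /G /gauge (ger0_norm mu0); lra.
have a2 : s <= G by rewrite /G /gauge; have := normr_ge0 (mu s); lra.
have a3 : (s - r)^-1 <= G by rewrite /G /gauge; have := normr_ge0 (mu s); lra.
have e2 : 4 * mu s * (s * (s - r)^-1) <= G ^+ maxn K0 5.
  apply: le_trans (_ : G ^+ 5 <= _); last exact: gauge_pow (leq_maxr _ _).
  have -> : G ^+ 5 = (G * G * G) * (G * G) by rewrite !exprS expr0; ring.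
  have s0' := ltW s0; apply: ler_pM.
  - by rewrite mulr_ge0.
  - by rewrite mulr_ge0.
  - by apply: ler_pM => //; nra.
  - by apply: ler_pM.
rewrite exprS; have : 2 * G ^+ maxn K0 5 <= G * G ^+ maxn K0 5.
  by rewrite ler_wpM2r // exprn_ge0.
by lra.
Qed.

(** * Means bounded by the logarithm of the gauge *)

Definition ccont (w : C R -> R) := forall r, continuous (fun t => w (circle_pt r t)).

Definition msmall (w : C R -> R) := exists K : R, forall r s, 1 <= r -> r < s ->
  mean (fun t => w (circle_pt r t)) <= K * ln (gauge r s).

Lemma ln_gauge r s : 1 <= r -> r < s -> ln 2 <= ln (gauge r s).
Proof.
move=> r1 rs; have := gauge_ge2 r1 rs => h; rewrite ler_ln ?posrE //; lra.
Qed.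

Lemma ln_le x y : 0 < x -> x <= y -> ln x <= ln y.
Proof. by move=> x0 xy; rewrite ler_ln ?posrE //; lra. Qed.

Lemma ln2_gt0 : 0 < ln 2 :> R. Proof. by rewrite ln_gt0 // ltr1n. Qed.

Lemma msmallD (w v : C R -> R) : ccont w -> ccont v -> msmall w -> msmall v ->
  msmall (fun z => w z + v z).
Proof.
move=> cw cv [K HK] [M HM]; exists (K + M) => r s r1 rs.
by rewrite meanD ?mulrDl ?lerD ?HK ?HM.
Qed.

Lemma msmall_cst (x : R) : msmall (fun=> x).
Proof.
exists (`|x| / ln 2) => r s r1 rs; rewrite mean_cst.
apply: le_trans (ler_norm x) _; rewrite mulrAC -mulrA.
have l := ln_gauge r1 rs; have l2 := ln2_gt0.
by rewrite ler_peMr // ler_pdivlMr // mul1r.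
Qed.

Definition lnp g z : R := ln (1 + nm (g z)).

Lemma ccont_lnp g : entire g -> ccont (lnp g).
Proof.
move=> eg r t.
apply: (@continuous_comp _ _ _ (fun t => 1 + nm (g (circle_pt r t))) (@ln R)).
  by apply: cvgD; [exact: cvg_cst|exact: (rcont_nm (rcont_circle_comp r eg))].
by apply: continuous_ln; rewrite ltr_wpDr ?nm_ge0.
Qed.

Lemma msmall_lnp g : small g -> msmall (lnp g).
Proof.
move=> [eg [K HK]]; exists K.+1%:R => r s r1 rs.
rewrite -[leRHS](@mean_cst R); apply: mean_le.
- exact: ccont_lnp.
- by move=> t; exact: cvg_cst.
move=> t _; have g2 := gauge_ge2 r1 rs; have G0 : 0 < gauge r s by lra.
have p1 : 0 < 1 + nm (g (circle_pt r t)) by have := nm_ge0 (g (circle_pt r t)); lra.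
have p2 : 0 < gauge r s ^+ K.+1 by rewrite exprn_gt0.
rewrite mulr_natl -lnXn // /lnp (ler_ln (p1 : _ \in Num.pos) (p2 : _ \in Num.pos)).
have b : nm (g (circle_pt r t)) <= gauge r s ^+ K.
  by apply: HK => //; rewrite nm_circle ger0_norm //; lra.
have : 1 <= gauge r s ^+ K by rewrite exprn_ege1 //; lra.
rewrite exprS; nra.
Qed.

(** If [nm F = expR (Re h)], this is [log+ |F|], and its circle mean is the Nevanlinna
    characteristic of [F]. *)
Definition repos h z : R := Num.max (complex.Re (h z)) 0.

Lemma ccont_repos h : entire h -> ccont (repos h).
Proof.
move=> eh r t; have [cr _] := rcont_circle_comp r eh.
exact: (@continuous_max R R (fun t => complex.Re (h (circle_pt r t))) (fun=> 0) t (cr t)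
  (cvg_cst _)).
Qed.

(** Since [|x| = 2 * max x 0 - x] and [Re h] has mean [Re (h 0)], one-sided bounds on [Re h] control
    the mean of its absolute value. *)
Lemma mean_abs h r : entire h -> 0 < r ->
  mean (fun t => `|complex.Re (h (circle_pt r t))|) =
  2 * mean (fun t => repos h (circle_pt r t)) - complex.Re (h 0).
Proof.
move=> eh r0; have cp := ccont_repos eh (r := r).
have [cr _] := rcont_circle_comp r eh.
rewrite -(mean_Re eh r0) -meanN // -meanZ // -meanD.
- apply: eq_mean => t; rewrite /repos; set x := complex.Re _.
  by case: (leP x 0) => h0; [rewrite ler0_norm //; ring|rewrite gtr0_norm //; ring].
- by move=> t; apply: cvgM; [exact: cvg_cst|exact: cp].
- by move=> t; apply: cvgN; exact: cr.
Qed.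

Lemma ccontD (w v : C R -> R) : ccont w -> ccont v -> ccont (fun z => w z + v z).
Proof. by move=> cw cv r t; apply: cvgD; [exact: cw|exact: cv]. Qed.

Lemma ccont_cst (x : R) : ccont (fun=> x).
Proof. by move=> r t; exact: cvg_cst. Qed.

Lemma msmall_quot h U (v : C R -> R) : entire h -> entire U -> (exists z, U z != 0) ->
  ccont v -> msmall v -> (forall z, U z != 0 -> repos h z <= v z - ln (nm (U z))) ->
  msmall (repos h).
Proof.
move=> eh eU nU cv [K HK] H; have [M HM] := jensen eU nU.
have [K' HK'] := msmall_cst M; exists (K + K') => r s r1 rs.
have := HM r _ _ r1 (ccont_repos eh (r := r)) (cv r) (fun t => H (circle_pt r t)).
move=> /le_trans; apply; rewrite mulrDl; apply: lerD; first exact: HK.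
by have := HK' r s r1 rs; rewrite mean_cst.
Qed.

Lemma ln_repos h F z : nm (F z) = expR (complex.Re (h z)) -> lnp F z <= ln 2 + repos h z.
Proof.
move=> E; rewrite /lnp E /repos.
set x := complex.Re _; set m := Num.max x 0.
have m0 : 0 <= m by rewrite /m le_max lexx orbT.
have xm : x <= m by rewrite /m le_max lexx.
rewrite -{1}(expRK m) -lnM ?posrE ?expR_gt0 //.
apply: ln_le; first by have := expR_gt0 x; lra.
have : expR x <= expR m by rewrite ler_expR.
have : 1 <= expR m by rewrite -[1](@expR0 R) ler_expR.
by lra.
Qed.

Lemma lnp3 x y d : 0 <= x -> 0 <= y -> 0 <= d ->
  ln (1 + (x + y + d)) <= ln (1 + x) + ln (1 + y) + ln (1 + d).
Proof.
move=> x0 y0 d0; have p1 : 0 < 1 + x by lra.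
have p2 : 0 < 1 + y by lra.
have p3 : 0 < 1 + d by lra.
rewrite -!lnM ?posrE ?mulr_gt0 //; apply: ln_le; first by lra.
by have := mulr_ge0 x0 y0; have := mulr_ge0 x0 d0; have := mulr_ge0 y0 d0;
   have := mulr_ge0 (mulr_ge0 x0 y0) d0; lra.
Qed.

(** A root of the quadratic satisfies [|F| <= (1 + |al| + |be| + |ga|) / |al|] where [al] is
    nonzero; Jensen's inequality takes care of the division by [al]. *)
Lemma msmall_quad h F al be ga : entire h ->
  (forall z, nm (F z) = expR (complex.Re (h z))) ->
  small al -> small be -> small ga -> (exists z, al z != 0) ->
  (forall z, al z * F z ^+ 2 + be z * F z + ga z = 0) -> msmall (repos h).
Proof.
move=> eh FE sa sb sc na H.
have [ea eb ec] := And3 (small_entire sa) (small_entire sb) (small_entire sc).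
have ca := ccont_lnp ea; have cb := ccont_lnp eb; have cc := ccont_lnp ec.
apply: (msmall_quot eh ea na (ccontD (ccontD ca cb) cc)).
  exact: msmallD (ccontD ca cb) cc (msmallD ca cb (msmall_lnp sa) (msmall_lnp sb))
    (msmall_lnp sc).
move=> z az; have a0 : 0 < nm (al z) by rewrite nm_gt0.
have b0 := nm_ge0 (be z); have c0 := nm_ge0 (ga z).
apply: le_trans (lerB (lnp3 (ltW a0) b0 c0) (lexx _)).
set S := nm (al z) + nm (be z) + nm (ga z).
have S0 : 0 < 1 + S by rewrite /S; lra.
rewrite -ln_div ?posrE //.
rewrite /repos ge_max; apply/andP; split; last first.
  by rewrite ln_ge0 // ler_pdivlMr // mul1r /S; lra.
rewrite -[X in X <= _]expRK -FE ler_ln ?posrE ?divr_gt0 //; last first.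
  by rewrite FE expR_gt0.
rewrite ler_pdivlMr //; set x := nm (F z).
have x0 : 0 <= x by rewrite nm_ge0.
have [x1|x1] := leP x 1; first by rewrite /S; nra.
have E : nm (al z) * x ^+ 2 <= nm (be z) * x + nm (ga z).
  rewrite -nmX -!nmM; have -> : al z * F z ^+ 2 = - (be z * F z + ga z).
    by have := H z => /eqP; rewrite -addrA addr_eq0 => /eqP.
  rewrite nmN; exact: nmD.
rewrite -(ler_pM2r (lt_trans ltr01 x1)) /S.
have -> : x * nm (al z) * x = nm (al z) * x ^+ 2 by ring.
apply: le_trans E _; nra.
Qed.

(** [F1] is the quotient of [- (c F + e)] by [a F + b], whose logarithms are controlled by small
    functions and by [repos h]; Jensen's inequality is applied to the denominator. *)
Lemma msmall_moebius h F h1 F1 (a b c e : C R -> C R) : entire h -> entire h1 -> entire F ->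
  (forall z, nm (F z) = expR (complex.Re (h z))) ->
  (forall z, nm (F1 z) = expR (complex.Re (h1 z))) ->
  small a -> small b -> small c -> small e ->
  (exists z, a z * F z + b z != 0) ->
  (forall z, F1 z * (a z * F z + b z) = - (c z * F z + e z)) ->
  msmall (repos h) -> msmall (repos h1).
Proof.
move=> eh eh1 eF FE F1E sa sb sc se nU H mh.
have ea := small_entire sa; have eb := small_entire sb.
have ec := small_entire sc; have ee := small_entire se.
have eU := entireD (entireM ea eF) eb.
pose l z := ln 2 + repos h z.
have cl : ccont l := ccontD (@ccont_cst (ln 2)) (ccont_repos eh).
have ml : msmall l.
  exact: msmallD (@ccont_cst (ln 2)) (ccont_repos eh) (msmall_cst _) mh.
pose v1 z := lnp a z + l z + lnp b z; pose v2 z := lnp c z + l z + lnp e z.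
have ca := ccont_lnp ea; have cb := ccont_lnp eb; have cc := ccont_lnp ec.
have ce := ccont_lnp ee.
have cv1 : ccont v1 := ccontD (ccontD ca cl) cb.
have cv2 : ccont v2 := ccontD (ccontD cc cl) ce.
have mv1 : msmall v1.
  exact: msmallD (ccontD ca cl) cb (msmallD ca cl (msmall_lnp sa) ml) (msmall_lnp sb).
have mv2 : msmall v2.
  exact: msmallD (ccontD cc cl) ce (msmallD cc cl (msmall_lnp sc) ml) (msmall_lnp se).
apply: (msmall_quot eh1 eU nU (ccontD cv1 cv2) (msmallD cv1 cv2 mv1 mv2)).
have lin p q z : ln (1 + nm (p z * F z + q z)) <= lnp p z + l z + lnp q z.
  have pp := nm_ge0 (p z); have qq := nm_ge0 (q z); have ff := nm_ge0 (F z).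
  apply: (@le_trans _ _ (lnp p z + lnp F z + lnp q z)); last first.
    by rewrite lerD2r lerD2l; apply: ln_repos.
  have p1 : 0 < 1 + nm (p z) by lra. have p2 : 0 < 1 + nm (q z) by lra.
  have p3 : 0 < 1 + nm (F z) by lra.
  rewrite /lnp -!lnM ?posrE ?mulr_gt0 //; apply: ln_le.
    by have := nm_ge0 (p z * F z + q z); lra.
  have := nmD (p z * F z) (q z); rewrite nmM => h0.
  by have := mulr_ge0 pp ff; have := mulr_ge0 pp qq; have := mulr_ge0 ff qq;
     have := mulr_ge0 (mulr_ge0 pp ff) qq; lra.
move=> z Uz; set u := nm (a z * F z + b z); have u0 : 0 < u by rewrite nm_gt0.
apply: le_trans (lerB (lerD (lin a b z) (lin c e z)) (lexx _)).
rewrite -/u; set w := nm (c z * F z + e z); have w0 : 0 <= w by rewrite nm_ge0.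
have u1 : 0 < 1 + u by lra. have w1 : 0 < 1 + w by lra.
(* The summand [ln (1 + u)] in the majorant keeps it nonnegative after [ln u] is subtracted, as the
   positive part requires. *)
have lu : 0 <= ln (1 + u) - ln u.
  by rewrite subr_ge0 ler_ln ?posrE //; lra.
have lw : 0 <= ln (1 + w) by rewrite ln_ge0; lra.
rewrite /repos ge_max; apply/andP; split; last by lra.
have E : nm (F1 z) * u = w by rewrite -nmM H nmN.
have f0 : 0 < nm (F1 z) by rewrite F1E expR_gt0.
have -> : complex.Re (h1 z) = ln (nm (F1 z)) by rewrite F1E expRK.
have wp : 0 < w by rewrite -E mulr_gt0.
have -> : ln (nm (F1 z)) = ln w - ln u by rewrite -E lnM ?posrE // addrK.
have : ln w <= ln (1 + w) by rewrite ler_ln ?posrE //; lra.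
have : 0 <= ln (1 + u) by rewrite ln_ge0; lra.
by lra.
Qed.

Lemma growth_contra k : (forall r, 1 <= r -> 0 <= mu r) ->
  (forall s, exists M : R, forall r, 1 <= r -> r <= s -> mu r <= M) ->
  0 < k -> (forall r, 1 <= r -> k * r <= mu r) ->
  (exists K : R, forall r s, 1 <= r -> r < s -> mu r <= K * ln (gauge r s)) -> False.
Proof.
move=> mu0 bd k0 lo [K0 H0]; pose K := `|K0| + 1.
have K1 : 0 < K by rewrite /K; have := normr_ge0 K0; lra.
have H r s : 1 <= r -> r < s -> expR (mu r / K) <= gauge r s.
  move=> r1 rs; have g2 := gauge_ge2 r1 rs.
  have gp : 0 < gauge r s by lra.
  rewrite -[leRHS](lnK (gp : _ \in Num.pos)) ler_expR ler_pdivrMr // mulrC.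
  apply: le_trans (H0 r s r1 rs) _; apply: ler_wpM2r; first by rewrite ln_ge0; lra.
  by rewrite /K; have := ler_norm K0; lra.
(* For [y >= L] the summand [6 * K ^ 3] makes the cubic term of [expR (y / K)] at least [y ^ 2], and
   [9 + k^-1] makes [y ^ 2] exceed [2 * y] plus the other terms of the gauge. *)
pose L := 9 + k^-1 + 6 * K ^+ 3.
have ki : 0 < k^-1 by rewrite invr_gt0.
have K3 : 0 < 6 * K ^+ 3 by rewrite mulr_gt0 // exprn_gt0.
(* At [R0] the linear lower bound already exceeds [L]. The gaps [2 ^ (- j)] contribute [2 ^ j] to
   the gauge, which the lower bound [L * 2 ^ j] dominates, and all radii stay below [R0 + 2]. *)
pose R0 := L / k + 1; pose r (j : nat) := R0 + 2 - 2 / 2 ^+ j.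
have L0 : 0 < L by rewrite /L; lra.
have R01 : 1 <= R0 by rewrite /R0 lerDr divr_ge0 // ltW.
have rj j : 1 <= r j /\ r j <= R0 + 2.
  have : 2 / 2 ^+ j <= 2 :> R.
    by rewrite ler_pdivrMr ?exprn_gt0 // ler_peMr // exprn_ege1 // ler1n.
  have : 0 <= 2 / 2 ^+ j :> R by rewrite divr_ge0 // exprn_ge0.
  by rewrite /r; split; lra.
have grow j : L * 2 ^+ j <= mu (r j).
  elim: j => [|j IH].
    rewrite expr0 mulr1; apply: le_trans (lo _ _); last by case: (rj 0%N).
    rewrite /r expr0 /R0; have -> : k * (L / k + 1 + 2 - 2 / 1) = L + k.
      by field; rewrite gt_eqF.
    by lra.
  set y := L * 2 ^+ j in IH; have [r1 _] := rj j; have [r1' r2'] := rj j.+1.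
  have e2 : 0 < 2 ^+ j :> R by rewrite exprn_gt0.
  have dr : r j.+1 - r j = (2 ^+ j)^-1.
    by rewrite /r exprS; move: (2 ^+ j) e2 => b b0; field; rewrite gt_eqF.
  have rr : r j < r j.+1 by rewrite -subr_gt0 dr invr_gt0.
  have := H _ _ r1 rr; rewrite /gauge dr invrK (ger0_norm (mu0 _ r1')) => Hj.
  have p1 : 1 <= 2 ^+ j :> R by rewrite exprn_ege1 // ler1n.
  have yL : L <= y by rewrite /y ler_peMr // ltW.
  have y2 : 2 ^+ j <= y by rewrite /y ler_peMl // ?(ltW e2) // /L; lra.
  have ex : y ^+ 2 <= expR (mu (r j) / K).
    apply: le_trans (_ : expR (y / K) <= _); last first.
      by rewrite ler_expR ler_wpM2r // invr_ge0 ltW.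
    have y0 : 0 <= y by lra.
    have yk : 0 <= y / K by rewrite divr_ge0 // ltW.
    have := @expR_ge1Dxn R (y / K) 2 yk.
    have -> : (y / K) ^+ 3 / 3`!%:R = y ^+ 2 * (y / (6 * K ^+ 3)).
      have -> : 3`! = 6%N by [].
      by field; rewrite gt_eqF.
    have : 1 <= y / (6 * K ^+ 3).
      by rewrite ler_pdivlMr // mul1r; apply: le_trans yL; rewrite /L; lra.
    move=> h1 h2; have := ler_wpM2l (sqr_ge0 y) h1; lra.
  have yk : L / k <= y * k^-1 by rewrite ler_wpM2r // ltW.
  have : 2 * y + 2 + (R0 + 2) + 2 ^+ j <= y ^+ 2.
    have y9 : 9 + k^-1 <= y by apply: le_trans yL; rewrite /L; lra.
    have yp : 0 <= y by lra.
    have := ler_wpM2l yp y9; have -> : y * (9 + k^-1) = 9 * y + y * k^-1 by ring.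
    have -> : y ^+ 2 = y * y by rewrite expr2.
    move: (y * k^-1) (y * y) yk => b1 b2; rewrite /R0; move: (L / k) => b3 yk yy.
    by lra.
  by move=> hy; rewrite exprS mulrCA -/y; lra.
have [M HM] := bd (R0 + 2).
have [j hj] : exists j : nat, M < L * 2 ^+ j.
  have hb := archi_boundP (normr_ge0 M); exists (Num.bound `|M|).
  apply: le_lt_trans (ler_norm M) (lt_le_trans hb _).
  apply: le_trans (pow2_nat _ _) _; rewrite ler_peMl ?exprn_ge0 // /L; lra.
have [q1 q2] := rj j.
by have := le_lt_trans (le_trans (grow j) (HM _ q1 q2)) hj; rewrite ltxx.
Qed.

End SmallFunctions.

(** * Differential polynomials and the four-term relation *)

Section DifferentialPolynomial.
Variable R : realType.
Implicit Types (f g h q F G : C R -> C R) (r s t x y : R) (z w c d : C R).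

Definition nz g := exists z, g z != 0.

Lemma nzP g : (forall z, g z = 0) \/ nz g.
Proof.
have [H|H] := pselect (nz g); [by right|left => z].
by apply/eqP/negPn/negP => gz; apply: H; exists z.
Qed.

Lemma nzM f g : entire f -> entire g -> nz f -> nz g -> nz (fun z => f z * g z).
Proof.
move=> ef eg [z1 h1] [z2 h2]; have [H|//] := nzP (fun z => f z * g z).
have [E|E] := entire_dom ef eg H.
- by move: h1; rewrite E eqxx.
- by move: h2; rewrite E eqxx.
Qed.

Lemma nz_shift g c : nz g -> nz (fun z => g (z + c)).
Proof. by move=> [z h]; exists (z - c); rewrite subrK. Qed.

(** The quotient [G^(j) / G] for any [G] with [G' = q G], written without division so that it is
    visibly entire and inherits smallness from [q]. *)
Fixpoint dpoly q j : C R -> C R :=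
  if j is i.+1 then fun z => derive1 (dpoly q i) z + q z * dpoly q i z else fun=> 1.

Lemma entire_dpoly q j : entire q -> entire (dpoly q j).
Proof.
move=> eq; elim: j => [|j IH]; first exact: entire_cst.
exact: entireD (entire_d IH) (entireM eq IH).
Qed.

Lemma small_dpoly mu q j : small mu q -> small mu (dpoly q j).
Proof.
move=> sq; elim: j => [|j IH]; first exact: small_cst.
exact: smallD (small_d IH) (smallM sq IH).
Qed.

Lemma dpoly_shift q c j : entire q ->
  dpoly (fun z => q (z + c)) j = fun z => dpoly q j (z + c).
Proof.
move=> eq; elim: j => [//|j IH]; apply/funext => z /=.
by rewrite IH (d1_shift c z (@entire_dpoly q j eq)).
Qed.

Lemma derive1n_dpoly G q j : entire G -> entire q ->
  (forall z, derive1 G z = q z * G z) -> derive1n j G = fun z => dpoly q j z * G z.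
Proof.
move=> eG eq H; elim: j => [|j IH].
  by apply/funext => z; rewrite derive1n0 /= mul1r.
rewrite derive1nS IH; apply/funext => z.
rewrite (d1M z (@entire_dpoly q j eq) eG) H /=; ring.
Qed.

Lemma entire_dn f j : entire f -> entire (derive1n j f).
Proof.
by move=> ef; elim: j => [//|j IH]; rewrite derive1nS; exact: entire_d IH.
Qed.

Lemma tc_dn0 f j : entire f -> (forall z, derive1n j f z = 0) ->
  forall m, tc f (m + j) = 0.
Proof.
elim: j f => [|j IH] f ef H m.
  have -> : f = fun=> 0 by apply/funext => z; have := H z; rewrite derive1n0.
  exact: tc_zero.
have := IH _ (entire_d ef) _ m; rewrite (tc_d _ ef) -derive1Sn addnS => /(_ H)/eqP.
by rewrite mulf_eq0 pnatr_eq0 => /eqP.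
Qed.

Lemma tc_poly f j : entire f -> (forall m, tc f (m + j) = 0) ->
  forall z, f z = (\poly_(i < j) tc f i).[z].
Proof.
move=> ef H z; rewrite horner_poly; apply/eqP; rewrite -subr_eq0 -nm_eq0.
rewrite eq_le nm_ge0 andbT.
have s0 : 0 < nm z + 1 by rewrite ltr_wpDl ?nm_ge0.
have zz : nm z <= nm z + 1 by rewrite lerDl.
have [K K0 HK] := (rep_tc ef).2 _ s0.
apply: (@le_pow2 _ _ _ K) => N; rewrite add0r.
have E : psum (tc f) (j + N) z = \sum_(i < j) tc f i * z ^+ i.
  rewrite psum_add [X in _ + X]big1 ?addr0 // => i _.
  by rewrite addnC H mul0r.
rewrite -E; apply: le_trans (HK _ _ zz) _.
rewrite ler_wpM2l // lef_pV2 ?posrE ?exprn_gt0 //.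
by rewrite ler_weXn2l ?leq_addl // ler1n.
Qed.

Lemma transcendental_dn f j : transcendental_entire f -> nz (derive1n j f).
Proof.
move=> [ef nf]; have [H|//] := nzP (derive1n j f).
by case: nf; exists (\poly_(i < j) tc f i); apply: (tc_poly ef (tc_dn0 ef H)).
Qed.

(** The quotient [f / g] may have poles. Instead [V = f - k g], with [k] fitted at a point where [g]
    is nonzero, vanishes there and satisfies [V' g = V g']; a zero of finite order [m + 1] would
    force [m + 1] times a nonzero number to be 0. *)
Lemma wronskian f g : entire f -> entire g -> nz g ->
  (forall z, derive1 f z * g z = f z * derive1 g z) -> exists k : C R, forall z, f z = k * g z.
Proof.
move=> ef eg [z0 gz0] H; pose k := f z0 / g z0; exists k.
pose V w := f (w + z0) + - (k * g (w + z0)); pose Y w := g (w + z0).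
have e1 := @entire_shift R f z0 ef; have e2 := @entire_shift R g z0 eg.
have ek := entireM (@entire_cst R k) e2.
have eV : entire V := entireD e1 (entireN ek).
have dV w : derive1 V w = derive1 f (w + z0) - k * derive1 g (w + z0).
  rewrite (d1D w e1 (entireN ek)) (d1N w ek) (d1M w (@entire_cst R k) e2) d1_cst mul0r add0r.
  by rewrite (d1_shift z0 w ef) (d1_shift z0 w eg).
have WV w : derive1 V w * Y w = V w * derive1 Y w.
  rewrite dV /V /Y (d1_shift z0 w eg); have := H (w + z0) => Hw.
  by rewrite mulrBl Hw; ring.
have V0 : V 0 = 0 by rewrite /V /k !add0r divfK // subrr.
suff VZ : forall w, V w = 0.
  by move=> z; apply/eqP; rewrite -subr_eq0; have := VZ (z - z0); rewrite /V subrK => ->.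
have [//|nV] := nzP V; exfalso.
have [m [v [ev v0 VE]]] := factor_zero eV nV.
case: m VE => [|m] VE; first by move: v0; have := VE 0; rewrite V0 expr0 mul1r => <-; rewrite eqxx.
have eX := @entireX R m; have eX1 := @entireX R m.+1.
have dX w : derive1 (fun z : C R => z ^+ m.+1) w = m.+1%:R * w ^+ m.
  exact: (@exp_derive1 (C R) m.+1 w).
have VE' : V = fun w => w ^+ m.+1 * v w by apply/funext.
have eX0 := @entireX R 1.
(* The cofactor of [w ^ m] in [V' Y - V Y']. *)
pose T w := m.+1%:R * (v w * Y w) + w ^+ 1 * (derive1 v w * Y w + - (v w * derive1 Y w)).
have eT : entire T.
  apply: entireD; first exact: entireM (@entire_cst R _) (entireM ev e2).
  apply: entireM eX0 _.
  exact: entireD (entireM (entire_d ev) e2) (entireN (entireM ev (entire_d e2))).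
have XT w : w ^+ m * T w = 0.
  have := WV w; rewrite VE' (d1M w eX1 ev) dX => /eqP; rewrite -subr_eq0 => /eqP <-.
  rewrite /T (exprS w m) expr1.
  by move: (derive1 v w) (v w) (Y w) (derive1 Y w) (w ^+ m) => b1 b2 b3 b4 b5; ring.
have [E|E] := entire_dom eX eT XT.
  by have := E 1; rewrite expr1n => /eqP; rewrite oner_eq0.
have Y0 : Y 0 != 0 by rewrite /Y add0r.
have m0 : m.+1%:R != 0 :> C R by rewrite pnatr_eq0.
have T0 : T 0 = m.+1%:R * (v 0 * Y 0) by rewrite /T expr1 mul0r addr0.
by have := mulf_neq0 m0 (mulf_neq0 v0 Y0); rewrite -T0 (E 0) eqxx.
Qed.

End DifferentialPolynomial.

(** * The four-term relation between two exponentials *)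

Section FourTerms.
Variable R : realType.
Implicit Types (r s t x y : R) (z w : C R).
Variables (h h1 G G1 a b c e : C R -> C R).
Hypotheses (eh : entire h) (eh1 : entire h1) (eG : entire G) (eG1 : entire G1).
Hypothesis GE : forall z, nm (G z) = expR (complex.Re (h z)).
Hypothesis G1E : forall z, nm (G1 z) = expR (complex.Re (h1 z)).
Hypothesis dG : forall z, derive1 G z = derive1 h z * G z.
Hypothesis dG1 : forall z, derive1 G1 z = derive1 h1 z * G1 z.

Let absmean (g : C R -> C R) (r : R) := mean (fun t => `|complex.Re (g (circle_pt r t))|).
(** One gauge for both exponents: [h] and [h1] become small together, without comparing their
    means. *)
Definition mu2 r := absmean h r + absmean h1 r.

Let absmean_ge0 (g : C R -> C R) (r : R) : entire g -> 0 <= absmean g r.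
Proof.
move=> eg; rewrite -[0](@mean_cst R); apply: mean_le => //; first by move=> t; exact: cvg_cst.
by apply: continuous_norm_comp; case: (rcont_circle_comp r eg).
Qed.

Lemma small_h : small mu2 h.
Proof. by apply: small_of_mean => // r _; rewrite lerDl absmean_ge0. Qed.
Lemma small_h1 : small mu2 h1.
Proof. by apply: small_of_mean => // r _; rewrite lerDr absmean_ge0. Qed.

Hypotheses (sa : small mu2 a) (sb : small mu2 b) (sc : small mu2 c) (se : small mu2 e).
Hypothesis rel : forall z,
  a z * (G z * G1 z) + b z * G1 z + c z * G z + e z = 0.
Hypothesis det : nz (fun z => a z * e z - b z * c z).

Let ea := small_entire sa.
Let eb := small_entire sb.
Let ec := small_entire sc.
Let ee := small_entire se.

Let q1 := derive1 h1.
Let sq1 : small mu2 q1. Proof. exact: small_d small_h1. Qed.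
Let sq : small mu2 (derive1 h). Proof. exact: small_d small_h. Qed.

Let s0 := @small_cst R mu2 0.

Lemma quad_or (u v : C R -> C R) F g : entire g ->
  (forall z, nm (F z) = expR (complex.Re (g z))) -> small mu2 u -> small mu2 v -> nz u ->
  (forall z, u z * F z + v z = 0) -> msmall mu2 (repos g).
Proof.
move=> eg FE su sv nu H.
apply: (msmall_quad eg FE su sv s0 nu) => z.
by rewrite addr0 -[RHS](mul0r (F z)) -(H z); ring.
Qed.

(** With [U = a G + b] and [W = c G + e] the relation reads [G1 U = - W], so [W' U - W U' = q1 W U].
    These are the coefficients of [G ^ 2], [1] and [G] in this identity after [G' = h' G]. *)
Let al z := derive1 c z * a z - derive1 a z * c z - q1 z * (a z * c z).
Let ga z := derive1 e z * b z - derive1 b z * e z - q1 z * (b z * e z).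
Let be z := (derive1 c z + c z * derive1 h z) * b z + derive1 e z * a z
  - (derive1 a z + a z * derive1 h z) * e z - derive1 b z * c z
  - q1 z * (c z * b z + e z * a z).

Let quad z : al z * G z ^+ 2 + be z * G z + ga z = 0.
Proof.
pose U := fun z => a z * G z + b z; pose W := fun z => c z * G z + e z.
have eU : entire U := entireD (entireM ea eG) eb.
have eW : entire W := entireD (entireM ec eG) ee.
have UW : (fun z => G1 z * U z) = (fun z => - W z).
  apply/funext => w; apply/eqP; rewrite -addr_eq0; apply/eqP.
  by rewrite -(rel w) /U /W; ring.
have UWz w : G1 w * U w = - W w by rewrite -[LHS]/((fun z => G1 z * U z) w) UW.
have D : derive1 G1 z * U z + G1 z * derive1 U z = - derive1 W z.
  by rewrite -(d1M z eG1 eU) UW (d1N z eW).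
have dU := d1D z (entireM ea eG) eb; rewrite (d1M z ea eG) dG in dU.
have dW := d1D z (entireM ec eG) ee; rewrite (d1M z ec eG) dG in dW.
rewrite -/U in dU; rewrite -/W in dW.
have K : derive1 W z * U z - W z * derive1 U z - q1 z * W z * U z = 0.
  have -> : W z = - (G1 z * U z) by rewrite UWz opprK.
  have -> : derive1 W z = - (derive1 G1 z * U z + G1 z * derive1 U z) by rewrite D opprK.
  by rewrite dG1 -/q1; ring.
rewrite dU dW /U /W in K; rewrite -[RHS]K /al /be /ga.
move: (derive1 a z) (derive1 b z) (derive1 c z) (derive1 e z) (derive1 h z) (q1 z)
  (a z) (b z) (c z) (e z) (G z) => x1 x2 x3 x4 x5 x6 x7 x8 x9 x10 x11.
by ring.
Qed.

Let s_al : small mu2 al.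
Proof.
exact: smallB (smallB (smallM (small_d sc) sa) (smallM (small_d sa) sc))
  (smallM sq1 (smallM sa sc)).
Qed.
Let s_ga : small mu2 ga.
Proof.
exact: smallB (smallB (smallM (small_d se) sb) (smallM (small_d sb) se))
  (smallM sq1 (smallM sb se)).
Qed.
Let s_be : small mu2 be.
Proof.
exact: smallB (smallB (smallB (smallD (smallM (smallD (small_d sc) (smallM sc sq)) sb)
  (smallM (small_d se) sa)) (smallM (smallD (small_d sa) (smallM sa sq)) se))
  (smallM (small_d sb) sc)) (smallM sq1 (smallD (smallM sc sb) (smallM se sa))).
Qed.

(** The identity says that [v / u] has the logarithmic derivative of [G1]. Hence [G1 * u = k * v],
    which makes [G1] a quotient of small functions unless [u] or [v] vanishes. *)
Let ratio_or (u v : C R -> C R) : small mu2 u -> small mu2 v ->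
  (forall z, derive1 v z * u z - derive1 u z * v z - q1 z * (u z * v z) = 0) ->
  msmall mu2 (repos h1) \/ ((forall z, u z = 0) \/ (forall z, v z = 0)).
Proof.
move=> su sv H; have eu := small_entire su; have ev := small_entire sv.
have [u0|nu] := nzP u; first by right; left.
have [v0|nv] := nzP v; first by right; right.
left; have [z|k Hk] := wronskian (entireM eG1 eu) ev nv.
  rewrite (d1M z eG1 eu) dG1 -/q1; have /eqP := H z; rewrite subr_eq0 => /eqP Hz.
  move: Hz; move: (derive1 v z) (derive1 u z) (q1 z) (u z) (v z) (G1 z).
  move=> x1 x2 x3 x4 x5 x6 Hz.
  have -> : (x3 * x6 * x4 + x6 * x2) * x5 = x6 * (x3 * (x4 * x5) + x2 * x5) by ring.
  by rewrite -Hz; ring.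
apply: (quad_or eh1 G1E su (smallN (smallM (@small_cst R mu2 k) sv)) nu) => z.
by rewrite mulrC Hk subrr.
Qed.

(** The relation can be solved for either exponential: if a denominator such as [a G + b] vanished
    identically, then so would [c G + e], and with them the determinant
    [a (c G + e) - c (a G + b)]. *)
Lemma msmall_both : msmall mu2 (repos h) \/ msmall mu2 (repos h1) ->
  msmall mu2 (repos h) /\ msmall mu2 (repos h1).
Proof.
have [z0 dz0] := det.
case=> [mh|mh1]; split => //.
- apply: (msmall_moebius eh eh1 eG GE G1E sa sb sc se _ _ mh).
    have [H|//] := nzP (fun z => a z * G z + b z); exfalso.
    have H1 := H z0; have H2 := rel z0.
    have H3 : c z0 * G z0 + e z0 = 0.
      rewrite -H2 (_ : a z0 * (G z0 * G1 z0) + b z0 * G1 z0 = (a z0 * G z0 + b z0) * G1 z0).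
        by rewrite H1 mul0r add0r.
      by ring.
    move/eqP: dz0; apply.
    have -> : a z0 * e z0 - b z0 * c z0 =
      a z0 * (c z0 * G z0 + e z0) - c z0 * (a z0 * G z0 + b z0) by ring.
    by rewrite H1 H3 !mulr0 subrr.
  move=> z; apply/eqP; rewrite -addr_eq0; apply/eqP; rewrite -(rel z); ring.
- apply: (msmall_moebius eh1 eh eG1 G1E GE sa sc sb se _ _ mh1).
    have [H|//] := nzP (fun z => a z * G1 z + c z); exfalso.
    have H1 := H z0; have H2 := rel z0.
    have H3 : b z0 * G1 z0 + e z0 = 0.
      rewrite -H2 (_ : a z0 * (G z0 * G1 z0) + b z0 * G1 z0 + c z0 * G z0 =
        (a z0 * G1 z0 + c z0) * G z0 + b z0 * G1 z0).
        by rewrite H1 mul0r add0r.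
      by ring.
    move/eqP: dz0; apply.
    have -> : a z0 * e z0 - b z0 * c z0 =
      a z0 * (b z0 * G1 z0 + e z0) - b z0 * (a z0 * G1 z0 + c z0) by ring.
    by rewrite H1 H3 !mulr0 subrr.
  move=> z; apply/eqP; rewrite -addr_eq0; apply/eqP; rewrite -(rel z); ring.
Qed.

Lemma not_both_msmall : nz (derive1 h) ->
  ~ (msmall mu2 (repos h) /\ msmall mu2 (repos h1)).
Proof.
move=> nq [[K HK] [K1 HK1]].
have [m Hm] : exists m, tc h m.+1 != 0.
  apply: contrapT => H; have [z0 /eqP] := nq; apply.
  have -> : derive1 h = fun=> 0; last by [].
  apply: (eq_tc (entire_d eh) (@entire_cst R 0)) => m; rewrite tc_zero (tc_d m eh).
  suff -> : tc h m.+1 = 0 by rewrite mulr0.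
  by apply/eqP/negPn/negP => hm; apply: H; exists m.
(* The coefficient bound gives [mu2 r >= k * r ^ (m + 1) >= k * r], the linear growth that starts
   the blow-up. *)
pose k := nm (tc h m.+1) / 4.
have kp : 0 < k by rewrite divr_gt0 // nm_gt0.
apply: (@growth_contra R mu2 k) => //.
- by move=> r _; rewrite addr_ge0 // absmean_ge0.
- move=> s; have [M M0 HM] := entire_bounded s eh; have [M1 M10 HM1] := entire_bounded s eh1.
  have B g N r : entire g -> (forall z, nm z <= s -> nm (g z) <= N) -> 1 <= r -> r <= s ->
      absmean g r <= N.
    move=> eg HN r1 rs; rewrite -[N](@mean_cst R); apply: mean_le.
    + by apply: continuous_norm_comp; case: (rcont_circle_comp r eg).
    + by move=> t; exact: cvg_cst.
    + move=> t _; apply: le_trans (Re_nm _) (HN _ _); rewrite nm_circle ger0_norm //; lra.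
  by exists (M + M1) => r r1 rs; apply: lerD; apply: B.
- move=> r r1; have r0 : 0 < r by lra.
  have := tc_le_mean m eh r0; rewrite -/(absmean h r) => H.
  have rm : r <= r ^+ m.+1 by rewrite exprS ler_peMr ?exprn_ege1 // ltW.
  have := ler_wpM2l (nm_ge0 (tc h m.+1)) rm.
  by have := absmean_ge0 r eh1; rewrite /mu2 /k; lra.
- have [M HM] := @msmall_cst R mu2 (`|complex.Re (h 0)| + `|complex.Re (h1 0)|).
  exists (2 * K + 2 * K1 + M) => r s r1 rs; have r0 : 0 < r by lra.
  have := HM r s r1 rs; rewrite mean_cst; have := HK r s r1 rs; have := HK1 r s r1 rs.
  rewrite /mu2 /absmean (mean_abs eh r0) (mean_abs eh1 r0) !mulrDl -!mulrA.
  have := ler_norm (- complex.Re (h 0)); have := ler_norm (- complex.Re (h1 0)).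
  by rewrite !normrN; lra.
Qed.

Lemma four_terms : nz (derive1 h) ->
  ((forall z, a z = 0) /\ (forall z, e z = 0)) \/
  ((forall z, b z = 0) /\ (forall z, c z = 0)).
Proof.
move=> nq; have nb := not_both_msmall nq.
have nh : ~ msmall mu2 (repos h) by move=> H; apply: nb; apply: msmall_both; left.
have nh1 : ~ msmall mu2 (repos h1) by move=> H; apply: nb; apply: msmall_both; right.
have al0 z : al z = 0.
  have [//|nal] := nzP al; exfalso; apply: nh.
  exact: (msmall_quad eh GE s_al s_be s_ga nal quad).
have be0 z : be z = 0.
  have [//|nbe] := nzP be; exfalso; apply: nh.
  apply: (quad_or eh GE s_be s_ga nbe) => w.
  by have := quad w; rewrite al0 mul0r add0r.
have ga0 z : ga z = 0 by have := quad z; rewrite al0 be0 !mul0r !add0r.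
(* From [al = 0] one of [a], [c] vanishes, and from [ga = 0] one of [b], [e]; the determinant
   excludes the pairs [a], [b] and [c], [e]. *)
have [/nh1//|ac] := ratio_or sa sc al0.
have [/nh1//|be_] := ratio_or sb se ga0.
have [z0 /eqP dz0] := det.
case: ac => [a0|c0]; case: be_ => [b0|e0].
- by exfalso; apply: dz0; rewrite a0 b0 !mul0r subrr.
- by left.
- by right.
- by exfalso; apply: dz0; rewrite c0 e0 !mulr0 subrr.
Qed.

End FourTerms.

(** * A non-zero exceptional value *)

Section NonzeroExceptionalValue.
Variable R : realType.
Implicit Types (f g h q F G : C R -> C R) (z w c d : C R).

Lemma d1X f m z : entire f ->
  derive1 (fun z => f z ^+ m.+1) z = m.+1%:R * (f z ^+ m * derive1 f z).
Proof.
move=> ef; elim: m => [|m IH].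
  by rewrite expr0 !mul1r; congr (derive1 _ z); apply/funext => w; rewrite expr1.
have -> : (fun z => f z ^+ m.+2) = (fun z => f z * f z ^+ m.+1).
  by apply/funext => w; rewrite exprS.
have eX : entire (fun z => f z ^+ m.+1) by apply: entireXn.
rewrite (d1M z ef eX) IH exprS -[in RHS](natr1 m.+1).
by move: (derive1 f z) (f z) (f z ^+ m) (m.+1%:R) => x1 x2 x3 x4; ring.
Qed.

Lemma mulf_nzl (x y : C R) : x * y != 0 -> x != 0.
Proof. by rewrite mulf_eq0 negb_or => /andP[]. Qed.

Lemma nzX f m : entire f -> nz f -> nz (fun z => f z ^+ m).
Proof. by move=> ef [z fz]; exists z; rewrite expf_neq0. Qed.

Lemma transcendental_nz f c : transcendental_entire f -> nz (fun z => f z + c).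
Proof.
move=> [ef nf]; have [H|//] := nzP (fun z => f z + c); case: nf.
by exists (- c)%:P => z; rewrite hornerC; apply/eqP; rewrite -addr_eq0 H.
Qed.

(** The hypothesis is silent at zeros of the denominators. Multiplied by [f z * f (z + c)] the
    identity holds everywhere, and this nonzero entire factor is then cancelled. *)
Lemma quotient_periodic_mul f g n c : entire f -> entire g -> nz f -> (0 < n)%N ->
  quotient_periodic g (fun z => f z ^+ n) c ->
  forall z, g (z + c) * f z ^+ n = g z * f (z + c) ^+ n.
Proof.
move=> ef eg nf n0 H.
have efc := @entire_shift R f c ef; have egc := @entire_shift R g c eg.
refine (entire_eq_mul (entireM egc (@entireXn R f n ef)) (entireM eg (@entireXn R _ n efc))
  (entireM ef efc) (nzM ef efc nf (nz_shift c nf)) _) => z.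
have [->|f0] := eqVneq (f z) 0; first by rewrite !mul0r !mulr0.
have [->|f1] := eqVneq (f (z + c)) 0; first by rewrite !mulr0.
have := H z (expf_neq0 n f0) (expf_neq0 n f1).
move: (expf_neq0 n f0) (expf_neq0 n f1).
move: (f z ^+ n) (f (z + c) ^+ n) (g z) (g (z + c)) (f z * f (z + c)).
move=> x1 x2 x3 x4 x5 h1 h2 E; congr (_ * _).
have -> : x4 = x4 / x2 * x2 by rewrite divfK.
by rewrite E; field.
Qed.

(* Logarithmic differentiation of P G (G1 + d)^n = P1 G1 (G + d)^n. *)
Lemma log_diff (G G1 P P1 q q1 : C R -> C R) d m : entire G -> entire G1 ->
  entire P -> entire P1 -> entire q -> entire q1 ->
  (forall z, derive1 G z = q z * G z) -> (forall z, derive1 G1 z = q1 z * G1 z) ->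
  nz G -> nz G1 -> nz (fun z => G z + d) -> nz (fun z => G1 z + d) ->
  (forall z, P1 z * G1 z * (G z + d) ^+ m.+1 = P z * G z * (G1 z + d) ^+ m.+1) ->
  let B z := derive1 P z * P1 z - derive1 P1 z * P z + (q z - q1 z) * (P z * P1 z) in
  let Q z := m.+1%:R * (P z * P1 z) in
  forall z, B z * ((G z + d) * (G1 z + d)) +
    Q z * (q1 z * G1 z * (G z + d) - q z * G z * (G1 z + d)) = 0.
Proof.
move=> eG eG1 eP eP1 eq eq1 dG dG1 nG nG1 nf nf1 H B Q.
pose f z := G z + d; pose f1 z := G1 z + d.
have ef : entire f := entireD eG (@entire_cst R d).
have ef1 : entire f1 := entireD eG1 (@entire_cst R d).
have df z : derive1 f z = q z * G z.
  by have := d1D z eG (@entire_cst R d); rewrite d1_cst addr0 dG.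
have df1 z : derive1 f1 z = q1 z * G1 z.
  by have := d1D z eG1 (@entire_cst R d); rewrite d1_cst addr0 dG1.
have eXf := (@entireXn R f m ef); have eXf1 := (@entireXn R f1 m ef1).
have eSf := (@entireXn R f m.+1 ef); have eSf1 := (@entireXn R f1 m.+1 ef1).
have ePP := entireM eP eP1.
have eB : entire B.
  exact: entireD (entireD (entireM (entire_d eP) eP1) (entireN (entireM (entire_d eP1) eP)))
    (entireM (entireD eq (entireN eq1)) ePP).
have eQ : entire Q := entireM (@entire_cst R _) ePP.
pose T z := B z * (f z * f1 z) + Q z * (q1 z * G1 z * f z - q z * G z * f1 z).
have eT : entire T.
  exact: entireD (entireM eB (entireM ef ef1)) (entireM eQ (entireD
    (entireM (entireM eq1 eG1) ef) (entireN (entireM (entireM eq eG) ef1)))).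
have eGG := entireM eG eG1; have eff := entireM eXf eXf1.
have nM := nzM eGG eff (nzM eG eG1 nG nG1) (nzM eXf eXf1 (nzX m ef nf) (nzX m ef1 nf1)).
have LR : (fun z => P1 z * G1 z * f z ^+ m.+1) = (fun z => P z * G z * f1 z ^+ m.+1).
  by apply/funext => z; apply: H.
have TM z : T z * (G z * G1 z * (f z ^+ m * f1 z ^+ m)) = 0.
  have Hz := H z; rewrite -/(f z) -/(f1 z) in Hz.
  have D := d1M z (entireM eP1 eG1) eSf; rewrite LR in D.
  have D' := d1M z (entireM eP eG) eSf1; rewrite {}D' in D.
  rewrite (d1M z eP eG) (d1M z eP1 eG1) (d1X m z ef) (d1X m z ef1) df df1 dG dG1 in D.
  rewrite /T /B /Q; move: D Hz; rewrite !exprS.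
  move: (derive1 P z) (derive1 P1 z) (P z) (P1 z) (q z) (q1 z) (G z) (G1 z) (f z) (f1 z)
    (f z ^+ m) (f1 z ^+ m) (m.+1%:R) => p p1 x x1 u u1 y y1 v v1 r r1 k D Hz.
  set Lf := x1 * y1 * (v * r) in Hz; set Rf := x * y * (v1 * r1) in Hz.
  (* The derivative of one side times the other side, minus the same with the roles exchanged; it
     vanishes because the sides and their derivatives agree. *)
  have -> : (((p * x1 - p1 * x + (u - u1) * (x * x1)) * (v * v1) +
      k * (x * x1) * (u1 * y1 * v - u * y * v1)) * (y * y1 * (r * r1))) =
    ((p * y + x * (u * y)) * (v1 * r1) + x * y * (k * (r1 * (u1 * y1)))) * Lf
   - ((p1 * y1 + x1 * (u1 * y1)) * (v * r) + x1 * y1 * (k * (r * (u * y)))) * Rf.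
    by rewrite /Lf /Rf; ring.
  by rewrite D Hz subrr.
have [//|E] := entire_dom eT (entireM eGG eff) TM.
by exfalso; case: nM => z0; rewrite E eqxx.
Qed.

Lemma periodic_of_nonzero_picard f k n c d : transcendental_entire f ->
  (1 <= k)%N -> (2 <= n)%N ->
  quotient_periodic (derive1n k f) (fun z => f z ^+ n) c ->
  d != 0 -> picard_exceptional f d -> periodic f c \/ periodic f (2%:R * c).
Proof.
move=> tf k1 n2 qp d0 pd; have [ef _] := tf.
pose G z := f z + - d; have eG : entire G := entireD ef (@entire_cst R (- d)).
have G0 z : G z != 0 by rewrite /G subr_eq0; apply: pd.
have fE z : f z = G z + d by rewrite /G subrK.
have [h eh HG] := entire_log eG G0.
pose G1 z := G (z + c); pose h1 z := h (z + c).
have eG1 : entire G1 := @entire_shift R G c eG.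
have eh1 : entire h1 := @entire_shift R h c eh.
have dh1 z : derive1 h1 z = derive1 h (z + c) := d1_shift c z eh.
have dG z : derive1 G z = derive1 h z * G z := (HG z).1.
have dG1 z : derive1 G1 z = derive1 h1 z * G1 z.
  by rewrite dh1 (d1_shift c z eG) dG.
have GE z : nm (G z) = expR (complex.Re (h z)) := (HG z).2.
have G1E z : nm (G1 z) = expR (complex.Re (h1 z)) := GE (z + c).
pose q := derive1 h; pose q1 := derive1 h1.
have eq : entire q := entire_d eh; have eq1 : entire q1 := entire_d eh1.
have q1E : q1 = fun z => q (z + c) by apply/funext => z; apply: dh1.
pose P := dpoly q k; pose P1 := dpoly q1 k.
have eP : entire P := @entire_dpoly R q k eq.
have eP1 : entire P1 := @entire_dpoly R q1 k eq1.
have P1z z : P1 z = P (z + c) by rewrite /P1 q1E dpoly_shift.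
have dff : derive1 f = derive1 G.
  apply/funext => z; have H := d1D z ef (@entire_cst R (- d)).
  exact: esym (etrans H (etrans (congr1 (fun x => derive1 f z + x) (d1_cst (- d) z))
    (addr0 _))).
have dn j : (1 <= j)%N -> derive1n j f = fun z => dpoly q j z * G z.
  case: j => [//|j _]; refine (etrans _ (derive1n_dpoly j.+1 eG eq dG)).
  by rewrite !derive1Sn dff.
have dk : derive1n k f = fun z => P z * G z := dn k k1.
have nP : nz P.
  have [z Hz] := transcendental_dn k tf; exists z.
  by rewrite (congr1 (fun F => F z) dk) in Hz; exact: mulf_nzl Hz.
have nq : nz q.
  have [z Hz] := transcendental_dn 1 tf; exists z.
  have E : derive1n 1 f z = q z * G z.
    exact: etrans (congr1 (fun F => F z) dff) (dG z).
  by rewrite E in Hz; exact: mulf_nzl Hz.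
have nq1 : nz q1 by rewrite q1E; apply: nz_shift.
have nP1 : nz P1.
  by have [z Hz] := nz_shift c nP; exists z; rewrite P1z.
have nG : nz G by exists 0. have nG1 : nz G1 by exists 0; apply: G0.
have nf : nz f by have [z] := transcendental_nz 0 tf; rewrite addr0 => Hz; exists z.
have nf0 : nz (fun z => G z + d) by case: nf => z Hz; exists z; rewrite -fE.
have nf1 : nz (fun z => G1 z + d) by have [z Hz] := nz_shift c nf; exists z; rewrite -fE.
case: n n2 qp => [//|m m1 qp].
have rel0 z : P1 z * G1 z * (G z + d) ^+ m.+1 = P z * G z * (G1 z + d) ^+ m.+1.
  have K := quotient_periodic_mul ef (@entire_dn R f k ef) nf (ltn0Sn m) qp z.
  by rewrite dk (fE z) (fE (z + c)) -(P1z z) in K.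
have := log_diff eG eG1 eP eP1 eq eq1 dG dG1 nG nG1 nf0 nf1 rel0.
set B := fun z => derive1 P z * P1 z - derive1 P1 z * P z + (q z - q1 z) * (P z * P1 z).
set Q := fun z => m.+1%:R * (P z * P1 z).
rewrite -/B -/Q => /= rel.
pose mu := mu2 h h1.
have sh : small mu h := small_h eh eh1. have sh1 : small mu h1 := small_h1 eh eh1.
have sq : small mu q := small_d sh. have sq1 : small mu q1 := small_d sh1.
have sP : small mu P := @small_dpoly R mu q k sq.
have sP1 : small mu P1 := @small_dpoly R mu q1 k sq1.
have sPP := smallM sP sP1.
have sB : small mu B.
  exact: smallD (smallB (smallM (small_d sP) sP1) (smallM (small_d sP1) sP))
    (smallM (smallB sq sq1) sPP).
have sQ : small mu Q := smallM (@small_cst R mu _) sPP.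
have scst x := @small_cst R mu x.
(* Coefficients of [G G1], [G1], [G] and 1 when the relation of [log_diff] is expanded. *)
pose a z := B z + Q z * (q1 z - q z); pose b z := d * (B z + Q z * q1 z).
pose c' z := d * (B z - Q z * q z); pose e z := d * d * B z.
have sa : small mu a := smallD sB (smallM sQ (smallB sq1 sq)).
have sb : small mu b := smallM (scst d) (smallD sB (smallM sQ sq1)).
have sc : small mu c' := smallM (scst d) (smallB sB (smallM sQ sq)).
have se : small mu e := smallM (scst (d * d)) sB.
have rel4 z : a z * (G z * G1 z) + b z * G1 z + c' z * G z + e z = 0.
  have := rel z; rewrite /a /b /c' /e.
  move: (B z) (Q z) (q z) (q1 z) (G z) (G1 z) => x1 x2 x3 x4 x5 x6 E.
  by rewrite -[RHS]E; ring.
have nQ : nz Q.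
  have [z Hz] := nzM eP eP1 nP nP1; exists z; rewrite /Q.
  by apply: mulf_neq0 Hz; rewrite pnatr_eq0.
have eQ := small_entire sQ.
(* All terms with [B] cancel and leave [d^2 Q^2 q q1]; here [d != 0] is essential. *)
have det : nz (fun z => a z * e z - b z * c' z).
  have [z Hz] := nzM (entireM eQ eQ) (entireM eq eq1) (nzM eQ eQ nQ nQ) (nzM eq eq1 nq nq1).
  exists z; suff -> : a z * e z - b z * c' z = d * d * (Q z * Q z * (q z * q1 z)).
    exact: mulf_neq0 (mulf_neq0 d0 d0) Hz.
  rewrite /a /b /c' /e; move: (B z) (Q z) (q z) (q1 z) => x1 x2 x3 x4; ring.
have eqq := entireM eQ eq.
have [[a0 e0]|[b0 c0]] := four_terms eh eh1 eG eG1 GE G1E dG dG1 sa sb sc se rel4 det nq.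
(* Here [B = 0] and [Q q1 = Q q], so the relation reduces to [Q q d (G1 - G) = 0]. *)
- left.
  have B0 z : B z = 0.
    by have /eqP := e0 z; rewrite /e mulf_eq0 (negbTE (mulf_neq0 d0 d0)) => /eqP.
  have Qq z : Q z * q1 z = Q z * q z.
    by apply/eqP; rewrite -subr_eq0 -mulrBr; have := a0 z; rewrite /a B0 add0r => ->.
  have E : forall z, G1 z = G z.
    apply: (entire_eq_mul eG1 eG eqq (nzM eQ eq nQ nq)) => z.
    move: (rel z) (B0 z) (Qq z).
    move: (B z) (Q z) (q z) (q1 z) (G z) (G1 z) => x1 x2 x3 x4 x5 x6 E e1 e2.
    apply: (mulfI d0); apply/eqP; rewrite -subr_eq0 -[X in _ == X]E e1.
    have -> : x2 * (x4 * x6 * (x5 + d) - x3 * x5 * (x6 + d)) =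
      (x2 * x4) * x6 * (x5 + d) - x2 * x3 * x5 * (x6 + d) by ring.
    by rewrite e2; apply/eqP; ring.
  by move=> z; rewrite !fE -[G (z + c)]/(G1 z) E.
(* Here [B = Q q] and [Q q1 = - Q q], so the relation reduces to [Q q (d^2 - G G1) = 0]. Comparing
   [G G1 = d^2] at [z] and at [z + c] gives the period [2 c]. *)
- right.
  have BQ z : B z = Q z * q z.
    by apply/eqP; rewrite -subr_eq0; have /eqP := c0 z; rewrite /c' mulf_eq0 (negbTE d0).
  have BQ1 z : Q z * q1 z = - (Q z * q z).
    have /eqP := b0 z; rewrite /b mulf_eq0 (negbTE d0) BQ addrC addr_eq0 => /eqP.
    by [].
  have E : forall z, G z * G1 z = d * d.
    apply: (entire_eq_mul (entireM eG eG1) (@entire_cst R (d * d)) eqq (nzM eQ eq nQ nq)) => z.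
    move: (rel z) (BQ z) (BQ1 z).
    move: (B z) (Q z) (q z) (q1 z) (G z) (G1 z) => x1 x2 x3 x4 x5 x6 E e1 e2.
    apply/eqP; rewrite -subr_eq0 -oppr_eq0 -[X in _ == X]E e1.
    have -> : x2 * (x4 * x6 * (x5 + d) - x3 * x5 * (x6 + d)) =
      (x2 * x4) * x6 * (x5 + d) - x2 * x3 * x5 * (x6 + d) by ring.
    by rewrite e2; apply/eqP; ring.
  move=> z; rewrite !fE; congr (_ + _); apply: (mulIf (G0 (z + c))).
  have E1 := E z; have E2 := E (z + c); rewrite /G1 in E1 E2.
  rewrite E1 mulr_natl mulr2n addrA [LHS]mulrC; exact: E2.
Qed.

End NonzeroExceptionalValue.

(** * Exceptional value zero and finite hyper-order *)

Section FiniteHyperOrder.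
Variable R : realType.
Implicit Types (f g h q F G : C R -> C R) (r s t x y : R) (z w c d u : C R).

Lemma hyper_order_bound f : (hyper_order f < +oo)%E -> exists (K : nat) (r0 : R), 1 <= r0 /\
  forall r, r0 < r -> nevanlinna_char f r <= expR (r ^+ K).
Proof.
rewrite /hyper_order limf_esupE => /ereal_inf_lt[_ [V [r1 [_ HV]] <-] Hy].
have [M HM] : exists M : R, forall r, V r ->
    ln (ln (nevanlinna_char f r)) / ln r <= M.
  move: Hy; set S := ereal_sup _ => Hy.
  have ub r : V r -> ((ln (ln (nevanlinna_char f r)) / ln r)%:E <= S)%E.
    by move=> Vr; apply: ereal_sup_ubound; exists r.
  move: Hy ub; case: S => [M _ ub|//|_ ub].
    by exists M => r /ub; rewrite lee_fin.
  by exists 0 => r /ub; rewrite leeNy_eq.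
have hb := archi_boundP (normr_ge0 M).
exists (Num.bound `|M|), (Num.max 1 r1); split; first by rewrite le_max lexx.
move=> r; rewrite gt_max => /andP[rg1 rgr].
have r0 : 0 < r by lra.
have lr : 0 < ln r by rewrite ln_gt0.
have := HM r (HV r rgr); rewrite ler_pdivrMr // => H.
set T := nevanlinna_char f r in H *; set K := Num.bound _ in hb *.
have rK : 0 < r ^+ K by rewrite exprn_gt0.
(* For [T <= 1] the outer logarithm takes its default value 0 and carries no information, but then
   the bound is trivial. *)
have [T1|T1] := leP T 1.
  by apply: le_trans T1 _; rewrite -[1](@expR0 R) ler_expR ltW.
have T0 : 0 < T by lra.
have lT : 0 < ln T by rewrite ln_gt0.
rewrite -[T](lnK (T0 : _ \in Num.pos)) ler_expR.
rewrite -(ler_ln (lT : _ \in Num.pos) (rK : _ \in Num.pos)) lnXn // -mulr_natl.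
apply: le_trans H _; rewrite ler_pM2r //.
by have := ler_norm M; lra.
Qed.

Lemma nevanlinna_repos f h r : (forall z, nm (f z) = expR (complex.Re (h z))) ->
  nevanlinna_char f r = mean (fun t => repos h (circle_pt r t)).
Proof.
move=> H; rewrite -[LHS]/(mean (fun t => logplus (nm (f (circle_pt r t))))).
by apply: eq_mean => t; rewrite H /logplus expRK /repos maxC.
Qed.

Definition amean h r := mean (fun t => `|complex.Re (h (circle_pt r t))|).

(** A gap of 1 between the radii suffices: the gauge is then at most the exponential of a
    polynomial, so the logarithm of any of its powers grows polynomially. *)
Lemma small_ln_bound f h g : entire h -> (forall z, nm (f z) = expR (complex.Re (h z))) ->
  (hyper_order f < +oo)%E -> small (amean h) g ->
  exists (A r0 : R) (N : nat), [/\ 0 <= A, 1 <= r0 &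
    forall r z, r0 <= r -> nm z <= r -> lnp g z <= A * (r + 1) ^+ N].
Proof.
move=> eh fE ho [eg [M HM]]; have [K [r0 [r01 HK]]] := hyper_order_bound ho.
pose B := `|complex.Re (h 0)| + 8; exists (M.+1%:R * (B + 2)), r0, K.+1.
have B0 : 0 <= B by rewrite /B; have := normr_ge0 (complex.Re (h 0)); lra.
have M0 : 0 <= M.+1%:R :> R by [].
split => //; first by rewrite mulr_ge0 //; lra.
move=> r z rr0 zr; have r1 : 1 <= r by lra. have rs : r < r + 1 by lra.
set s := r + 1 in rs *.
have g2 := gauge_ge2 (amean h) r1 rs; set Ga := gauge (amean h) r s in g2.
have G0 : 0 < Ga by lra.
have s1 : 1 <= s by rewrite /s; lra. have s0 : 0 < s by rewrite /s; lra.
have a0 : 0 <= amean h s.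
  rewrite -[0](@mean_cst R); apply: mean_le => //; first by move=> t; exact: cvg_cst.
  by apply: continuous_norm_comp; case: (rcont_circle_comp s eh).
have am : amean h s <= 2 * expR (s ^+ K) + `|complex.Re (h 0)|.
  rewrite /amean (mean_abs eh s0) -(nevanlinna_repos _ fE).
  have := HK s (le_lt_trans rr0 rs); have := ler_norm (- complex.Re (h 0)).
  by rewrite normrN; lra.
have sK : 1 <= s ^+ K by rewrite exprn_ege1.
have GB : Ga <= expR (s ^+ K + (s + B)).
  have e1 : 1 <= expR (s ^+ K) by rewrite -[1](@expR0 R) ler_expR; lra.
  have e2 : s + B + 1 <= expR (s + B) by have := expR_ge1Dx (s + B); lra.
  have -> : Ga = 2 + amean h s + s + 1.
    have sr : s - r = 1 by rewrite /s; ring.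
    by rewrite /Ga /gauge (ger0_norm a0) sr invr1.
  rewrite expRD; apply: (@le_trans _ _ (expR (s ^+ K) * (s + B + 1))).
    rewrite /B; have := normr_ge0 (complex.Re (h 0)); nra.
  by rewrite ler_wpM2l // expR_ge0.
have lG : ln Ga <= (B + 2) * s ^+ K.+1.
  apply: (@le_trans _ _ (s ^+ K + (s + B))).
    by rewrite -[leRHS]expRK; apply: ln_le.
  rewrite exprS; have : s <= s * s ^+ K by rewrite ler_peMr // ltW.
  have : s ^+ K <= s * s ^+ K by rewrite ler_peMl //; lra.
  have : B <= B * (s * s ^+ K).
    by rewrite ler_peMr //; nra.
  by lra.
rewrite -mulrA; apply: (@le_trans _ _ (M.+1%:R * ln Ga)); last by rewrite ler_wpM2l.
rewrite mulr_natl -lnXn // /lnp; apply: ln_le.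
  by have := nm_ge0 (g z); lra.
have b : nm (g z) <= Ga ^+ M := HM r s r1 rs z zr.
have : 1 <= Ga ^+ M by rewrite exprn_ege1 //; lra.
rewrite exprS; nra.
Qed.

Lemma zero_of_growth (x A B D r0 : R) (N m : nat) : 0 <= x -> 0 <= A -> 0 <= B -> 0 <= D ->
  (N <= m)%N -> (forall r, r0 <= r -> x * r ^+ m.+1 <= A * (r + B) ^+ N + D) -> x = 0.
Proof.
move=> x0 A0 B0 D0 Nm H; apply/eqP; rewrite eq_le x0 andbT leNgt; apply/negP => xp.
pose k := A * 2 ^+ N + D; have k0 : 0 <= k by rewrite /k addr_ge0 // mulr_ge0 // exprn_ge0.
pose r := `|r0| + B + 1 + k / x.
have kx : 0 <= k / x by rewrite divr_ge0.
have rn := ler_norm r0; have rn0 := normr_ge0 r0.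
have r1 : 1 <= r by rewrite /r; lra.
have := H r; rewrite /r -/r; have -> : r0 <= r by rewrite /r; lra.
move=> /(_ isT) Hr.
have p1 : (r + B) ^+ N <= 2 ^+ N * r ^+ m.
  apply: (@le_trans _ _ ((2 * r) ^+ N)).
    by rewrite lerXn2r ?nnegrE //; rewrite /r; lra.
  by rewrite exprMn ler_wpM2l ?exprn_ge0 // ler_weXn2l.
have rm : 1 <= r ^+ m by rewrite exprn_ege1.
have p2 : x * r ^+ m.+1 <= k * r ^+ m.
  apply: le_trans Hr _; rewrite /k mulrDl; apply: lerD; last by rewrite ler_peMr.
  by rewrite -mulrA ler_wpM2l.
have rmp : 0 < r ^+ m by lra.
move: p2; rewrite exprS mulrA ler_pM2r // => p3.
have : x * (k / x + 1) <= x * r by rewrite ler_pM2l // /r; lra.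
have -> : x * (k / x + 1) = k + x by field; rewrite gt_eqF.
by lra.
Qed.

(** * Finite differences *)

Definition dl c g : C R -> C R := fun z => g (z + c) - g z.
(** These functions form an algebra that contains the polynomials and is closed under derivation; it
    therefore contains [dpoly q k] as soon as it contains [q]. *)
Definition nilp c g := exists N : nat, forall z, iter N (dl c) g z = 0.

Lemma eq_iter_dl c g g' N : g =1 g' -> iter N (dl c) g =1 iter N (dl c) g'.
Proof. by move=> E z; have -> : g = g' by apply/funext. Qed.

Lemma iter_dlD c N g g' z :
  iter N (dl c) (fun z => g z + g' z) z = iter N (dl c) g z + iter N (dl c) g' z.
Proof.
elim: N g g' z => [//|N IH] g g' z; rewrite !iterSr -IH.
by apply: eq_iter_dl => w; rewrite /dl opprD addrACA.
Qed.

Lemma iter_dl_shift c N g w z :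
  iter N (dl c) (fun z => g (z + w)) z = iter N (dl c) g (z + w).
Proof.
elim: N g z => [//|N IH] g z; rewrite !iterSr -IH.
by apply: eq_iter_dl => x; rewrite /dl (addrAC x c w).
Qed.

Lemma iter_dl0 c N g z : (forall z, g z = 0) -> iter N (dl c) g z = 0.
Proof.
elim: N g z => [|N IH] g z H; first exact: H.
by rewrite iterSr; apply: IH => w; rewrite /dl !H subrr.
Qed.

Lemma iter_dl_more c N M g : (forall z, iter N (dl c) g z = 0) ->
  forall z, iter (M + N) (dl c) g z = 0.
Proof. by move=> H z; rewrite iterD; apply: iter_dl0. Qed.

(** In the twisted Leibniz rule each term lowers one of the two orders, and the shift that appears
    commutes with differences. *)
Lemma iter_dlM c n a b g g' : (a + b = n)%N ->
  (forall z, iter a (dl c) g z = 0) -> (forall z, iter b (dl c) g' z = 0) ->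
  forall z, iter n (dl c) (fun z => g z * g' z) z = 0.
Proof.
elim: n a b g g' => [|n IH] a b g g' ab Ha Hb z.
  have a0 : a = 0%N by lia.
  by rewrite a0 in Ha; have := Ha z => /= ->; rewrite mul0r.
case: a ab Ha => [|a] ab Ha.
  by apply: iter_dl0 => w; have := Ha w => /= ->; rewrite mul0r.
case: b ab Hb => [|b] ab Hb.
  by apply: iter_dl0 => w; have := Hb w => /= ->; rewrite mulr0.
rewrite iterSr.
have -> : dl c (fun z => g z * g' z) =
    fun z => dl c g z * g' (z + c) + g z * dl c g' z.
  by apply/funext => w; rewrite /dl; ring.
rewrite iter_dlD (IH a b.+1) ?(IH a.+1 b) ?addr0 //; try lia.
- by move=> w; rewrite -iterSr.
- by move=> w; rewrite -iterSr.
- by move=> w; rewrite iter_dl_shift.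
Qed.

Lemma nilpD c g g' : nilp c g -> nilp c g' -> nilp c (fun z => g z + g' z).
Proof.
move=> [a Ha] [b Hb]; exists (a + b)%N => z; rewrite iter_dlD.
by rewrite (iter_dl_more a Hb) addnC (iter_dl_more b Ha) addr0.
Qed.

Lemma nilpM c g g' : nilp c g -> nilp c g' -> nilp c (fun z => g z * g' z).
Proof. by move=> [a Ha] [b Hb]; exists (a + b)%N => z; apply: iter_dlM Ha Hb z. Qed.

Lemma nilp_cst c (x : C R) : nilp c (fun=> x).
Proof. by exists 1%N => z; rewrite /= /dl subrr. Qed.

Lemma nilp_id c : nilp c (fun z => z).
Proof. by exists 2%N => z; rewrite /= /dl; ring. Qed.

Lemma nilp_poly c (p : {poly C R}) : nilp c (fun z => p.[z]).
Proof.
elim/poly_ind: p => [|p x IH].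
  have -> : (fun z => (0 : {poly C R}).[z]) = fun=> 0.
    by apply/funext => z; rewrite horner0.
  exact: nilp_cst.
have -> : (fun z => (p * 'X + x%:P).[z]) = fun z => p.[z] * z + x.
  by apply/funext => z; rewrite hornerMXaddC.
exact: nilpD (nilpM IH (nilp_id c)) (nilp_cst c x).
Qed.

Lemma iter_dl_entire c N g : entire g -> entire (iter N (dl c) g).
Proof.
elim: N g => [//|N IH] g eg; rewrite iterSr; apply: IH.
exact: entireD (@entire_shift R g c eg) (entireN eg).
Qed.

Lemma dl_d1 c g : entire g -> dl c (derive1 g) = derive1 (dl c g).
Proof.
move=> eg; have es := @entire_shift R g c eg; have en := entireN eg.
apply/funext => z; have H := d1D z es en.
by rewrite (d1N z eg) (d1_shift c z eg) in H; exact: esym H.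
Qed.

Lemma iter_dl_d1 c N g : entire g -> iter N (dl c) (derive1 g) = derive1 (iter N (dl c) g).
Proof.
move=> eg; elim: N => [//|N IH].
exact: etrans (congr1 (dl c) IH) (dl_d1 c (@iter_dl_entire c N g eg)).
Qed.

Lemma nilp_d c g : entire g -> nilp c g -> nilp c (derive1 g).
Proof.
move=> eg [N H]; exists N => z; rewrite (iter_dl_d1 c N eg).
have -> : iter N (dl c) g = fun=> 0 by apply/funext.
exact: d1_cst.
Qed.

Lemma nilp_dpoly c q j : entire q -> nilp c q -> nilp c (dpoly q j).
Proof.
move=> eq nq; elim: j => [|j IH]; first exact: nilp_cst.
exact: nilpD (nilp_d (@entire_dpoly R q j eq) IH) (nilpM nq IH).
Qed.

(** * Growth along a ray *)

Lemma circle1X t n : circle_pt 1 t ^+ n = circle_pt 1 (n%:R * t) :> C R.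
Proof.
elim: n => [|n IH].
  by rewrite expr0 mul0r; apply: C_eq; rewrite /= ?cos0 ?sin0; ring.
by rewrite exprS IH -circle1D -natr1; congr circle_pt; ring.
Qed.

Lemma unit_direction (a : C R) n : exists2 u, nm u = 1 & a * u ^+ n.+1 = rC (nm a).
Proof.
have [t _ aE] := polar a; exists (circle_pt 1 (- t / n.+1%:R)).
  by rewrite nm_circle normr1.
have e : n.+1%:R * (- t / n.+1%:R) = - t by rewrite mulrC divfK // pnatr_eq0.
rewrite circle1X e {1}aE circleE -mulrA -circle1D subrr.
by rewrite (_ : circle_pt 1 0 = 1) ?mulr1 //; apply: C_eq; rewrite /= ?cos0 ?sin0; ring.
Qed.

(** The direction [u] makes the leading term real and positive. Translating [p] keeps its leading
    coefficient, so one direction serves every base point [w]; the recursion of [yseq] needs several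
    at once. *)
Lemma poly_ray (p : {poly C R}) : (1 < size p)%N ->
  exists2 u, nm u = 1 & forall w (B : R), exists t0 : R, forall t, t0 <= t ->
    B <= complex.Re p.[rC t * u + w].
Proof.
move=> sp; set a := lead_coef p.
have [n nE] : exists n, size p = n.+2 by exists (size p).-2; lia.
have [u u1 uE] := unit_direction a n; exists u => // w B.
pose r := p \Po ('X + w%:P).
have sx : size ('X + w%:P) = 2%N by rewrite size_XaddC.
have sr : size r = n.+2 by rewrite /r size_comp_poly2.
have lr : r`_n.+1 = a.
  have sx1 : (1 < size ('X + w%:P)%R)%N by rewrite sx.
  have := lead_coef_comp p sx1.
  rewrite -/r lead_coefE sr /= => ->.
  by rewrite lead_coefXaddC expr1n mulr1.
have an : 0 < nm a.
  by rewrite nm_gt0 lead_coef_eq0 -size_poly_gt0 nE.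
pose K := \sum_(i < n.+1) nm r`_i.
have K0 : 0 <= K by apply: sumr_ge0 => i _; exact: nm_ge0.
exists (1 + (`|B| + K) / nm a) => t tt.
have bk : 0 <= (`|B| + K) / nm a by rewrite divr_ge0 ?addr_ge0 // ltW.
have t1 : 1 <= t by lra.
have -> : p.[rC t * u + w] = r.[rC t * u].
  by rewrite /r horner_comp hornerD hornerX hornerC.
rewrite horner_coef sr big_ord_recr /= lr exprMn mulrCA uE ReD.
have -> : complex.Re (rC t ^+ n.+1 * rC (nm a)) = t ^+ n.+1 * nm a by rewrite -rCX -rCM.
set S := \sum_(i < n.+1) _.
have SB : nm S <= K * t ^+ n.
  apply: le_trans (@nm_sum _ _ (fun i => r`_i * (rC t * u) ^+ i)) _.
  rewrite /K mulr_suml; apply: ler_sum => i _; rewrite nmM nmX nmM nm_rC u1 mulr1.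
  rewrite (ger0_norm (_ : 0 <= t)); last by lra.
  by rewrite ler_wpM2l ?nm_ge0 // ler_weXn2l // -ltnS.
have := le_trans (Re_nm S) SB; rewrite ler_norml => /andP[S1 _].
have tn : 1 <= t ^+ n by rewrite exprn_ege1.
have ta : `|B| + K + nm a <= t * nm a.
  have -> : `|B| + K + nm a = (1 + (`|B| + K) / nm a) * nm a by field; rewrite gt_eqF.
  by rewrite ler_pM2r.
have := ler_norm B; have := normr_ge0 B => b0 bb.
rewrite exprS; have : (`|B| + K) * t ^+ n <= t * nm a * t ^+ n by rewrite ler_pM2r; lra.
have : `|B| <= `|B| * t ^+ n by rewrite ler_peMr.
by move: (t ^+ n) S1 => tt_n; lra.
Qed.

(* Delta^N P(z) = Y_N(z) P(z + Nc), and Y_N tends to 1 along the ray. *)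
Fixpoint yseq c (ep : C R -> C R) N : C R -> C R :=
  if N is M.+1 then
    fun z => yseq c ep M (z + c) - yseq c ep M z * (ep (z + M%:R * c))^-1
  else fun=> 1.

Lemma entire_yseq c ep N : entire ep -> (forall z, ep z != 0) -> entire (yseq c ep N).
Proof.
move=> ee e0; elim: N => [|N IH]; first exact: entire_cst.
have es := @entire_shift R ep (N%:R * c) ee.
have ev := entireV es (fun z => e0 _).
exact: entireD (@entire_shift R _ c IH) (entireN (entireM IH ev)).
Qed.

Lemma dl_yseq c ep P N : (forall z, ep z != 0) -> (forall z, P (z + c) = P z * ep z) ->
  forall z, iter N (dl c) P z = yseq c ep N z * P (z + N%:R * c).
Proof.
move=> e0 HP; elim: N => [|N IH] z; first by rewrite /= mul0r addr0 mul1r.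
rewrite iterS /dl !IH /=.
have -> : z + c + N%:R * c = z + N.+1%:R * c by rewrite -natr1; ring.
have -> : P (z + N.+1%:R * c) = P (z + N%:R * c) * ep (z + N%:R * c).
  by rewrite -HP -natr1; congr P; ring.
move: (e0 (z + N%:R * c)); move: (ep _) (P _) (yseq c ep N z) (yseq c ep N (z + c)).
by move=> x1 x2 x3 x4 h1; field.
Qed.

Lemma yseq_lim c ep (ray : R -> C R) N :
  (forall w (B : R), exists t0 : R, forall t, t0 <= t -> B <= nm (ep (ray t + w))) ->
  forall w (e : R), 0 < e -> exists t0 : R, forall t, t0 <= t ->
    nm (yseq c ep N (ray t + w) - 1) <= e.
Proof.
move=> H; elim: N => [|N IH] w e e0.
  by exists 0 => t _ /=; rewrite subrr nm0 ltW.
have e2 : 0 < e / 2 by rewrite divr_gt0.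
have [t1 H1] := IH (w + c) _ e2; have [t2 H2] := IH w 1 ltr01.
(* As [nm y1 <= 2], this lower bound makes the correction [y1 / x] at most [e / 2]. *)
have [t3 H3] := H (w + N%:R * c) (4 / e).
exists (Num.max t1 (Num.max t2 t3)) => t; rewrite !ge_max => /and3P[h1 h2 h3] /=.
have := H1 t h1; have := H2 t h2; have := H3 t h3; rewrite !addrA.
set y1 := yseq _ _ _ _; set y2 := yseq _ _ _ _; set x := ep _ => k3 k2 k1.
have -> : y2 - y1 * x^-1 - 1 = (y2 - 1) - y1 * x^-1 by ring.
apply: le_trans (nmB _ _) _; rewrite nmM nmV.
have x0 : 0 < nm x by apply: lt_le_trans k3; rewrite divr_gt0.
have y12 : nm y1 <= 2.
  have -> : y1 = (y1 - 1) + 1 by ring.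
  by apply: le_trans (nmD _ _) _; rewrite nm1; lra.
have : nm y1 / nm x <= e / 2.
  rewrite ler_pdivrMr //; apply: le_trans y12 _.
  by move: k3; rewrite ler_pdivrMr // mulrC => ?; lra.
by lra.
Qed.

Lemma growth_arith (x y A X b d : R) : y <= 2 * A * X + b -> - x <= d ->
  4 * (2 * y - x) <= 16 * A * X + (8 * b + 4 * d).
Proof. by move: (A * X) => Y; lra. Qed.

Lemma periodic_of_zero_picard f k n c : transcendental_entire f -> (2 <= n)%N ->
  quotient_periodic (derive1n k f) (fun z => f z ^+ n) c ->
  picard_exceptional f 0 -> (hyper_order f < +oo)%E -> periodic f ((n - 1)%N%:R * c).
Proof.
move=> tf n2 qp f0 ho; have [ef _] := tf.
have [h eh Hh] := entire_log ef f0.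
have dF z : derive1 f z = derive1 h z * f z := (Hh z).1.
have fE z : nm (f z) = expR (complex.Re (h z)) := (Hh z).2.
pose q := derive1 h; have ehd : entire q := entire_d eh.
pose P := dpoly q k; have eP : entire P := @entire_dpoly R q k ehd.
have dk : derive1n k f = fun z => P z * f z := derive1n_dpoly k ef ehd dF.
have nP : nz P.
  have [z Hz] := transcendental_dn k tf; exists z.
  by rewrite (congr1 (fun F => F z) dk) in Hz; exact: mulf_nzl Hz.
have nf : nz f by exists 0; apply: f0.
have efc := @entire_shift R f c ef.
pose E z := f (z + c) * (f z)^-1; have eE : entire E := entireM efc (entireV ef f0).
have E0 z : E z != 0.
  by rewrite /E; apply: mulf_neq0; [exact: f0|rewrite invr_eq0; exact: f0].
have fc z : f (z + c) = E z * f z by rewrite /E divfK //; exact: f0.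
have [g eg Hg] := entire_log eE E0.
have dE z : derive1 E z = derive1 g z * E z := (Hg z).1.
have EE z : nm (E z) = expR (complex.Re (g z)) := (Hg z).2.
(* From here on [n] is [m + 2], so the exponent [n - 1] of [E] is [m + 1]. *)
case: n n2 qp => [//|[//|m]] _ qp; rewrite subn1 /=.
have PE z : P (z + c) = P z * E z ^+ m.+1.
  have K := quotient_periodic_mul ef (@entire_dn R f k ef) nf (ltn0Sn _) qp z.
  rewrite dk fc in K; have Ez := E0 z; have fz : f z != 0 := f0 z.
  move: K Ez fz; rewrite exprS (exprS (E z * f z)).
  move: (P (z + c)) (P z) (E z) (f z) => x1 x2 x3 x4 K h1 h2.
  apply: (mulIf h1); apply: (mulIf h2); apply: (mulIf h2); apply: (mulIf (expf_neq0 m.+1 h2)).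
  rewrite exprMn in K; move: (x3 ^+ m.+1) (x4 ^+ m.+1) K => x5 x6 K.
  have -> : x1 * x3 * x4 * x4 * x6 = x1 * (x3 * x4) * (x4 * x6) by ring.
  by rewrite K; ring.
clear dk; have sh : small (amean h) h by apply: small_of_mean.
have sP : small (amean h) P := @small_dpoly R _ q k (small_d sh).
have [A [r0 [N [A0 r01 HA]]]] := small_ln_bound eh fE ho sP; clear ho.
have [M HM] := jensen eP nP.
have ePc := @entire_shift R P c eP.
pose nc := nm c; have nc0 : 0 <= nc := nm_ge0 c.
(* Where [P] is nonzero, [E ^ (m + 1) = P(. + c) / P], and [repos g] is at most [m + 1] times
   itself; Jensen's inequality for [P] bounds its mean by the logarithmic size of [P] on a slightly
   larger disc. *)
have MG r : r0 <= r -> mean (fun t => repos g (circle_pt r t)) <=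
    2 * A * (r + (nc + 1)) ^+ N + `|M|.
  move=> rr; have r1 : 1 <= r by lra.
  pose v t := lnp (fun z => P (z + c)) (circle_pt r t) + lnp P (circle_pt r t).
  have cv : continuous v := ccontD (ccont_lnp ePc) (ccont_lnp eP) (r := r).
  apply: le_trans (HM r _ v r1 (ccont_repos eg (r := r)) cv _) _.
    move=> t; set z := circle_pt r t => Pz; rewrite /v -/z /lnp PE nmM nmX EE.
    have p0 : 0 < nm (P z) by rewrite nm_gt0.
    have lp : ln (nm (P z)) <= ln (1 + nm (P z)) by apply: ln_le => //; lra.
    have x0 : 0 < expR (complex.Re (g z)) ^+ m.+1 by rewrite exprn_gt0 // expR_gt0.
    have px : 0 < nm (P z) * expR (complex.Re (g z)) ^+ m.+1 by rewrite mulr_gt0.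
    have l0 : 0 <= ln (1 + nm (P z) * expR (complex.Re (g z)) ^+ m.+1).
      by rewrite ln_ge0; lra.
    rewrite /repos ge_max; apply/andP; split; last by lra.
    have [gz|gz] := leP (complex.Re (g z)) 0; first by lra.
    have : ln (nm (P z) * expR (complex.Re (g z)) ^+ m.+1) <=
      ln (1 + nm (P z) * expR (complex.Re (g z)) ^+ m.+1) by apply: ln_le => //; lra.
    rewrite lnM ?posrE // lnXn ?expR_gt0 // expRK -mulr_natl.
    have : complex.Re (g z) <= m.+1%:R * complex.Re (g z).
      by rewrite ler_peMl ?ler1n // ltW.
    have : 0 <= ln (1 + nm (P z)) by rewrite ln_ge0; lra.
    by lra.
  apply: lerD; last exact: ler_norm.
  rewrite -[leRHS](@mean_cst R); apply: mean_le => //; first by move=> t; exact: cvg_cst.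
  move=> t _; have zr : nm (circle_pt r t) <= r by rewrite nm_circle ger0_norm //; lra.
  have zc : nm (circle_pt r t + c) <= r + nc by apply: le_trans (nmD _ _) _; rewrite lerD2r.
  have b1 : lnp P (circle_pt r t + c) <= A * (r + (nc + 1)) ^+ N.
    by rewrite addrA; apply: HA => //; lra.
  have b2 : lnp P (circle_pt r t) <= A * (r + (nc + 1)) ^+ N.
    apply: le_trans (HA r _ rr zr) _; rewrite ler_wpM2l // lerXn2r ?nnegrE //; lra.
  have -> : 2 * A * (r + (nc + 1)) ^+ N = A * (r + (nc + 1)) ^+ N + A * (r + (nc + 1)) ^+ N.
    by rewrite -mulrA mulr_natl mulr2n.
  exact: lerD.
(* Polynomial growth of the mean of [|Re g|] leaves no coefficient of index above [N]. *)
have tg i : tc g (i + N.+1) = 0.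
  apply/eqP; rewrite -nm_eq0; apply/eqP; rewrite addnS.
  have A80 : 0 <= 16 * A by rewrite mulr_ge0.
  have nB : 0 <= nc + 1 by lra.
  have D0 : 0 <= 8 * `|M| + 4 * `|complex.Re (g 0)| by rewrite addr_ge0 // mulr_ge0.
  apply: (zero_of_growth (nm_ge0 _) A80 nB D0 (leq_addl i N)) => r rr.
  have rp : 0 < r := lt_le_trans (lt_le_trans ltr01 r01) rr.
  apply: le_trans (tc_le_mean (i + N) eg rp) _; rewrite (mean_abs eg rp).
  by apply: growth_arith (MG r rr) _; rewrite -normrN ler_norm.
pose p := \poly_(i < N.+1) tc g i.
have gp z : g z = p.[z] := tc_poly eg tg z.
have ng : nilp c g.
  by have -> : g = fun z => p.[z] by [apply/funext]; apply: nilp_poly.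
(* Logarithmic derivatives of [f(. + c) = E f]; as [g'] is a polynomial, [q] is annihilated by one
   more difference than [g']. *)
have dq : dl c q = derive1 g.
  apply/funext => z; have efz := d1_shift c z ef.
  have D : derive1 (fun z => f (z + c)) z = derive1 E z * f z + E z * derive1 f z.
    rewrite -(d1M z eE ef); congr (derive1 _ z); apply/funext => w; exact: fc.
  rewrite efz dF fc dE dF in D; rewrite /dl.
  have Ez := E0 z; have fz : f z != 0 := f0 z.
  move: D Ez fz; rewrite -/q.
  move: (q (z + c)) (q z) (derive1 g z) (E z) (f z) => x1 x2 x3 x4 x5 D h1 h2.
  apply: (mulIf h1); apply: (mulIf h2).
  have -> : (x1 - x2) * x4 * x5 = x1 * (x4 * x5) - x2 * x4 * x5 by ring.
  by rewrite D; ring.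
have nq : nilp c q.
  have [j Hj] := nilp_d eg ng; exists j.+1 => z.
  by rewrite iterSr dq.
clear dq; have [j Hj] : nilp c P := nilp_dpoly k ehd nq.
pose ep z := E z ^+ m.+1; have ee : entire ep := @entireXn R E m.+1 eE.
have ep0 z : ep z != 0 by rewrite expf_neq0.
have [sp|sp] := leqP (size p) 1.
  have dg0 z : derive1 g z = 0.
    have -> : g = fun=> p`_0; last exact: d1_cst.
    by apply/funext => w; rewrite gp (size1_polyC sp) hornerC coefC.
  have Ec z : E z = E 0 by apply: (entire_d0_cst eE) => w; rewrite dE dg0 mul0r.
  (* For constant [E] each difference multiplies [P] by [E 0 ^ (m + 1) - 1]; since some iterate
     vanishes and [P] does not, this factor is 0. *)
  have om : E 0 ^+ m.+1 = 1.
    have [z0 Pz0] := nP; pose x := E 0 ^+ m.+1 - 1.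
    have it i z : iter i (dl c) P z = x ^+ i * P z.
      elim: i z => [|i IH] z; first by rewrite expr0 mul1r.
      rewrite iterS /dl !IH (PE z) (Ec z) (exprS x i) {3}/x.
      by move: (E 0 ^+ m.+1) (P z) (x ^+ i) => y1 y2 y3; ring.
    have := Hj z0; rewrite it => /eqP; rewrite mulf_eq0 (negbTE Pz0) orbF.
    by rewrite expf_eq0 => /andP[_]; rewrite subr_eq0 => /eqP.
  have it i z : f (z + i%:R * c) = E 0 ^+ i * f z.
    elim: i z => [|i IH] z; first by rewrite mul0r addr0 mul1r.
    have -> : z + i.+1%:R * c = (z + i%:R * c) + c by rewrite -natr1; ring.
    by rewrite fc Ec IH exprS mulrA.
  by move=> z; rewrite it om mul1r.
(* For nonconstant [g] the function [yseq c ep j] is close to 1 somewhere on the ray, hence nonzero;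
   its product with [P(. + j c)] is the vanishing [j]-th difference, a contradiction. *)
exfalso; have [u u1 Hu] := poly_ray sp.
have Hray w (B : R) : exists t0 : R, forall t, t0 <= t -> B <= nm (ep (rC t * u + w)).
  have [t0 Ht] := Hu w (Num.max B 0); exists t0 => t /Ht.
  rewrite ge_max -gp /ep nmX EE => /andP[]; set x := complex.Re _ => Bx x0.
  apply: (@le_trans _ _ (expR x)).
    by apply: le_trans Bx _; have := expR_ge1Dx x; lra.
  rewrite exprS ler_peMr ?expR_ge0 // exprn_ege1 //.
  by rewrite -[1](@expR0 R) ler_expR.
have half : 0 < 1 / 2 :> R by rewrite divr_gt0.
have [t0 Ht0] := @yseq_lim c ep (fun t => rC t * u) j Hray 0 (1 / 2) half.
have eY := @entire_yseq c ep j ee ep0.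
have nY : nz (yseq c ep j).
  exists (rC t0 * u + 0); apply/eqP => Y0; have := Ht0 t0 (lexx _).
  by rewrite Y0 sub0r nmN nm1; lra.
have eS := @entire_shift R P (j%:R * c) eP.
have [z] := nzM eY eS nY (nz_shift (j%:R * c) nP).
by rewrite -(dl_yseq j ep0 PE) Hj eqxx.
Qed.

End FiniteHyperOrder.

Theorem theorem3p2 (R : realType) (f : C R -> C R) (k n : nat) (c : C R)
    (f_transc : transcendental_entire f) (k_ge1 : (1 <= k)%N) (n_ge2 : (2 <= n)%N)
    (c_neq0 : c != 0)
    (quot_per : quotient_periodic (derive1n k f) (fun z => f z ^+ n) c)
    (f_picard :
       (picard_exceptional f 0 /\ (hyper_order f < +oo)%E) \/
       (exists d : C R, d != 0 /\ picard_exceptional f d)) :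
  periodic f c \/ periodic f (2%:R * c) \/ periodic f ((n - 1)%N%:R * c).
Proof.
case: f_picard => [[f0 ho]|[d [d0 fd]]].
- by right; right; exact: periodic_of_zero_picard quot_per f0 ho.
- have [H|H] := periodic_of_nonzero_picard f_transc k_ge1 n_ge2 quot_per d0 fd.
  + by left.
  + by right; left.
Qed.
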